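(* Write a dominant coweight $\lambda=\omega_{i_1}+\ldots+\omega_{i_r}$ as a sum of fundamental coweights, and write $\underline\lambda$ for this ordered decomposition. Let $\mathcal P_{\underline\lambda}$ be the path model of LS-paths of shape $\underline\lambda$, having as starting path the concatenation $\pi_{\omega_{i_1}}*\cdots*\pi_{\omega_{i_r}}$. For $\pi\in\mathcal P_{\underline\lambda}$ let $\gamma_\pi$ be the associated gallery in the one-skeleton of $\mathbb A$, obtained as the sequence of edges and vertices lying on the path. The one-skeleton galleries $\gamma_\pi$, $\pi\in\mathcal P_{\underline\lambda}$, are precisely the LS-galleries of the same type as $\gamma_{\omega_{i_1}}*\cdots*\gamma_{\omega_{i_r}}$.
   Context: **Root data and apartment.** $G$ is a connected complex semisimple group with maximal torus $T$, roots $\Phi$, positive roots $\Phi^+$, simple roots $\alpha_1,\dots,\alpha_n$, coroots $\alpha^\vee$, $\rho$ half the sum of the positive roots, Weyl group $W$ (Bruhat order). $\mathbb A=X^\vee\otimes\mathbb R$ with origin $\mathfrak o$, $X^\vee$ the cocharacter group; the fundamental coweights $\omega_i\in\mathbb A$ satisfy $\langle\omega_i,\alpha_j\rangle=\delta_{ij}$. For $\alpha\in\Phi,n\in\mathbb Z$: $H_{\alpha,n}=\{x:\langle\alpha,x\rangle+n=0\}$, $H^\pm_{\alpha,n}$ the closed half-spaces $\pm(\langle\alpha,x\rangle+n)\ge0$, $s_{\alpha,n}$ the affine reflection $x\mapsto x-(\langle\alpha,x\rangle+n)\alpha^\vee$, $W^{\mathfrak a}$ the group they generate. Faces of $\mathbb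 A$ are the closed faces of this hyperplane arrangement; vertices and edges are faces of dimension $0$ and $1$; $F^o$ is the open face. A vertex is special if for every root $\alpha$ it lies on some $H_{\alpha,n}$. $C^+$ is the closed dominant Weyl chamber, $C^-=-C^+$. The type of a face is the unique face of the fundamental alcove $\{0\le\langle\alpha,x\rangle\le1\ \forall\alpha\in\Phi^+\}$ which is $W^{\mathfrak a}$-conjugate to it. A sector with vertex $V$ is $\mathfrak s=V+\tau(C^+)$, $\tau\in W$; $-\mathfrak s=V-\tau(C^+)$; its class $\underline{\mathfrak s}$ is given by $\tau$, and classes are ordered by the Bruhat order on the $\tau$'s. A wall separates $\Omega$ from a face $F$ if $\Omega$ lies in a closed half-space of it and $F^o$ in the opposite open half-space. **Galleries.** A combinatorial one-skeleton gallery is a sequence $(V_0\subset E_0\supset V_1\subset\cdots\subset E_r\supset V_{r+1})$ of vertices $V_i$ and edges $E_i$ of $\mathbb A$ with $V_0$ (source) and $V_{r+1}$ (target) special. Its type is the sequence of types of its faces; galleries ''of the same type as'' one starting in $\mathfrak o$ are also taken to start in $\mathfrak o$. $\gamma*\gamma'$ denotes concatenation, after translating $\gamma'$ so that its source is the target of $\gamma$. For a fundamental coweight $\omega$, $\gamma_\omega$ is the gallery of consecutive vertices and edges on the segment from $\mathfrak o$ to $\omega$. **Positively folded.** $(E\supset V\subset F)$ is minimal if there is a sector $\mathfrak s$ with vertex $V$ with $E\subset\mathfrak s$, $F\subset-\mathfrak s$. $(E\supset V\subset F')$ is obtained from $(E\supset V\subset F)$ by a positive folding if there is $(\beta,n)$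 with $V\in H_{\beta,n}$, $F'=s_{\beta,n}(F)$ and $H_{\beta,n}$ separates $F\cup(V+C^-)$ from $F'$. $(E\supset V\subset F)$ is positively folded if it is minimal or obtained from a minimal $(E\supset V\subset F_0)$ by a finite sequence of positive foldings. A gallery is positively folded if every $(E_{i-1}\supset V_i\subset E_i)$ is positively folded and there are sectors $\mathfrak s_i$ with vertex $V_i$, $E_i\subset\mathfrak s_i$ ($0\le i\le r$), and $\underline{\mathfrak s}_0\ge\cdots\ge\underline{\mathfrak s}_r$. **LS-galleries.** For a vertex $V$ of an edge $E$ and a wall $H_{\alpha,n}\ni V$, $\alpha>0$, $(V,E)$ crosses $H_{\alpha,n}$ positively if $E\not\subset H^-_{\alpha,n}$. $\sharp^+\delta$ is the total number, over $i=0,\dots,r$, of positive wall crossings of $(V_i,E_i)$. An LS-gallery of the same type as $\gamma_{\omega_{i_1}}*\cdots*\gamma_{\omega_{i_r}}$ is a positively folded combinatorial gallery $\delta$ of this type with $\sharp^+\delta=\langle\lambda+\mu,\rho\rangle$, $\mu$ the target of $\delta$. **Path model.** $\pi_\omega:[0,1]\to\mathbb A$, $t\mapsto t\omega$. Concatenation $*$ of paths is the usual one (up to reparametrization). $\mathcal P_{\underline\lambda}$ is the set of paths obtained from $\pi_{\omega_{i_1}}*\cdots*\pi_{\omega_{i_r}}$ by successively applying root operators $f_\alpha$, $\alpha$ a simple root (whenever defined), where: for a path $\pi$ let $h(t)=\langle\alpha,\pi(t)\rangle$, $m=\min h$, $p$ maximal with $h(p)=m$; $f_\alpha\pi$ is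 defined iff $h(1)-m\ge1$, and then, with $x>p$ minimal such that $h(x)=m+1$, $f_\alpha\pi(t)=\pi(t)$ for $t\le p$, $\pi(p)+s_\alpha(\pi(t)-\pi(p))$ for $p\le t\le x$, and $\pi(t)-\alpha^\vee$ for $t\ge x$ (here $s_\alpha$ is the linear reflection). *)

(* Defs.v *)
(* MathComp / MathComp-Analysis. *)
From mathcomp Require Import all_boot all_order all_algebra.
From mathcomp Require Import boolp classical_sets reals.

Set Implicit Arguments.
Unset Strict Implicit.
Unset Printing Implicit Defensive.

Import Order.TTheory GRing.Theory Num.Theory.
Local Open Scope classical_set_scope.
Local Open Scope ring_scope.

(* With c = a^\vee this is the reflection x |-> x - <a, x> a^\vee on
   cocharacters (columns); acting from the right on characters (rows) it is
   b |-> b - <b, a^\vee> a. *)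
Definition reflmx n (a : 'rV[int]_n) (c : 'cV[int]_n) : 'M[int]_n :=
  1%:M - c *m a.

(* A connected complex semisimple group G with a maximal torus T of rank n and a
   choice of positive roots is given by its based root datum
   (X, Phi, X^\vee, Phi^\vee).  After choosing a Z-basis, X = Z^n (rows),
   X^\vee = Z^n (columns) and the perfect pairing is the matrix product. *)
Record rootDatum (n : nat) := RootDatum {
  roots : seq 'rV[int]_n;
  coroot : 'rV[int]_n -> 'cV[int]_n;
  simple : 'I_n -> 'rV[int]_n;
  roots_uniq : uniq roots;
  coroot_inj : {in roots &, injective coroot};
  root_corootE : forall a, a \in roots -> a *m coroot a = 2%:M;
  refl_root : forall a b, a \in roots -> b \in roots ->
    b *m reflmx a (coroot a) \in roots;
  refl_coroot : forall a b, a \in roots -> b \in roots ->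
    exists2 c, c \in roots & reflmx a (coroot a) *m coroot b = coroot c;
  roots_reduced : forall a, a \in roots -> a *+ 2 \notin roots;
  (* semisimplicity: the centre of G contains no nontrivial torus *)
  roots_semisimple : forall x : 'cV[int]_n,
    (forall a, a \in roots -> a *m x = 0) -> x = 0;
  simple_root : forall i, simple i \in roots;
  (* linear independence of the n simple roots follows from semisimplicity *)
  root_simple : forall a, a \in roots -> exists c : 'I_n -> nat,
    a = \sum_i simple i *+ c i \/ a = - \sum_i simple i *+ c i
}.

Section Weyl.
Context (n : nat) (D : rootDatum n).

Definition pos_roots : seq 'rV[int]_n :=
  [seq a <- roots D |
    `[< exists c : 'I_n -> nat, a = \sum_i simple D i *+ c i >]].

Definition refl (a : 'rV[int]_n) : 'M[int]_n := reflmx a (coroot D a).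

(* W, acting on X^\vee *)
Definition weyl : set 'M[int]_n :=
  [set w | exists2 s : seq 'rV[int]_n, {subset s <= roots D} &
           w = foldr (fun a u => refl a *m u) 1%:M s].

Definition word (s : seq 'I_n) : 'M[int]_n :=
  foldr (fun i u => refl (simple D i) *m u) 1%:M s.

Definition has_length (w : 'M[int]_n) (k : nat) : Prop :=
  (exists2 s, size s = k & word s = w) /\
  (forall s, word s = w -> (k <= size s)%N).

Inductive bruhat_le (u : 'M[int]_n) : 'M[int]_n -> Prop :=
| bruhat_refl : bruhat_le u u
| bruhat_step w b k l : bruhat_le u w -> b \in roots D ->
    has_length w k -> has_length (w *m refl b) l -> (k < l)%N ->
    bruhat_le u (w *m refl b).

End Weyl.

Section Apartment.
Context (R : realType) (n : nat) (D : rootDatum n).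

(* The apartment X^\vee (x) R is 'cV[R]_n, with origin 0. *)
Local Notation A := 'cV[R]_n.

Definition pairing (a : 'rV[int]_n) (x : A) : R :=
  (map_mx intr a *m x) ord0 ord0.

Definition rho : 'rV[R]_n := 2^-1 *: \sum_(a <- pos_roots D) map_mx intr a.

Definition act (w : 'M[int]_n) (x : A) : A := map_mx intr w *m x.

Definition hyp (a : 'rV[int]_n) (m : int) : set A :=
  [set x | pairing a x + m%:~R = 0].
Definition hyp_pos (a : 'rV[int]_n) (m : int) : set A :=
  [set x | 0 <= pairing a x + m%:~R].
Definition hyp_neg (a : 'rV[int]_n) (m : int) : set A :=
  [set x | pairing a x + m%:~R <= 0].

Definition arefl (a : 'rV[int]_n) (m : int) (x : A) : A :=
  x - (pairing a x + m%:~R) *: map_mx intr (coroot D a).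

(* W^a; closure under inverses is automatic, the generators being involutions *)
Inductive affine_weyl : (A -> A) -> Prop :=
| affine_weyl_id : affine_weyl id
| affine_weyl_refl a m w : a \in roots D -> affine_weyl w ->
    affine_weyl (arefl a m \o w).

(* The smallest closed face containing x: the intersection of all the closed
   half-spaces of the arrangement that contain x. *)
Definition face_at (x : A) : set A :=
  [set y | forall a m, a \in roots D ->
    (hyp_pos a m x -> hyp_pos a m y) /\ (hyp_neg a m x -> hyp_neg a m y)].

Definition is_face (F : set A) : Prop := exists x, F = face_at x.

(* F^o: the points of F lying in no smaller face *)
Definition open_face (F : set A) : set A := [set x | F = face_at x].

(* The rows of B form a basis of the direction of the affine hull of F. *)
Definition face_dim (F : set A) (d : nat) : Prop :=
  exists B : 'M[R]_(d, n),
    [/\ row_free B,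
        forall i, exists x y, [/\ F x, F y & row i B = (x - y)^T]
      & forall x y, F x -> F y -> ((x - y)^T <= B)%MS].

(* A vertex {V} is identified with the point V. *)
Definition is_vertex (V : A) : Prop := is_face [set V] /\ face_dim [set V] 0.
Definition is_edge (E : set A) : Prop := is_face E /\ face_dim E 1.

Definition special (V : A) : Prop :=
  forall a, a \in roots D -> exists m, hyp a m V.

Definition chamber : set A :=
  [set x | forall a, a \in pos_roots D -> 0 <= pairing a x].

Definition alcove : set A :=
  [set x | forall a, a \in pos_roots D -> 0 <= pairing a x <= 1].

Definition has_type (F T : set A) : Prop :=
  [/\ is_face T, T `<=` alcove & exists2 w, affine_weyl w & T = w @` F].
Definition same_type (F F' : set A) : Prop :=
  exists2 T, has_type F T & has_type F' T.

Definition sector (V : A) (w : 'M[int]_n) : set A :=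
  [set V + act w x | x in chamber].
Definition opp_sector (V : A) (w : 'M[int]_n) : set A :=
  [set V - act w x | x in chamber].

Definition separates (a : 'rV[int]_n) (m : int) (O F : set A) : Prop :=
  (O `<=` hyp_neg a m /\ open_face F `<=` ~` hyp_neg a m) \/
  (O `<=` hyp_pos a m /\ open_face F `<=` ~` hyp_pos a m).

(* The gallery (V_0, E_0, V_1, ..., E_r, V_{r+1}) is the pair
   (V_0, [:: (E_0, V_1); ...; (E_r, V_{r+1})]). *)
Definition gallery : Type := (A * seq (set A * A))%type.

Definition vertices (g : gallery) : seq A := g.1 :: unzip2 g.2.
Definition edges (g : gallery) : seq (set A) := unzip1 g.2.
Definition vtx (g : gallery) (i : nat) : A := nth 0 (vertices g) i.
Definition edg (g : gallery) (i : nat) : set A := nth set0 (edges g) i.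
Definition nedges (g : gallery) : nat := size g.2.
Definition source (g : gallery) : A := g.1.
Definition target (g : gallery) : A := last g.1 (unzip2 g.2).

Definition is_gallery (g : gallery) : Prop :=
  [/\ (0 < nedges g)%N,
      forall i, (i <= nedges g)%N -> is_vertex (vtx g i),
      forall i, (i < nedges g)%N -> is_edge (edg g i),
      forall i, (i < nedges g)%N -> edg g i (vtx g i) /\ edg g i (vtx g i.+1)
    & special (source g) /\ special (target g)].

Definition gcat (g h : gallery) : gallery :=
  let v := target g - source h in
  (g.1, g.2 ++ [seq ([set x + v | x in EV.1], EV.2 + v) | EV <- h.2]).

(* (0, [::]) is a right unit of gcat *)
Definition gconcat (gs : seq gallery) : gallery := foldr gcat (0, [::]) gs.

Definition same_gallery_type (g h : gallery) : Prop :=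
  [/\ nedges g = nedges h,
      forall i, (i <= nedges g)%N -> same_type [set vtx g i] [set vtx h i]
    & forall i, (i < nedges g)%N -> same_type (edg g i) (edg h i)].

Definition minimal (E : set A) (V : A) (F : set A) : Prop :=
  exists2 w, weyl D w & E `<=` sector V w /\ F `<=` opp_sector V w.

Definition pos_folding (V : A) (F F' : set A) : Prop :=
  exists b m, [/\ b \in roots D, hyp b m V, F' = arefl b m @` F
    & separates b m (F `|` [set V - x | x in chamber]) F'].

Inductive pos_foldings (V : A) (F : set A) : set A -> Prop :=
| pos_foldings0 : pos_foldings V F F
| pos_foldingsS F' F'' : pos_foldings V F F' -> pos_folding V F' F'' ->
    pos_foldings V F F''.

Definition locally_pos_folded (E : set A) (V : A) (F : set A) : Prop :=
  exists2 F0, minimal E V F0 & pos_foldings V F0 F.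

Definition pos_folded (g : gallery) : Prop :=
  (forall i, (i.+1 < nedges g)%N ->
     locally_pos_folded (edg g i) (vtx g i.+1) (edg g i.+1)) /\
  exists tau : nat -> 'M[int]_n,
    (forall i, (i < nedges g)%N ->
       weyl D (tau i) /\ edg g i `<=` sector (vtx g i) (tau i)) /\
    (forall i, (i.+1 < nedges g)%N -> bruhat_le D (tau i.+1) (tau i)).

(* V lies on at most one wall H_{a,m} for each root a, so counting the positive
   roots a counts the walls. *)
Definition pos_crossings (V : A) (E : set A) : nat :=
  count (fun a => `[< exists m, hyp a m V /\ ~ (E `<=` hyp_neg a m) >])
        (pos_roots D).

Definition sharp_pos (g : gallery) : nat :=
  (\sum_(i < nedges g) pos_crossings (vtx g i) (edg g i))%N.

(* Only the restriction of a path to [0, 1] is relevant. *)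
Definition traces (p : R -> A) (g : gallery) : Prop :=
  exists t : nat -> R,
    [/\ t 0%N = 0, t (nedges g) = 1,
        forall i, (i < nedges g)%N -> t i < t i.+1,
        forall i, (i <= nedges g)%N -> is_vertex (vtx g i) /\ p (t i) = vtx g i
      & forall i, (i < nedges g)%N -> is_edge (edg g i) /\
          forall u, t i < u < t i.+1 -> open_face (edg g i) (p u)].

(* The sequence of vertices and edges met by p.  There is at most one such
   gallery; if there is none (p leaves the one-skeleton) the value is
   (0, [::]), which is not a gallery since it has no edge. *)
Definition gallery_of_path (p : R -> A) : gallery :=
  xget (0, [::]) [set g : gallery | traces p g].

Definition line_path (x : A) : R -> A := fun t => t *: x.

Definition path_cat (p q : R -> A) : R -> A :=
  fun t => if t <= 2^-1 then p (2 * t) else p 1 + q (2 * t - 1).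

Fixpoint path_concat (ps : seq (R -> A)) : R -> A :=
  match ps with
  | [::] => fun=> 0
  | [:: p] => p
  | p :: qs => path_cat p (path_concat qs)
  end.

(* root_op a p q : f_a is defined on p, and q = f_a p *)
Definition root_op (a : 'rV[int]_n) (p q : R -> A) : Prop :=
  let h t := pairing a (p t) in
  exists t0 t1 : R,
    [/\ [/\ 0 <= t0 <= 1,
            forall t, 0 <= t <= 1 -> h t0 <= h t
          & forall t, t0 < t <= 1 -> h t != h t0],
        1 <= h 1 - h t0,
        [/\ t0 < t1 <= 1, h t1 = h t0 + 1
          & forall t, t0 < t < t1 -> h t != h t0 + 1]
      & q = fun t => if t <= t0 then p t
                     else if t <= t1 then p t0 + act (refl D a) (p t - p t0)
                     else p t - map_mx intr (coroot D a)].

Inductive path_model (ws : seq A) : (R -> A) -> Prop :=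
| path_model_start : path_model ws (path_concat (map line_path ws))
| path_model_op i p q : path_model ws p -> root_op (simple D i) p q ->
    path_model ws q.

Definition LS_gallery (ws : seq A) : set gallery :=
  [set d | [/\ is_gallery d,
     source d = 0,
     same_gallery_type d
       (gconcat [seq gallery_of_path (line_path w) | w <- ws]),
     pos_folded d
   & (sharp_pos d)%:R = (rho *m (\sum_(w <- ws) w + target d)) ord0 ord0]].

End Apartment.

(* Main.v *)
From mathcomp Require Import all_boot all_order all_algebra.
From mathcomp Require Import boolp classical_sets reals.
From mathcomp Require Import zify ring lra.
Require Import Defs.

Set Implicit Arguments.
Unset Strict Implicit.
Unset Printing Implicit Defensive.

Import Order.TTheory GRing.Theory Num.Theory.
Local Open Scope classical_set_scope.
Local Open Scope ring_scope.

(** A gallery that starts in the origin is recorded by the displacements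
[e 0, ..., e (N - 1)] of its edges; its vertices are the partial sums [psum e].
Let [e0] be the displacements of the straight gallery of the given type.  The
galleries of this type are then the sequences whose [k]-th edge is the image of
the [k]-th straight edge under some element of the affine Weyl group
([conj_base]); in particular [e k] lies in the Weyl group orbit of the dominant
vector [e0 k].  The proof characterises the LS-galleries in these terms
([LS_disp], [LS_disp_gallery], [LS_gallery_disp]), shows that they form a crystal
under the root operators, and transports the operators to paths.

Foldings.  A positive folding at a vertex [V] replaces a direction [x] by [s_b x],
where [b] is a positive root, integral at [V], with [<b, x> < 0] ([folds]).  The
Bruhat order is the same relation on the orbit of the regular vector
[rho_check], the sum of the fundamental coweights ([bruhat_folds],
[folds_bruhat]).  As a simple reflection permutes the positive roots other
than its own, a chain of foldings can be conjugated by it up to the first, or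
from the last, folding in that simple root ([folds_lift1], [folds_lift2]).  This
lifting property is all that is needed both at the vertices of a gallery and for
its defining chain; it also gives the uniqueness of the dominant vector in an
orbit ([dominant_unique]).

Dimension.  [<lambda + mu, rho>] minus the number of positive wall crossings is a
sum over the inner vertices of the increments of the weight [gap_weight]
([rho_defect]), and positive foldings never decrease this weight.  So in an
LS-gallery it is preserved at every vertex.  But a folding that turns a simple
root from negative to nonnegative strictly increases it, unless the vertex lies
on a wall of that root ([gap_weight_folds_neg]).  Hence the local minima of a
simple root along an LS-gallery are integers ([turn_neg], [local_min_int]).

Root operators.  By this integrality a root operator reflects a block of edges
between two consecutive walls of the simple root, on which that root is monotone.
Lowering and raising preserve all four conditions ([LS_disp_lower],
[LS_disp_raise]).  If no raising operator applies, then the gallery stays in the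
dominant chamber; by induction, [tau_k] fixes the dominant vertex [V_k] by means
of the defining chain, so that [V_(k+1)] and its straight counterpart are
dominant vectors of one orbit, and the gallery is straight ([dominant_base]).
Raising adds one crossing and the number of crossings is bounded, so every
LS-gallery is obtained from the straight one by lowering
([LS_disp_path_model]).

Paths.  A path determines the gallery that it traces ([traces_unique]), and the
extremal parameters in the definition of a root operator are times of vertices,
since the interior of an edge crosses no wall ([root_op_lowering],
[lowering_root_op]).  The straight gallery is obtained by cutting each
fundamental coweight where it meets a wall transversally ([base_single]). *)

(** * Pairing, reflections and the invariant form *)

Section Pairing.
Context (R : realType) (n : nat) (D : rootDatum n).
Local Notation A := 'cV[R]_n.
Implicit Types (a b : 'rV[int]_n) (x y : A) (w : 'M[int]_n).

Lemma pairingD a x y : pairing a (x + y) = pairing a x + pairing a y.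
Proof. by rewrite /pairing mulmxDr mxE. Qed.

Lemma pairingZ a c x : pairing a (c *: x) = c * pairing a x.
Proof. by rewrite /pairing -scalemxAr mxE. Qed.

Lemma pairingN a x : pairing a (- x) = - pairing a x.
Proof. by rewrite /pairing mulmxN mxE. Qed.

Lemma pairingB a x y : pairing a (x - y) = pairing a x - pairing a y.
Proof. by rewrite pairingD pairingN. Qed.

Lemma pairing0 a : pairing a (0 : A) = 0.
Proof. by rewrite /pairing mulmx0 mxE. Qed.

Lemma pairing_sum (I : Type) (r : seq I) (P : pred I) (F : I -> A) a :
  pairing a (\sum_(i <- r | P i) F i) = \sum_(i <- r | P i) pairing a (F i).
Proof.
exact: (big_morph (pairing a) (pairingD a) (pairing0 a)).
Qed.

Lemma pairingDl a b x : pairing (a + b) x = pairing a x + pairing b x.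
Proof. by rewrite /pairing map_mxD mulmxDl mxE. Qed.

Lemma pairingNl a x : pairing (- a) x = - pairing a x.
Proof. by rewrite /pairing map_mxN mulNmx mxE. Qed.

Lemma pairing0l x : pairing 0 x = 0.
Proof. by rewrite /pairing map_mx0 mul0mx mxE. Qed.

Lemma pairingZl a (c : int) x : pairing (c *: a) x = c%:~R * pairing a x.
Proof. by rewrite /pairing map_mxZ -scalemxAl mxE. Qed.

Lemma pairing_suml (I : Type) (r : seq I) (P : pred I) (F : I -> 'rV_n) x :
  pairing (\sum_(i <- r | P i) F i) x = \sum_(i <- r | P i) pairing (F i) x.
Proof.
exact: (big_morph (fun a => pairing a x) (fun a b => pairingDl a b x)
  (pairing0l x)).
Qed.

Lemma pairing_mulrn a k x : pairing (a *+ k) x = k%:R * pairing a x.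
Proof. by rewrite -scaler_nat pairingZl natz. Qed.

Lemma actD w x y : act w (x + y) = act w x + act w y.
Proof. exact: mulmxDr. Qed.
Lemma actN w x : act w (- x) = - act w x.
Proof. exact: mulmxN. Qed.
Lemma actB w x y : act w (x - y) = act w x - act w y.
Proof. by rewrite actD actN. Qed.
Lemma actZ w c x : act w (c *: x) = c *: act w x.
Proof. by rewrite /act scalemxAr. Qed.
Lemma act0 w : act w (0 : A) = 0.
Proof. exact: mulmx0. Qed.
Lemma act_sum (I : Type) (r : seq I) (P : pred I) (F : I -> A) w :
  act w (\sum_(i <- r | P i) F i) = \sum_(i <- r | P i) act w (F i).
Proof. exact: (big_morph (act w) (actD w) (act0 w)). Qed.
Lemma actM w1 w2 x : act (w1 *m w2) x = act w1 (act w2 x).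
Proof. by rewrite /act map_mxM mulmxA. Qed.
Lemma act1 x : act 1%:M x = x.
Proof. by rewrite /act map_mx1 mul1mx. Qed.

Lemma pairing_act a w x : pairing a (act w x) = pairing (a *m w) x.
Proof. by rewrite /pairing /act mulmxA map_mxM. Qed.

Definition cartan a b : int := (a *m coroot D b) ord0 ord0.
Definition coroot_vec a : A := map_mx intr (coroot D a).
Local Notation rc := coroot_vec.

Definition root_reflection a x : A := x - pairing a x *: rc a.
Local Notation sr := root_reflection.

Definition reflected_root a b : 'rV[int]_n := b *m refl D a.
Local Notation rr := reflected_root.

Lemma pairing_rc a b : pairing a (rc b) = (cartan a b)%:~R.
Proof. by rewrite /pairing /rc -map_mxM mxE. Qed.

Lemma rrE a b : rr a b = b - cartan b a *: a.
Proof.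
rewrite /rr /refl /reflmx mulmxBr mulmx1 mulmxA; congr (_ - _).
by rewrite [b *m _]mx11_scalar mul_scalar_mx.
Qed.

Lemma pairing1 a x : map_mx intr a *m x = (pairing a x)%:M.
Proof. by rewrite [LHS]mx11_scalar. Qed.

Lemma act_refl a x : act (refl D a) x = sr a x.
Proof.
rewrite /act /refl /reflmx map_mxB map_mx1 mulmxBl mul1mx map_mxM -mulmxA.
by rewrite pairing1 mul_mx_scalar.
Qed.

Lemma pairing_sr a b x : pairing b (sr a x) = pairing (rr a b) x.
Proof. by rewrite -act_refl pairing_act. Qed.

Lemma pairing_srE a b x :
  pairing b (sr a x) = pairing b x - (cartan b a)%:~R * pairing a x.
Proof. by rewrite /sr pairingB pairingZ pairing_rc mulrC. Qed.

Lemma srD a x y : sr a (x + y) = sr a x + sr a y.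
Proof. by rewrite -!act_refl actD. Qed.
Lemma srB a x y : sr a (x - y) = sr a x - sr a y.
Proof. by rewrite -!act_refl actB. Qed.
Lemma srZ a c x : sr a (c *: x) = c *: sr a x.
Proof. by rewrite -!act_refl actZ. Qed.

Lemma sr_id a x : pairing a x = 0 -> sr a x = x.
Proof. by move=> h; rewrite /sr h scale0r subr0. Qed.

Lemma cartan_diag a : a \in roots D -> cartan a a = 2.
Proof.
by move=> ha; rewrite /cartan root_corootE // mxE eqxx.
Qed.

Lemma pairing_sr_diag a x : a \in roots D -> pairing a (sr a x) = - pairing a x.
Proof. by move=> ha; rewrite pairing_srE cartan_diag //; ring. Qed.

Lemma srK a x : a \in roots D -> sr a (sr a x) = x.
Proof.
move=> ha; rewrite {1}/sr pairing_sr_diag // /sr scaleNr opprK subrK //.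
Qed.

Lemma refl_invol a : a \in roots D -> refl D a *m refl D a = 1%:M.
Proof.
move=> ha; rewrite /refl /reflmx; set M := _ *m a.
have MM : M *m M = M *+ 2.
  rewrite /M -mulmxA [a *m (_ *m _)]mulmxA root_corootE // mul_scalar_mx.
  by rewrite -scalemxAr scaler_nat.
rewrite mulmxBr mulmx1 mulmxBl mul1mx MM.
have -> : M - M *+ 2 = - M by rewrite mulr2n opprD addrA subrr sub0r.
by rewrite opprK subrK.
Qed.

Lemma rrK a b : a \in roots D -> rr a (rr a b) = b.
Proof. by move=> ha; rewrite /rr -mulmxA refl_invol // mulmx1. Qed.

Lemma rr_root a b : a \in roots D -> b \in roots D -> rr a b \in roots D.
Proof. exact: refl_root. Qed.

Lemma rr_diag a : a \in roots D -> rr a a = - a.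
Proof.
move=> ha; rewrite rrE cartan_diag // scaler_nat mulr2n opprD addrA subrr sub0r //.
Qed.

Lemma opp_root a : a \in roots D -> - a \in roots D.
Proof. by move=> ha; rewrite -rr_diag // rr_root. Qed.

Lemma opp_rootE a : (- a \in roots D) = (a \in roots D).
Proof. by apply/idP/idP => /opp_root; rewrite ?opprK. Qed.

Lemma rrN a b : rr a (- b) = - rr a b.
Proof. by rewrite /rr mulNmx. Qed.

Lemma sum_roots_rr (F : 'rV[int]_n -> R) a : a \in roots D ->
  \sum_(b <- roots D) F (rr a b) = \sum_(b <- roots D) F b.
Proof.
move=> ha; rewrite -(big_map (rr a) xpredT F); apply: perm_big.
apply: uniq_perm; rewrite ?roots_uniq //.
  rewrite map_inj_uniq ?roots_uniq //.
  by move=> b c /(congr1 (rr a)); rewrite !rrK.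
move=> b; apply/mapP/idP => [[c hc ->]|hb]; first exact: rr_root.
by exists (rr a b); rewrite ?rr_root ?rrK.
Qed.

Lemma sum_roots_opp (F : 'rV[int]_n -> R) :
  \sum_(b <- roots D) F (- b) = \sum_(b <- roots D) F b.
Proof.
rewrite -(big_map -%R xpredT F); apply: perm_big.
apply: uniq_perm; rewrite ?roots_uniq //.
  by rewrite map_inj_uniq ?roots_uniq //; exact: oppr_inj.
move=> b; apply/mapP/idP => [[c hc ->]|hb]; first exact: opp_root.
by exists (- b); rewrite ?opprK ?opp_rootE.
Qed.

(** Positive definite and invariant under [W], because [W] permutes the roots.
It is what determines a coroot by its root ([ip_rc]). *)
Definition inner x y : R := \sum_(a <- roots D) pairing a x * pairing a y.

Local Notation ip := inner.

Lemma ipC x y : ip x y = ip y x.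
Proof. by apply: eq_bigr => a _; rewrite mulrC. Qed.
Lemma ipDr x y z : ip x (y + z) = ip x y + ip x z.
Proof. by rewrite -big_split; apply: eq_bigr => a _; rewrite pairingD mulrDr. Qed.
Lemma ipZr x c y : ip x (c *: y) = c * ip x y.
Proof. by rewrite mulr_sumr; apply: eq_bigr => a _; rewrite pairingZ mulrCA. Qed.
Lemma ipNr x y : ip x (- y) = - ip x y.
Proof. by rewrite -scaleN1r ipZr mulN1r. Qed.
Lemma ipBr x y z : ip x (y - z) = ip x y - ip x z.
Proof. by rewrite ipDr ipNr. Qed.
Lemma ip0r x : ip x 0 = 0.
Proof. by rewrite -(scale0r 0) ipZr mul0r. Qed.
Lemma ip_sumr (I : Type) (r : seq I) (P : pred I) (F : I -> A) x :
  ip x (\sum_(i <- r | P i) F i) = \sum_(i <- r | P i) ip x (F i).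
Proof. exact: (big_morph (ip x) (ipDr x) (ip0r x)). Qed.

Lemma ip_ge0 x : 0 <= ip x x.
Proof. by apply: sumr_ge0 => a _; rewrite -expr2 sqr_ge0. Qed.

Lemma ip_sr a x y : a \in roots D -> ip (sr a x) (sr a y) = ip x y.
Proof.
move=> ha; rewrite /ip -[RHS](sum_roots_rr _ ha).
by apply: eq_bigr => b _; rewrite !pairing_sr.
Qed.

Lemma sr_rc_diag a : a \in roots D -> sr a (rc a) = - rc a.
Proof.
move=> ha; rewrite /sr pairing_rc cartan_diag // scaler_nat mulr2n.
by rewrite opprD addrA subrr sub0r.
Qed.

(** Compare [inner x (rc a)] with its image under the reflection in [a], which
negates [rc a]; so [rc a] is proportional to the dual of [a]. *)
Lemma ip_rc a x : a \in roots D -> 2 * ip x (rc a) = pairing a x * ip (rc a) (rc a).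
Proof.
move=> ha; have := ip_sr x (rc a) ha.
rewrite sr_rc_diag // ipNr [ip (sr a x) _]ipC /sr ipBr ipZr [ip (rc a) x]ipC.
by lra.
Qed.

End Pairing.

Section Roots.
Context (R : realType) (n : nat) (D : rootDatum n) (omega : 'I_n -> 'cV[R]_n).
Hypothesis omegaE :
  forall i j, pairing (simple D j) (omega i) = (i == j)%:R.
Local Notation A := 'cV[R]_n.
Local Notation rc := (@coroot_vec R n D).
Local Notation sr := (@root_reflection R n D).
Local Notation rr := (@reflected_root n D).
Local Notation ip := (@inner R n D).
Implicit Types (a b : 'rV[int]_n) (x y : A) (w : 'M[int]_n).

(** The simple roots have a right inverse, the fundamental coweights; a square
matrix with a right inverse is invertible. *)
Lemma omega_basis x : x = \sum_i pairing (simple D i) x *: omega i.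
Proof.
pose S : 'M[R]_n := \matrix_i map_mx intr (simple D i).
pose O : 'M[R]_n := \matrix_(i, j) omega j i ord0.
have SO : S *m O = 1%:M.
  apply/matrixP => i j; rewrite !mxE.
  transitivity (pairing (simple D i) (omega j)); last by rewrite omegaE eq_sym.
  by rewrite /pairing mxE; apply: eq_bigr => k _; rewrite !mxE.
have OS := mulmx1C SO.
rewrite -[LHS]mul1mx -OS -mulmxA.
apply/matrixP => i j; rewrite !mxE summxE; apply: eq_bigr => k _.
rewrite ord1 !mxE mulrC; congr (_ * _).
by rewrite /pairing mxE; apply: eq_bigr => l _; rewrite !mxE.
Qed.

Lemma simple_ext x y :
  (forall i, pairing (simple D i) x = pairing (simple D i) y) -> x = y.
Proof.
by move=> h; rewrite (omega_basis x) (omega_basis y); apply: eq_bigr => i _; rewrite h.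
Qed.

Lemma pairing_omega a x :
  pairing a x = \sum_i pairing (simple D i) x * pairing a (omega i).
Proof.
by rewrite {1}(omega_basis x) pairing_sum; apply: eq_bigr => i _; rewrite pairingZ.
Qed.

Lemma ip_eq0 x : ip x x = 0 -> x = 0.
Proof.
move=> /eqP; rewrite psumr_eq0; last by move=> a _; rewrite -expr2 sqr_ge0.
move=> /allP h; apply: simple_ext => i; rewrite pairing0; apply/eqP.
by have := h _ (simple_root D i); rewrite mulf_eq0 orbb.
Qed.

Lemma ip_gt0 x : x != 0 -> 0 < ip x x.
Proof.
move=> hx; rewrite lt_neqAle ip_ge0 andbT eq_sym.
by apply: contra hx => /eqP/ip_eq0/eqP.
Qed.

Lemma rc_neq0 a : a \in roots D -> rc a != 0.
Proof.
move=> ha; apply/eqP => h; have := pairing_rc R D a a.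
by rewrite h pairing0 cartan_diag // => /eqP; rewrite eq_sym intr_eq0.
Qed.

Lemma ip_rc_gt0 a : a \in roots D -> 0 < ip (rc a) (rc a).
Proof. by move/rc_neq0/ip_gt0. Qed.

(** Both sides are proportional to the dual of the same root by [ip_rc], and the
factor is fixed by the pairing of a root with its own coroot being 2. *)
Lemma root_reflection_coroot a b : a \in roots D -> b \in roots D -> sr a (rc b) = rc (rr a b).
Proof.
move=> ha hb; set y := sr a (rc b); set b' := rr a b.
have hb' : b' \in roots D by exact: rr_root.
have ny : ip y y = ip (rc b) (rc b) by rewrite ip_sr.
have hy x : 2 * ip x y = pairing b' x * ip (rc b) (rc b).
  rewrite -(ip_sr x y ha) srK // ip_rc // pairing_sr //.
have h1 := hy (rc b'); have h2 := ip_rc y hb'.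
have e1 : pairing b' (rc b') = 2 by rewrite pairing_rc cartan_diag.
have e2 : pairing b' y = 2.
  by rewrite -pairing_sr /y srK // pairing_rc cartan_diag.
rewrite e1 in h1; rewrite e2 ipC in h2.
have nn : ip (rc b) (rc b) = ip (rc b') (rc b') by lra.
apply/eqP; rewrite -subr_eq0; apply/eqP/ip_eq0.
have h3 := hy (y - rc b'); have h4 := ip_rc (y - rc b') hb'.
by rewrite nn in h3; rewrite ipBr; lra.
Qed.

Lemma rcN a : a \in roots D -> rc (- a) = - rc a.
Proof. by move=> ha; rewrite -(rr_diag ha) -root_reflection_coroot // sr_rc_diag. Qed.

Lemma srNl a x : a \in roots D -> sr (- a) x = sr a x.
Proof. by move=> ha; rewrite /sr rcN // pairingNl scaleNr scalerN opprK. Qed.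

Lemma sr_conj a b x : a \in roots D -> b \in roots D ->
  sr a (sr b x) = sr (rr a b) (sr a x).
Proof.
move=> ha hb; rewrite [sr b x]/root_reflection srB srZ root_reflection_coroot // [RHS]/root_reflection.
by rewrite pairing_sr rrK.
Qed.

Lemma mx_intr_inj w w' : (forall x, act w x = act w' x) -> w = w'.
Proof.
move=> h; apply/matrixP => i j; apply: (@intr_inj R).
have := congr1 (fun M : 'M[R]_(n,1) => M i ord0) (h (delta_mx j ord0)).
by rewrite /act -!colE !mxE.
Qed.

End Roots.

(** * Positive roots and the Weyl group *)

Section Positive.
Context (R : realType) (n : nat) (D : rootDatum n) (omega : 'I_n -> 'cV[R]_n).
Hypothesis omegaE :
  forall i j, pairing (simple D j) (omega i) = (i == j)%:R.
Local Notation A := 'cV[R]_n.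
Local Notation rc := (@coroot_vec R n D).
Local Notation rr := (@reflected_root n D).
Local Notation ip := (@inner R n D).
Local Notation alpha := (simple D).
Implicit Types (a b : 'rV[int]_n) (x y : A) (w : 'M[int]_n).

(** The sum of the fundamental coweights is a regular dominant vector: a root is
positive iff it is positive on it ([posP]), so its orbit is a copy of [W]. *)
Definition rho_check : A := \sum_i omega i.
Local Notation vrho := rho_check.

Lemma coef_omega (c : 'I_n -> nat) j :
  pairing (\sum_i alpha i *+ c i) (omega j) = (c j)%:R.
Proof.
rewrite pairing_suml (bigD1 j) //= big1 ?addr0.
  by rewrite pairing_mulrn omegaE eqxx mulr1.
by move=> i hi; rewrite pairing_mulrn omegaE eq_sym (negPf hi) mulr0.
Qed.

Lemma root_neq0 a : a \in roots D -> a != 0.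
Proof.
move=> ha; apply/eqP => a0; have := pairing_rc R D a a.
by rewrite cartan_diag // a0 pairing0l => /eqP; rewrite eq_sym intr_eq0.
Qed.

Lemma pos_rootsE a : (a \in pos_roots D) =
  (a \in roots D) && `[< exists c : 'I_n -> nat, a = \sum_i alpha i *+ c i >].
Proof. by rewrite mem_filter andbC. Qed.

Lemma pos_root a : a \in pos_roots D -> a \in roots D.
Proof. by rewrite pos_rootsE => /andP[]. Qed.

Lemma pos_omega a j : a \in pos_roots D -> 0 <= pairing a (omega j).
Proof.
by rewrite pos_rootsE => /andP[_ /asboolP[c ->]]; rewrite coef_omega ler0n.
Qed.

Lemma vrhoE a : pairing a vrho = \sum_i pairing a (omega i).
Proof. exact: pairing_sum. Qed.

Lemma pos_vrho a : a \in pos_roots D -> 0 < pairing a vrho.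
Proof.
move=> ha; have a0 := root_neq0 (pos_root ha).
rewrite vrhoE lt_neqAle sumr_ge0 ?andbT; last by move=> i _; exact: pos_omega.
rewrite eq_sym; apply: contra a0; rewrite psumr_eq0; last first.
  by move=> i _; exact: pos_omega.
move: ha; rewrite pos_rootsE => /andP[_ /asboolP[c ->]] /allP h.
apply/eqP/big1 => i _.
have /eqP := h i (mem_index_enum i); rewrite coef_omega => /eqP.
by rewrite pnatr_eq0 => /eqP ->; rewrite mulr0n.
Qed.

Lemma root_posVneg a : a \in roots D -> (a \in pos_roots D) \/ (- a \in pos_roots D).
Proof.
move=> ha; have [c [hc|hc]] := root_simple ha.
  by left; rewrite pos_rootsE ha; apply/asboolP; exists c.
right; rewrite pos_rootsE opp_rootE ha; apply/asboolP; exists c.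
by rewrite hc opprK.
Qed.

Lemma posP a : a \in roots D -> (a \in pos_roots D) = (0 < pairing a vrho).
Proof.
move=> ha; apply/idP/idP; first exact: pos_vrho.
move=> h; have [//|/pos_vrho] := root_posVneg ha.
by rewrite pairingNl; lra.
Qed.

Lemma pos_opp a : a \in roots D -> (- a \in pos_roots D) = (a \notin pos_roots D).
Proof.
move=> ha; rewrite !posP ?opp_root // pairingNl oppr_gt0 -leNgt le_eqVlt.
have [/pos_vrho|/pos_vrho] := root_posVneg ha; rewrite ?pairingNl; lra.
Qed.

Lemma pos_of_omega a j : a \in roots D -> 0 < pairing a (omega j) ->
  a \in pos_roots D.
Proof.
move=> ha h; have [//|/(pos_omega j)] := root_posVneg ha.
rewrite pairingNl; lra.
Qed.

Lemma simple_pos i : alpha i \in pos_roots D.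
Proof. by apply: (@pos_of_omega _ i); rewrite ?simple_root // omegaE eqxx ltr01. Qed.

Lemma root_int_omega a j : a \in roots D -> pairing a (omega j) \is a Num.int.
Proof.
move=> ha; have [c [->|->]] := root_simple ha;
  rewrite ?pairingNl coef_omega ?rpredN; exact: natr_int.
Qed.

(** Such a root is [c] times the simple root; integrality of the Cartan numbers
leaves only [c = 1] and [c = 2], and the root system is reduced. *)
Lemma pos_support1 a i : a \in pos_roots D ->
  (forall j, j != i -> pairing a (omega j) = 0) -> a = alpha i.
Proof.
move=> ha h; have hr := pos_root ha; have ai := simple_root D i.
move: (ha); rewrite pos_rootsE hr => /asboolP[c hc].
have hai : a = alpha i *+ c i.
  rewrite hc (bigD1 i) //= big1 ?addr0 // => j /h.
  by rewrite hc coef_omega => /eqP; rewrite pnatr_eq0 => /eqP ->; rewrite mulr0n.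
have h2 : (c i)%:R * cartan D (alpha i) a = 2 :> int.
  have := pairing_rc R D a a; rewrite cartan_diag // {1}hai pairing_mulrn.
  rewrite pairing_rc pmulrn -intrM => /eqP.
  by rewrite eqr_int !natz => /eqP e; exact: e.
have : (c i %| 2)%N.
  have : ((c i)%:Z %| 2)%Z by apply/dvdzP; exists (cartan D (alpha i) a); rewrite -h2 natz mulrC.
  by [].
rewrite dvdn_divisors // => hci.
have {hci} : c i = 1%N \/ c i = 2%N.
  by move: hci; rewrite !inE => /orP[/eqP ->|/eqP ->]; [left|right].
case=> e; first by rewrite hai e mulr1n.
by have := roots_reduced ai; rewrite -e -hai hr.
Qed.

(** The reflection only changes the coefficient of [alpha i]; some other
coefficient is positive, and it decides the sign of the root. *)
Lemma simple_perm_pos a i : a \in pos_roots D -> a != alpha i ->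
  rr (alpha i) a \in pos_roots D.
Proof.
move=> ha hne; have hr := pos_root ha; have ai := simple_root D i.
have [j /andP[ji hj]] : exists j, (j != i) && (pairing a (omega j) != 0).
  apply: contrapT => hn; move/eqP: hne; apply; apply: pos_support1 => // j ji.
  by apply/eqP/negPn/negP => h; apply: hn; exists j; rewrite ji h.
apply: (@pos_of_omega _ j); first exact: rr_root.
rewrite -pairing_sr sr_id ?omegaE ?(negPf ji) //.
by rewrite lt_neqAle eq_sym hj pos_omega.
Qed.

Lemma sum_pos (F : 'rV[int]_n -> R) :
  \sum_(a <- pos_roots D) F a = \sum_(a <- roots D | a \in pos_roots D) F a.
Proof.
by rewrite big_filter big_seq_cond [RHS]big_seq_cond; apply: eq_bigl => a;
  rewrite pos_rootsE; case: (a \in roots D).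
Qed.

Lemma sum_roots_pos (F : 'rV[int]_n -> R) :
  \sum_(a <- roots D) F a = \sum_(a <- pos_roots D) (F a + F (- a)).
Proof.
rewrite (bigID (mem (pos_roots D))) /= big_split /= -sum_pos; congr (_ + _).
pose G a := if a \in pos_roots D then 0 else F a.
have -> : \sum_(a <- roots D | a \notin pos_roots D) F a = \sum_(a <- roots D) G a.
  by rewrite big_mkcond; apply: eq_bigr => a _; rewrite /G if_neg.
rewrite -sum_roots_opp sum_pos [RHS]big_mkcond.
rewrite big_seq [RHS]big_seq; apply: eq_bigr => a ha.
by rewrite /G pos_opp //; case: (a \in pos_roots D).
Qed.

Lemma chamberP x : chamber D x <-> forall i, 0 <= pairing (alpha i) x.
Proof.
split=> [h i|h a ha]; first exact/h/simple_pos.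
rewrite (pairing_omega omegaE); apply: sumr_ge0 => i _; apply: mulr_ge0 => //.
exact: pos_omega.
Qed.

Lemma vrho_simple i : pairing (alpha i) vrho = 1.
Proof.
rewrite vrhoE (bigD1 i) //= omegaE eqxx big1 ?addr0 // => j ji.
by rewrite omegaE (negPf ji).
Qed.

Lemma chamber_vrho : chamber D vrho.
Proof. by apply/chamberP => i; rewrite vrho_simple. Qed.

Lemma chamber_omega i : chamber D (omega i).
Proof. by apply/chamberP => j; rewrite omegaE ler0n. Qed.

Lemma weyl1 : weyl D 1%:M.
Proof. by exists [::]. Qed.

Lemma weylS a w : a \in roots D -> weyl D w -> weyl D (refl D a *m w).
Proof.
move=> ha [s hs ->]; exists (a :: s) => // b.
by rewrite inE => /orP[/eqP->|/hs].
Qed.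

Lemma weyl_ind (P : 'M[int]_n -> Prop) : P 1%:M ->
  (forall a w, a \in roots D -> weyl D w -> P w -> P (refl D a *m w)) ->
  forall w, weyl D w -> P w.
Proof.
move=> h1 hS w [s hs ->]; elim: s hs => //= a s IH hs.
have hs' : {subset s <= roots D} by move=> b hb; apply: hs; rewrite inE hb orbT.
apply: hS; [by apply: hs; rewrite inE eqxx | by exists s | exact: IH].
Qed.

Lemma weyl_refl a : a \in roots D -> weyl D (refl D a).
Proof. by move=> ha; rewrite -[refl D a]mulmx1; exact: (weylS ha weyl1). Qed.

Lemma weylM w w' : weyl D w -> weyl D w' -> weyl D (w *m w').
Proof.
move=> hw hw'; move: w hw; apply: weyl_ind; first by rewrite mul1mx.
by move=> a w ha _ h; rewrite -mulmxA; apply: weylS.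
Qed.

Lemma weyl_inv w : weyl D w ->
  exists w', [/\ weyl D w', w' *m w = 1%:M & w *m w' = 1%:M].
Proof.
move: w; apply: weyl_ind; first by exists 1%:M; rewrite mulmx1; split=> //; exact: weyl1.
move=> a w ha hw [w' [h1 h2 h3]]; exists (w' *m refl D a); split.
- by apply: weylM => //; exact: weyl_refl.
- by rewrite mulmxA -(mulmxA w') refl_invol // mulmx1.
- by rewrite mulmxA -(mulmxA _ w) h3 mulmx1 refl_invol.
Qed.

Lemma weyl_root w a : weyl D w -> a \in roots D -> a *m w \in roots D.
Proof.
move=> hw; move: w hw a; apply: weyl_ind; first by move=> a; rewrite mulmx1.
by move=> b w hb _ IH a ha; rewrite mulmxA; apply: IH; exact: rr_root.
Qed.

Lemma sum_roots_weyl (F : 'rV[int]_n -> R) w : weyl D w ->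
  \sum_(b <- roots D) F (b *m w) = \sum_(b <- roots D) F b.
Proof.
move=> hw; move: w hw F; apply: weyl_ind => [F|a w ha _ IH F].
  by apply: eq_bigr => b _; rewrite mulmx1.
rewrite -[RHS]IH; have /= <- := sum_roots_rr (fun b => F (b *m w)) ha.
by apply: eq_bigr => b _; rewrite mulmxA.
Qed.

Lemma refl_conj a b : a \in roots D -> b \in roots D ->
  refl D a *m refl D b = refl D (rr a b) *m refl D a.
Proof.
move=> ha hb; apply: (@mx_intr_inj R) => x.
by rewrite !actM !act_refl (sr_conj omegaE).
Qed.

Lemma weyl_conj w b : weyl D w -> b \in roots D ->
  exists b', [/\ b' \in roots D, w *m refl D b = refl D b' *m w & b' *m w = b].
Proof.
move: w; apply: (weyl_ind (P := fun w => b \in roots D -> exists b', [/\ b' \in roots D, w *m refl D b = refl D b' *m w & b' *m w = b])) => [hb|a w ha _ IH hb].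
  by exists b; rewrite mul1mx !mulmx1.
have [b' [h1 h2 h3]] := IH hb; exists (rr a b'); split; first exact: rr_root.
  by rewrite -mulmxA h2 mulmxA refl_conj // mulmxA.
by rewrite mulmxA -/(rr a (rr a b')) rrK.
Qed.

Lemma word_weyl s : weyl D (word D s).
Proof.
elim: s => [|i s IH] /=; first exact: weyl1.
by apply: weylS => //; exact: simple_root.
Qed.

Lemma word_cat s t : word D (s ++ t) = word D s *m word D t.
Proof.
by elim: s => [|i s IH] /=; rewrite ?mul1mx // IH mulmxA.
Qed.

Lemma refl_opp a : a \in roots D -> refl D (- a) = refl D a.
Proof.
move=> ha; apply: (@mx_intr_inj R) => x.
by rewrite !act_refl (srNl omegaE).
Qed.

(** Induction on the height: a positive root [a] that is not simple has positive
pairing with some simple coroot, hence that simple reflection lowers it. *)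
Lemma refl_word a : a \in roots D -> exists s, word D s = refl D a.
Proof.
wlog ha : a / a \in pos_roots D.
  move=> H ha; have [hp|hn] := root_posVneg ha; first exact: H.
  by rewrite -refl_opp //; apply: H; rewrite ?opp_root.
move=> _.
have [m hm] : exists m : nat, pairing a vrho <= m%:R.
  by exists (Num.bound (pairing a vrho)); apply/ltW/archi_boundP/ltW/pos_vrho.
elim: m a ha hm => [|m IH] a ha hm; first by have := pos_vrho ha; lra.
have hr := pos_root ha.
have [[i ->]|hns] := pselect (exists i, a = alpha i).
  by exists [:: i] => /=; rewrite mulmx1.
(* otherwise a would pair nonpositively with its own coroot *)
have [i hi] : exists i, (0 < cartan D a (alpha i))%R.
  apply: contrapT => hn.
  have hle i : pairing (alpha i) (rc a) <= 0.
    have ai := simple_root D i.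
    have h0 : pairing a (rc (alpha i)) <= 0.
      rewrite pairing_rc lerz0 leNgt; apply/negP => h; apply: hn; by exists i.
    have e1 := ip_rc (rc (alpha i)) hr; have e2 := ip_rc (rc a) ai.
    have p1 := ip_rc_gt0 omegaE hr; have p2 := ip_rc_gt0 omegaE ai.
    have : pairing (alpha i) (rc a) * ip (rc (alpha i)) (rc (alpha i)) <= 0.
      rewrite -e2 ipC e1; apply: mulr_le0_ge0 => //; exact: ltW.
    by rewrite pmulr_lle0.
  have := pairing_rc R D a a; rewrite cartan_diag //.
  rewrite (pairing_omega omegaE).
  have : \sum_i pairing (alpha i) (rc a) * pairing a (omega i) <= 0.
    by apply: sumr_le0 => i _; apply: mulr_le0_ge0 => //; exact: pos_omega.
  by move=> h e; move: h; rewrite e; lra.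
have ai := simple_root D i.
have hb : rr (alpha i) a \in pos_roots D.
  by apply: simple_perm_pos => //; apply/eqP => e; apply: hns; exists i.
have [s hs] : exists s, word D s = refl D (rr (alpha i) a).
  apply: IH => //.
  rewrite -pairing_sr pairing_srE vrho_simple mulr1.
  have : 1 <= (cartan D a (alpha i))%:~R :> R by rewrite ler1z.
  by move: hm; rewrite -natr1; lra.
exists (i :: s ++ [:: i]); rewrite /= word_cat /= mulmx1 hs.
by rewrite mulmxA refl_conj ?rr_root // rrK // -mulmxA refl_invol // mulmx1.
Qed.

Lemma weyl_word w : weyl D w -> exists s, word D s = w.
Proof.
move: w; apply: weyl_ind; first by exists [::].
move=> a w ha _ [s <-]; have [t <-] := refl_word ha.
by exists (t ++ s); rewrite word_cat.
Qed.

End Positive.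

(** * Chains of foldings *)

Section Folds.
Context (R : realType) (n : nat) (D : rootDatum n) (omega : 'I_n -> 'cV[R]_n).
Hypothesis omegaE :
  forall i j, pairing (simple D j) (omega i) = (i == j)%:R.
Local Notation A := 'cV[R]_n.
Local Notation sr := (@root_reflection R n D).
Local Notation rr := (@reflected_root n D).
Local Notation alpha := (simple D).
Local Notation vrho := (rho_check omega).
Local Notation pos := (pos_roots D).
Implicit Types (a b : 'rV[int]_n) (x y : A) (w : 'M[int]_n).
Implicit Types (S : pred 'rV[int]_n).

(** [S] is the set of roots with a wall through the vertex at which the direction
[x] is folded: [integral_on V] for galleries, [predT] for the Bruhat order. *)
Inductive folds S x : A -> Prop :=
| folds0 : folds S x x
| foldsS y b : folds S x y -> b \in pos -> S b -> pairing b y < 0 ->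
    folds S x (sr b y).

Lemma folds_trans S x y z : folds S x y -> folds S y z -> folds S x z.
Proof. by move=> hxy; elim=> // u b _ IH hb hS hu; apply: foldsS. Qed.

Lemma folds1 S x b : b \in pos -> S b -> pairing b x < 0 -> folds S x (sr b x).
Proof. by move=> *; apply: foldsS => //; exact: folds0. Qed.

Lemma folds_le1 S x b : b \in pos -> S b -> pairing b x <= 0 ->
  folds S x (sr b x).
Proof.
move=> hb hS; rewrite le_eqVlt => /orP[/eqP h|]; last exact: folds1.
by rewrite sr_id //; exact: folds0.
Qed.

Lemma folds_ge1 S x b : b \in pos -> S b -> 0 <= pairing b x ->
  folds S (sr b x) x.
Proof.
move=> hb hS h; have hr := pos_root hb.
rewrite -{2}(srK x hr); apply: folds_le1 => //.
by rewrite pairing_sr_diag // oppr_le0.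
Qed.

Lemma folds_sub S S' x y : (forall b, b \in roots D -> S b -> S' b) ->
  folds S x y -> folds S' x y.
Proof.
move=> h; elim=> [|u b _ IH hb hS hu]; first exact: folds0.
by apply: foldsS => //; apply: h => //; exact: pos_root hb.
Qed.

Lemma folds_weyl S x y : folds S x y -> exists2 w, weyl D w & y = act w x.
Proof.
elim=> [|u b _ [w hw ->] hb _ _]; first by exists 1%:M; rewrite ?act1 //; exact: weyl1.
have hr := pos_root hb.
by exists (refl D b *m w); [exact: weylS | rewrite actM act_refl].
Qed.

(** When [alpha i] has no wall at the vertex, the simple reflection maps the
positive roots used by the chain to positive roots. *)
Lemma folds_conj S S' i x y :
    ~~ S (alpha i) -> (forall b, b \in roots D -> S b -> S' (rr (alpha i) b)) ->
  folds S x y -> folds S' (sr (alpha i) x) (sr (alpha i) y).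
Proof.
have ai := simple_root D i.
move=> hi h; elim=> [|u b _ IH hb hS hu]; first exact: folds0.
have hr := pos_root hb.
rewrite (sr_conj omegaE) //; apply: foldsS => //.
- apply: (simple_perm_pos omegaE) => //.
  by apply: contraNneq hi => <-.
- exact: h.
- by rewrite -pairing_sr srK.
Qed.

Section Stable.
Variables (S : pred 'rV[int]_n) (i : 'I_n).
Hypothesis Si : S (alpha i).
Hypothesis Sst : forall b, b \in roots D -> S b -> S (rr (alpha i) b).
Local Notation s := (sr (alpha i)).

Lemma fold_conj1 x y b : folds S x (s y) -> b \in pos -> S b ->
  pairing b y < 0 -> b != alpha i -> folds S x (s (sr b y)).
Proof.
move=> h hb hS hu ne; have hr := pos_root hb; have ai := simple_root D i.
rewrite (sr_conj omegaE) //; apply: foldsS => //.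
- exact: (simple_perm_pos omegaE).
- exact: Sst.
- by rewrite -pairing_sr srK.
Qed.

(** Conjugate the chain by [s] from its end; this fails only at a folding in
[alpha i], and there the chain [folds S x (s y)] comes for free. *)
Lemma folds_lift1 x y : folds S x y -> folds S (s x) (s y) \/ folds S x (s y).
Proof.
have ai := simple_root D i.
elim=> [|u b hu IH hb hS hlt]; first by left; exact: folds0.
have [->|ne] := eqVneq b (alpha i); first by right; rewrite srK.
by case: IH => IH; [left|right]; apply: fold_conj1.
Qed.

(** As [folds_lift1], but conjugating from the beginning of the chain. *)
Lemma folds_lift2 x y : folds S x y -> folds S (s x) (s y) \/ folds S (s x) y.
Proof.
elim=> [|u b hu IH hb hS hlt]; first by left; exact: folds0.
have [e|ne] := eqVneq b (alpha i).
  right; rewrite e in hlt *; case: IH => // IH.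
  by apply: foldsS => //; rewrite -e.
case: IH => IH; [left|right]; first exact: fold_conj1.
exact: foldsS.
Qed.

Lemma folds_sr_right x y : folds S x y -> pairing (alpha i) x <= 0 ->
  folds S x (s y).
Proof.
have hp := simple_pos omegaE i.
move=> /folds_lift1[h|//] hx; apply: folds_trans h; exact: folds_le1.
Qed.

Lemma folds_sr_left x y : folds S x y -> 0 <= pairing (alpha i) y ->
  folds S (s x) y.
Proof.
have hp := simple_pos omegaE i.
move=> /folds_lift2[h|//] hy; apply: folds_trans h _; exact: folds_ge1.
Qed.

Lemma folds_sr_up x y : folds S x y -> 0 <= pairing (alpha i) x ->
  folds S (s x) (s y).
Proof.
have hp := simple_pos omegaE i.
by move=> /folds_lift1[//|h] hx; apply: folds_trans h; exact: folds_ge1.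
Qed.

Lemma folds_sr_down x y : folds S x y -> pairing (alpha i) y <= 0 ->
  folds S (s x) (s y).
Proof.
have hp := simple_pos omegaE i.
by move=> /folds_lift2[//|h] hx; apply: folds_trans h _; exact: folds_le1.
Qed.

End Stable.

Lemma folds_dominant S x y : chamber D x -> folds S x y -> y = x.
Proof.
by move=> hx; elim=> // u b _ -> hb _; rewrite ltNge hx.
Qed.

(** Write [w] as a word and prepend its letters one by one, by [folds_sr_left]. *)
Lemma orbit_folds_dominant x w : chamber D x -> weyl D w ->
  folds predT (act w x) x.
Proof.
move=> hx /(weyl_word omegaE)[t <-]; elim: t => [|i t IH] /=.
  by rewrite act1; exact: folds0.
rewrite actM act_refl; apply: folds_sr_left => //.
exact/hx/simple_pos.
Qed.

Lemma dominant_unique x w : chamber D x -> weyl D w -> chamber D (act w x) ->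
  act w x = x.
Proof.
move=> hx hw hwx; apply/esym.
exact: folds_dominant hwx (orbit_folds_dominant hx hw).
Qed.

Lemma pairing_weyl_vrho w a : weyl D w -> a \in roots D ->
  (0 < pairing a (act w vrho)) = (a *m w \in pos).
Proof. by move=> hw ha; rewrite pairing_act (posP omegaE) //; exact: weyl_root. Qed.

(** An element that fixes [rho_check] preserves the positive roots, so it sends each
fundamental coweight to a dominant vector of its orbit, that is, to itself. *)
Lemma weyl_vrho_inj w : weyl D w -> act w vrho = vrho -> w = 1%:M.
Proof.
move=> hw h; apply: (@mx_intr_inj R) => x; rewrite act1.
rewrite (omega_basis omegaE x) act_sum; apply: eq_bigr => i _.
rewrite actZ; congr (_ *: _); apply: dominant_unique => //.
  exact: (chamber_omega omegaE).
move=> a ha; have hr := pos_root ha; rewrite pairing_act; apply: (pos_omega omegaE).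
by rewrite -pairing_weyl_vrho // h (pos_vrho omegaE).
Qed.

Lemma weyl_vrho_inj2 w w' : weyl D w -> weyl D w' -> act w vrho = act w' vrho ->
  w = w'.
Proof.
move=> hw hw' e; have [v [hv h1 h2]] := weyl_inv hw'.
have : v *m w = 1%:M.
  by apply: weyl_vrho_inj; [exact: weylM | rewrite actM e -actM h1 act1].
by move=> /(congr1 (mulmx w')); rewrite mulmxA h2 mul1mx mulmx1.
Qed.

Lemma pairing_rho_check_neq0 a w : weyl D w -> a \in roots D -> pairing a (act w vrho) != 0.
Proof.
move=> hw ha; rewrite pairing_act; have := weyl_root hw ha => hr.
have [/(pos_vrho omegaE)|/(pos_vrho omegaE)] := root_posVneg hr; rewrite ?pairingNl; lra.
Qed.

(** Total [f]-weight of the positive roots that are positive on [x].  With [f = 1]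
it measures the length, with [f] the gap to the next wall the dimension. *)
Definition pos_weight (f : 'rV[int]_n -> R) x : R :=
  \sum_(a <- roots D) f a * (a \in pos)%:R * (0 < pairing a x)%R%:R.

(** What the root [a] contributes to the change of [pos_weight] under the folding
of [x] in [b]; only positive roots made negative by [s_b] matter. *)
Definition fold_gain (f : 'rV[int]_n -> R) b x a : R :=
  f (- a) * ((a \in pos) && (- rr b a \in pos))%R%:R *
  ((pairing a x < 0)%R%:R - (pairing (rr b a) x < 0)%R%:R).

(** Roots whose sign is unchanged by [s_b] cancel.  The others are put
together by the involution [a |-> - s_b a], which turns [f a] into [f (- a)]. *)
Lemma pos_weight_fold f b x : b \in roots D ->
    (forall a, a \in roots D -> f (rr b a) = f a) ->
  pos_weight f (sr b x) - pos_weight f x = \sum_(a <- roots D) fold_gain f b x a.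
Proof.
move=> hb hf; rewrite /pos_weight.
have -> : \sum_(a <- roots D) f a * (a \in pos)%:R * (0 < pairing a (sr b x))%R%:R =
  \sum_(a <- roots D) f a * (rr b a \in pos)%:R * (0 < pairing a x)%R%:R.
  rewrite -[LHS](sum_roots_rr _ hb) big_seq [RHS]big_seq.
  by apply: eq_bigr => a ha; rewrite hf // pairing_sr rrK.
rewrite -sumrB.
transitivity (\sum_(a <- roots D)
  (f a * ((- a \in pos) && (rr b a \in pos))%R%:R * (0 < pairing a x)%R%:R
   - f a * ((a \in pos) && (- rr b a \in pos))%R%:R * (0 < pairing a x)%R%:R)).
  rewrite big_seq [RHS]big_seq; apply: eq_bigr => a ha.
  rewrite !(pos_opp omegaE) ?rr_root //.
  by case: (a \in pos); case: (rr b a \in pos) => /=; ring.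
rewrite sumrB -[X in X - _]sum_roots_opp -[X in _ - X]sum_roots_opp.
rewrite -[X in _ - X](sum_roots_rr _ hb) -sumrB big_seq [RHS]big_seq.
apply: eq_bigr => a ha; rewrite /fold_gain -!rrN !rrK // !rrN !opprK.
rewrite -rrN hf ?opp_root // !rrN !pairingNl !oppr_gt0.
by rewrite [(- rr b a \in _) && _]andbC; ring.
Qed.

(** The pairing of [b]'s coroot with such a root is positive, so folding can only
increase [a] on [x]. *)
Lemma fold_gain_ge0 f b x a : b \in pos -> pairing b x < 0 -> a \in roots D ->
  0 <= f (- a) -> 0 <= fold_gain f b x a.
Proof.
move=> hb hx ha hf; rewrite /fold_gain; have hr := pos_root hb.
have [/andP[h1 h2]|] := boolP ((a \in pos) && (- rr b a \in pos)); last first.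
  by rewrite mulr0 mul0r.
rewrite mulr1 mulr_ge0 // subr_ge0 ler_nat.
have [h3|//] := boolP (pairing (rr b a) x < 0).
suff -> : pairing a x < 0 by [].
apply: le_lt_trans h3; rewrite -pairing_sr pairing_srE lerBrDr gerDl.
apply: mulr_ge0_le0; last exact: ltW.
have := pos_vrho omegaE h1; have := pos_vrho omegaE h2; have := pos_vrho omegaE hb.
rewrite pairingNl -pairing_sr pairing_srE oppr_gt0 => p1 p2 p3.
have : 0 < (cartan D a b)%:~R * pairing b vrho by lra.
by rewrite pmulr_lgt0 // => /ltW.
Qed.

Lemma pos_weight_fold_le f b x : b \in pos -> pairing b x < 0 ->
    (forall a, a \in roots D -> 0 <= f a) ->
    (forall a, a \in roots D -> f (rr b a) = f a) ->
  pos_weight f x <= pos_weight f (sr b x).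
Proof.
move=> hb hx h0 hf; rewrite -subr_ge0 pos_weight_fold //; last exact: pos_root hb.
rewrite big_seq; apply: sumr_ge0 => a ha; apply: fold_gain_ge0 => //.
by apply: h0; exact: opp_root.
Qed.

Lemma pos_weight_fold_lt f b x a : b \in pos -> pairing b x < 0 ->
    (forall a, a \in roots D -> 0 <= f a) ->
    (forall a, a \in roots D -> f (rr b a) = f a) ->
    a \in pos -> - rr b a \in pos -> 0 < f (- a) ->
    pairing a x < 0 -> 0 <= pairing (rr b a) x ->
  pos_weight f x < pos_weight f (sr b x).
Proof.
move=> hb hx h0 hf h1 h2 hfa h3 h4.
have ha := pos_root h1.
rewrite -subr_gt0 pos_weight_fold //; last exact: pos_root hb.
rewrite (big_rem a) //=; apply: ltr_pwDl.
  by rewrite /fold_gain h1 h2 h3 [pairing (rr b a) x < 0]ltNge h4 /= mulr1 subr0 mulr1.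
rewrite big_seq; apply: sumr_ge0 => c /mem_rem hc; apply: fold_gain_ge0 => //.
by apply: h0; exact: opp_root.
Qed.

(** The length of [w] is the number of positive roots that are not counted by
[npos (act w rho_check)], see [has_lengthP]. *)
Definition npos x : nat := count (fun a => 0 < pairing a x) pos.

Lemma npos_pos_weight x : (npos x)%:R = pos_weight (fun=> 1) x.
Proof.
rewrite /pos_weight /npos -sum1_count natr_sum big_mkcond /= sum_pos [LHS]big_mkcond.
by apply: eq_bigr => a _; rewrite mul1r; case: (a \in pos);
  case: (0 < pairing a x); rewrite ?mulr1 ?mulr0.
Qed.

Lemma npos_fold b x : b \in pos -> pairing b x < 0 -> (npos x < npos (sr b x))%N.
Proof.
move=> hb hx; have hr := pos_root hb; rewrite -(ltr_nat R) !npos_pos_weight.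
apply: (@pos_weight_fold_lt _ b x b) => //; rewrite ?rr_diag ?opprK //.
by rewrite pairingNl oppr_ge0 ltW.
Qed.

End Folds.

(** * The Bruhat order as folding of a regular vector *)

Section Bruhat.
Context (R : realType) (n : nat) (D : rootDatum n) (omega : 'I_n -> 'cV[R]_n).
Hypothesis omegaE :
  forall i j, pairing (simple D j) (omega i) = (i == j)%:R.
Local Notation A := 'cV[R]_n.
Local Notation sr := (@root_reflection R n D).
Local Notation rr := (@reflected_root n D).
Local Notation alpha := (simple D).
Local Notation vrho := (rho_check omega).
Local Notation pos := (pos_roots D).
Local Notation folds := (folds D).
Local Notation npos := (npos D).
Implicit Types (a b : 'rV[int]_n) (x y : A) (w : 'M[int]_n).

Lemma pos_uniq : uniq pos.
Proof. by rewrite filter_uniq // roots_uniq. Qed.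

Lemma perm_pos_simple i :
  perm_eq (map (rr (alpha i)) (rem (alpha i) pos)) (rem (alpha i) pos).
Proof.
have ai := simple_root D i; have u := pos_uniq.
have memE b : (b \in rem (alpha i) pos) = (b != alpha i) && (b \in pos).
  by rewrite mem_rem_uniq.
have st b : b \in rem (alpha i) pos -> rr (alpha i) b \in rem (alpha i) pos.
  rewrite !memE => /andP[h1 h2]; have hb := pos_root h2.
  rewrite (simple_perm_pos omegaE) // andbT; apply: contraTneq h2 => e.
  rewrite -(rrK b ai) e rr_diag // (pos_opp omegaE) //.
  by rewrite (simple_pos omegaE).
apply: uniq_perm.
- rewrite map_inj_uniq ?rem_uniq //.
  by move=> b c /(congr1 (rr (alpha i))); rewrite !rrK.
- by rewrite rem_uniq.
move=> b; apply/mapP/idP => [[c hc ->]|hb]; first exact: st.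
by exists (rr (alpha i) b); rewrite ?rrK // st.
Qed.

Lemma count_pos_simple (P : pred 'rV[int]_n) i :
  (count (fun a => P (rr (alpha i) a)) pos + P (alpha i) =
   count P pos + P (- alpha i))%N.
Proof.
have hp := simple_pos omegaE i; have ai := simple_root D i.
rewrite !(permP (perm_to_rem hp)) /= rr_diag //.
have -> : count P (rem (alpha i) pos) =
    count (fun a => P (rr (alpha i) a)) (rem (alpha i) pos).
  by rewrite -(permP (perm_pos_simple i) P) count_map.
set c := count _ _; lia.
Qed.

Lemma npos_simple x i : pairing (alpha i) x < 0 ->
  npos (sr (alpha i) x) = (npos x).+1.
Proof.
move=> h; have := count_pos_simple (fun a => 0 < pairing a x) i.
rewrite pairingNl oppr_gt0 h ltNge (ltW h) /= addn0 addn1 => <-.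
by apply: eq_count => a; rewrite pairing_sr.
Qed.

Lemma npos_le x : (npos x <= size pos)%N.
Proof. exact: count_size. Qed.

Lemma npos_chamber x : npos x = size pos -> chamber D x.
Proof.
move=> /eqP; rewrite -all_count => /allP h a /h.
exact: ltW.
Qed.

Lemma npos_vrho : npos vrho = size pos.
Proof.
by apply/eqP; rewrite -all_count; apply/allP => a; exact: (pos_vrho omegaE).
Qed.

Definition wlength w : nat := size pos - npos (act w vrho).

Lemma wlength_word s : (wlength (word D s) <= size s)%N.
Proof.
rewrite /wlength; elim: s => [|i s IH] /=; first by rewrite act1 npos_vrho subnn.
rewrite actM act_refl; set x := act _ _ in IH *.
have := simple_root D i => ai.
have [h|h] := ltP (pairing (alpha i) x) 0; first by rewrite npos_simple //; lia.
have hs : pairing (alpha i) (sr (alpha i) x) < 0.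
  rewrite pairing_sr_diag // oppr_lt0 lt_neqAle h andbT eq_sym.
  by apply: (pairing_rho_check_neq0 omegaE) => //; exact: word_weyl.
have := npos_simple hs; rewrite srK // => e; lia.
Qed.

(** As long as the image of [rho_check] is not dominant some simple reflection
increases [npos]; once it is dominant, [w = 1]. *)
Lemma word_of_wlength w : weyl D w -> exists2 s, size s = wlength w & word D s = w.
Proof.
move: {2}(wlength w) (erefl (wlength w)) => k; elim: k w => [|k IH] w ek hw.
  exists [::] => //=; apply/esym/(weyl_vrho_inj omegaE) => //.
  apply: (dominant_unique omegaE) => //; first exact: (chamber_vrho omegaE).
  apply: npos_chamber; have := npos_le (act w vrho); move: ek; rewrite /wlength; lia.
have [i hi] : exists i, pairing (alpha i) (act w vrho) < 0.
  apply: contrapT => hn; suff e : act w vrho = vrho.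
    by move: ek; rewrite /wlength e npos_vrho subnn.
  apply: (dominant_unique omegaE) => //; first exact: (chamber_vrho omegaE).
  apply/(chamberP omegaE) => i; rewrite leNgt; apply/negP => h; apply: hn.
  by exists i.
have ai := simple_root D i.
have e : wlength (refl D (alpha i) *m w) = k.
  by move: ek; rewrite /wlength actM act_refl npos_simple //; lia.
have [|s hs ws] := IH _ e; first exact: weylS.
exists (i :: s) => /=; first by rewrite hs e ek.
by rewrite ws mulmxA refl_invol // mul1mx.
Qed.

Lemma has_lengthP w k : has_length D w k <-> weyl D w /\ k = wlength w.
Proof.
split=> [[[s <- <-] h]|[hw ->]].
  split; first exact: word_weyl.
  apply/eqP; rewrite eqn_leq wlength_word andbT.
  have [t <- ht] := word_of_wlength (word_weyl D s); exact: h.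
split; first by exact: word_of_wlength.
by move=> s <-; exact: wlength_word.
Qed.

Lemma wlength_fold w b : weyl D w -> b \in pos -> pairing b (act w vrho) < 0 ->
  (wlength (refl D b *m w) < wlength w)%N.
Proof.
move=> hw hb h; have := npos_fold omegaE hb h; rewrite /wlength actM act_refl.
have := npos_le (act w vrho); have := npos_le (sr b (act w vrho)); lia.
Qed.

(** A step of the Bruhat order from [w'] up to [w' s_b = s_c w'] is, read downwards,
the folding of [act (w' s_b) rho_check] in the positive root among [c], [- c]. *)
Lemma bruhat_folds u w : weyl D u -> bruhat_le D u w ->
  folds predT (act w vrho) (act u vrho).
Proof.
move=> hu; elim=> [|w' b k l _ IH hb /has_lengthP[hw hk] /has_lengthP[hw' hl] kl].
  exact: folds0.
apply: folds_trans IH.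
have [c [hc e1 _]] := weyl_conj omegaE hw hb.
have {c hc e1} [c hc e1] : exists2 c, c \in pos & w' *m refl D b = refl D c *m w'.
  have [h|h] := root_posVneg hc; first by exists c.
  by exists (- c); rewrite ?(refl_opp omegaE).
have hr := pos_root hc.
have hlt : pairing c (act (w' *m refl D b) vrho) < 0.
  rewrite e1 actM act_refl pairing_sr_diag // oppr_lt0 lt_neqAle eq_sym.
  rewrite (pairing_rho_check_neq0 omegaE) //= leNgt; apply/negP => /(wlength_fold hw hc).
  by rewrite -e1 -hl -hk; lia.
have <- : sr c (act (w' *m refl D b) vrho) = act w' vrho.
  by rewrite e1 actM act_refl srK.
exact: folds1.
Qed.

Lemma bruhat_trans u v w : bruhat_le D u v -> bruhat_le D v w -> bruhat_le D u w.
Proof. by move=> huv; elim=> // w' b k l _ IH hb hk hl kl; apply: bruhat_step IH hb hk hl kl. Qed.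

Lemma folds_bruhat u w : weyl D u -> weyl D w ->
  folds predT (act w vrho) (act u vrho) -> bruhat_le D u w.
Proof.
move=> hu hw; move e : (act u vrho) => y h; elim: h u hu e => [|z b _ IH hb _ hz] u hu e.
  by rewrite (weyl_vrho_inj2 omegaE hu hw e); exact: bruhat_refl.
have hr := pos_root hb.
have hv : weyl D (refl D b *m u) by exact: weylS.
have ev : act (refl D b *m u) vrho = z by rewrite actM act_refl e srK.
apply: bruhat_trans (IH _ hv ev).
have [c [hc e1 e2]] := weyl_conj omegaE hu (weyl_root hu hr).
have {e1} e1 : refl D b *m u = u *m refl D (b *m u).
  rewrite e1; congr (refl D _ *m _).
  have [u' [_ h1 h2]] := weyl_inv hu.
  by move/(congr1 (mulmx^~ u')): e2; rewrite -!mulmxA h2 !mulmx1.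
rewrite e1; apply: (@bruhat_step _ _ _ _ _ (wlength u) (wlength (u *m refl D (b *m u)))).
- exact: bruhat_refl.
- exact: weyl_root.
- exact/has_lengthP.
- by apply/has_lengthP; split=> //; rewrite -e1.
have : pairing b (act (refl D b *m u) vrho) < 0 by rewrite ev.
move=> /(wlength_fold hv hb); rewrite mulmxA refl_invol // mul1mx.
by rewrite e1.
Qed.

End Bruhat.

(** * The affine Weyl group and the fundamental alcove *)

Section Affine.
Context (R : realType) (n : nat) (D : rootDatum n) (omega : 'I_n -> 'cV[R]_n).
Hypothesis omegaE :
  forall i j, pairing (simple D j) (omega i) = (i == j)%:R.
Local Notation A := 'cV[R]_n.
Local Notation rc := (@coroot_vec R n D).
Local Notation sr := (@root_reflection R n D).
Local Notation rr := (@reflected_root n D).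
Local Notation ip := (@inner R n D).
Local Notation alpha := (simple D).
Local Notation pos := (pos_roots D).
Implicit Types (a b : 'rV[int]_n) (x y V : A) (w : 'M[int]_n).

Lemma int_ltD1 (x y : R) : x \is a Num.int -> y \is a Num.int -> x < y -> x + 1 <= y.
Proof.
move=> /intrP[p ->] /intrP[q ->]; rewrite ltr_int => h.
by rewrite -[1]/(1%:~R) -intrD ler_int lezD1.
Qed.

Lemma dominant_exists x : exists w, weyl D w /\ chamber D (act w x).
Proof.
move: {2}(size pos - npos D x)%N (erefl (size pos - npos D x)%N) => k.
elim/ltn_ind: k x => k IH x ek.
have [h|h] := pselect (forall i, 0 <= pairing (alpha i) x).
  by exists 1%:M; rewrite act1; split; [exact: weyl1 | apply/(chamberP omegaE)].
have [i hi] : exists i, pairing (alpha i) x < 0.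
  apply: contrapT => hn; apply: h => i; rewrite leNgt; apply/negP => hi.
  by apply: hn; exists i.
have e := npos_simple omegaE hi; have hle := npos_le D (sr (alpha i) x).
have [||w [hw hc]] := IH (size pos - npos D (sr (alpha i) x))%N _ (sr (alpha i) x) => //.
  by rewrite -ek e; lia.
exists (w *m refl D (alpha i)); rewrite actM act_refl; split=> //.
by apply: weylM => //; apply/weyl_refl/simple_root.
Qed.

(** The translations in the affine Weyl group.  Writing them as sums of coroots,
with repetitions, is what [star_orbit] inducts on. *)
Definition coroot_lattice (v : A) := exists2 l : seq 'rV[int]_n,
  {subset l <= roots D} & v = \sum_(b <- l) rc b.

Lemma coroot_lattice0 : coroot_lattice 0.
Proof. by exists [::]; rewrite ?big_nil. Qed.

Lemma coroot_latticeD u v : coroot_lattice u -> coroot_lattice v -> coroot_lattice (u + v).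
Proof.
move=> [l hl ->] [m hm ->]; exists (l ++ m); last by rewrite big_cat.
by move=> b; rewrite mem_cat => /orP[/hl|/hm].
Qed.

Lemma coroot_lattice_rc b : b \in roots D -> coroot_lattice (rc b).
Proof.
move=> hb; exists [:: b]; last by rewrite big_seq1.
by move=> c; rewrite inE => /eqP->.
Qed.

Lemma coroot_lattice_sr b v : b \in roots D -> coroot_lattice v -> coroot_lattice (sr b v).
Proof.
move=> hb [l hl ->]; exists (map (rr b) l).
  by move=> c /mapP[d hd ->]; rewrite rr_root // hl.
rewrite big_map -act_refl act_sum big_seq [RHS]big_seq.
by apply: eq_bigr => c hc; rewrite act_refl (root_reflection_coroot omegaE) // hl.
Qed.

Lemma coroot_lattice_act w v : weyl D w -> coroot_lattice v -> coroot_lattice (act w v).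
Proof.
move=> hw; move: w hw v; apply: weyl_ind => [v|b w hb _ IH v hv].
  by rewrite act1.
by rewrite actM act_refl; apply: coroot_lattice_sr => //; exact: IH.
Qed.

Lemma coroot_latticeN v : coroot_lattice v -> coroot_lattice (- v).
Proof.
move=> [l hl ->]; exists (map -%R l).
  by move=> c /mapP[d hd ->]; rewrite opp_root // hl.
rewrite big_map -sumrN big_seq [RHS]big_seq.
by apply: eq_bigr => c hc; rewrite (rcN omegaE) // hl.
Qed.

Lemma coroot_lattice_rcZ b (m : int) : b \in roots D -> coroot_lattice (m%:~R *: rc b).
Proof.
move=> hb.
have h (k : nat) : coroot_lattice (k%:R *: rc b).
  elim: k => [|k IH]; first by rewrite scale0r; exact: coroot_lattice0.
  by rewrite -natr1 scalerDl scale1r; apply: coroot_latticeD => //; exact: coroot_lattice_rc.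
case: m => k; first exact: h.
by rewrite NegzE mulrNz scaleNr; apply: coroot_latticeN; exact: h.
Qed.

Lemma coroot_lattice_int a v : coroot_lattice v -> pairing a v \is a Num.int.
Proof.
move=> [l hl ->]; rewrite pairing_sum; apply: rpred_sum => b _.
by rewrite pairing_rc intr_int.
Qed.

Lemma areflE a m x : arefl D a m x = act (refl D a) x + (- (m%:~R *: rc a)).
Proof. by rewrite act_refl /arefl /root_reflection scalerDl opprD addrA. Qed.

Lemma affine_weylP (g : A -> A) : affine_weyl D g <->
  exists w v, [/\ weyl D w, coroot_lattice v & g = fun x => act w x + v].
Proof.
split.
  elim=> [|a m h ha _ [w [v [hw hv ->]]]].
    exists 1%:M, 0; split; [exact: weyl1 | exact: coroot_lattice0 |].
    by apply: funext => x /=; rewrite act1 addr0.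
  exists (refl D a *m w), (act (refl D a) v - m%:~R *: rc a); split.
  - exact: weylS.
  - apply: coroot_latticeD; first by apply: coroot_lattice_act => //; exact: weyl_refl.
    by apply/coroot_latticeN/coroot_lattice_rcZ.
  - by apply: funext => x /=; rewrite areflE actD actM addrA.
move=> [w [v [hw hv ->]]].
have comp f h : affine_weyl D f -> affine_weyl D h -> affine_weyl D (f \o h : A -> A).
  move=> hf hh; elim: hf => // a m u ha _ IH.
  exact: (affine_weyl_refl m ha IH).
have ref a m : a \in roots D -> affine_weyl D (arefl D a m : A -> A).
  by move=> ha; apply: (@affine_weyl_refl _ _ D a m id ha); exact: affine_weyl_id.
have tr b : b \in roots D -> affine_weyl D ((+%R (rc b)) : A -> A).
  move=> hb; have -> : +%R (rc b) = arefl D b (-1) \o arefl D b 0 :> (A -> A).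
    apply: funext => x /=; rewrite !areflE scale0r oppr0 addr0 !act_refl srK //.
    by rewrite scaleN1r opprK addrC.
  by apply: comp; exact: ref.
have trv : affine_weyl D ((+%R v) : A -> A).
  case: hv => l hl ->; elim: l hl => [|b l IH] hl.
    have -> : +%R (\sum_(b <- [::]) rc b) = id by apply: funext => x; rewrite big_nil add0r.
    exact: affine_weyl_id.
  have -> : +%R (\sum_(c <- b :: l) rc c) = +%R (rc b) \o +%R (\sum_(c <- l) rc c).
    by apply: funext => x /=; rewrite big_cons addrA.
  apply: comp; first by apply: tr; apply: hl; rewrite inE eqxx.
  by apply: IH => c hc; apply: hl; rewrite inE hc orbT.
have lin : affine_weyl D (act w : A -> A).
  move: w hw; apply: weyl_ind => [|a w ha _ IH].
    have -> : act 1%:M = id :> (A -> A) by apply: funext => x; rewrite act1.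
    exact: affine_weyl_id.
  have -> : act (refl D a *m w) = arefl D a 0 \o act w :> (A -> A).
    by apply: funext => x /=; rewrite areflE scale0r oppr0 addr0 actM.
  by apply: comp => //; exact: ref.
have -> : (fun x => act w x + v) = +%R v \o act w by apply: funext => x /=; rewrite addrC.
exact: comp.
Qed.

Lemma affine_inv (g : A -> A) : affine_weyl D g ->
  exists g', [/\ affine_weyl D g', cancel g g' & cancel g' g].
Proof.
move=> /affine_weylP[w [v [hw hv ->]]]; have [w' [hw' h1 h2]] := weyl_inv hw.
exists (fun x => act w' x + - act w' v); split.
- by apply/affine_weylP; exists w', (- act w' v); split=> //; apply/coroot_latticeN/coroot_lattice_act.
- by move=> x /=; rewrite actD addrK -actM h1 act1.
- by move=> x /=; rewrite actD actN -!actM h2 !act1 subrK.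
Qed.

Lemma affine_comp (g h : A -> A) : affine_weyl D g -> affine_weyl D h ->
  affine_weyl D (g \o h).
Proof.
move=> /affine_weylP[w [v [hw hv ->]]] /affine_weylP[w' [v' [hw' hv' ->]]].
apply/affine_weylP; exists (w *m w'), (act w v' + v); split.
- exact: weylM.
- by apply: coroot_latticeD => //; exact: coroot_lattice_act.
- by apply: funext => x /=; rewrite actM actD addrA.
Qed.

(** Induction on the number of coroots in the translation [v].  If [v] is not 0,
some coroot [b] of the sum has positive pairing with it, namely 1 or 2.  If it is
1 then [s_b v] has one term less; if it is 2 then [y] lies on the wall where [b]
equals 1, and reflecting there removes two copies of [b] from [v] and adds one. *)
Lemma star_orbit (l : seq 'rV[int]_n) x y w : {subset l <= roots D} -> weyl D w ->
    (forall a, a \in roots D -> pairing a x <= 1) ->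
    (forall a, a \in roots D -> pairing a y <= 1) ->
    y = act w x + \sum_(b <- l) rc b ->
  exists2 w', weyl D w' & y = act w' x.
Proof.
move: {2}(size l) (erefl (size l)) => k; elim/ltn_ind: k l x y w => k IH l x y w ek hl hw hx hy ey.
set v := \sum_(b <- l) rc b in ey.
have [v0|v0] := eqVneq v 0; first by exists w; rewrite // ey v0 addr0.
(* otherwise the inner square of v would be a sum of nonpositive terms *)
have [b hb hbv] : exists2 b, b \in l & 0 < pairing b v.
  apply: contrapT => hn; have := ip_gt0 omegaE v0.
  rewrite ltNge => /negP; apply; rewrite {2}/v ip_sumr big_seq; apply: sumr_le0 => b hb.
  have h1 := ip_rc v (hl _ hb); have h2 := ip_rc_gt0 omegaE (hl _ hb).
  have h3 : pairing b v <= 0 by rewrite leNgt; apply/negP => h; apply: hn; exists b.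
  by have := mulr_le0_ge0 h3 (ltW h2); lra.
have hr := hl _ hb.
have hv2 : pairing b v <= 2.
  have e : pairing b y = pairing b (act w x) + pairing b v by rewrite ey pairingD.
  have h1 := hy _ hr; have := hx _ (opp_root (weyl_root hw hr)).
  by rewrite pairingNl -pairing_act; lra.
have hl' : {subset rem b l <= roots D} by move=> c /mem_rem/hl.
have sz : (size (rem b l) < k)%N.
  by rewrite size_rem // -ek; case: (l) hb => // c m _; rewrite /=; lia.
have ev : v = rc b + \sum_(c <- rem b l) rc c by rewrite /v (big_rem b).
have hyr : forall a, a \in roots D -> pairing a (sr b y) <= 1.
  by move=> a ha; rewrite pairing_sr; apply/hy/rr_root.
have : pairing b v \is a Num.int by apply: coroot_lattice_int; exists l.
move=> /intrP[m em]; move: hbv hv2; rewrite em ltr0z (ler_int _ m 2) => m0 m2.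
have {m0 m2} [m1|m2] : m = 1 \/ m = 2 by lia.
  have [||w' hw' e] := IH _ sz (rem b l) x (sr b y) (refl D b *m w) (erefl _) hl' _ hx hyr.
  - exact: weylS.
  - rewrite ey srD actM act_refl; congr (_ + _).
    by rewrite {1}/root_reflection em m1 scale1r ev addrC addKr.
  exists (refl D b *m w'); first exact: weylS.
  by rewrite actM act_refl -e srK.
have hby : pairing b y = 1.
  have e : pairing b y = pairing b (act w x) + pairing b v by rewrite ey pairingD.
  have h1 := hy _ hr; have := hx _ (opp_root (weyl_root hw hr)).
  by rewrite pairingNl -pairing_act; move: e; rewrite em m2; lra.
apply: (IH _ sz (rem b l) x y (refl D b *m w)) => //; first exact: weylS.
have -> : y = sr b y + rc b by rewrite /root_reflection hby scale1r subrK.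
rewrite ey srD actM act_refl -addrA; congr (_ + _).
rewrite {1}/root_reflection em m2 ev scaler_nat mulr2n opprD.
by rewrite addrA [rc b + _]addrC addrK subrK.
Qed.

Lemma alcove_le1 x a : alcove D x -> a \in roots D -> pairing a x <= 1.
Proof.
move=> hx ha; have [/hx/andP[_ //]|/hx/andP[]] := root_posVneg ha.
by rewrite pairingNl; lra.
Qed.

Lemma alcove_chamber x : alcove D x -> chamber D x.
Proof. by move=> hx a /hx/andP[]. Qed.

(** No two points of the closed fundamental alcove are conjugate: by [star_orbit]
the conjugating element may be taken linear, and both points are dominant. *)
Lemma alcove_fund x y (g : A -> A) : alcove D x -> alcove D y ->
  affine_weyl D g -> y = g x -> y = x.
Proof.
move=> hx hy /affine_weylP[w [_ [hw [l hl ->] ->]]] /= ey.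
have [w' hw' e] := star_orbit hl hw (fun a => alcove_le1 hx)
  (fun a => alcove_le1 hy) ey.
rewrite e; apply: (dominant_unique omegaE) => //; first exact: alcove_chamber.
by rewrite -e; exact: alcove_chamber.
Qed.

(** Points with a common denominator: among their conjugates a norm can be
minimised, as its values are discrete. *)
Definition rational_pt x := exists2 M : nat, (0 < M)%N &
  forall a, a \in roots D -> M%:R * pairing a x \is a Num.int.

(** A point with [<b, x> > 1] for some root [b] becomes shorter when reflected in
the wall where [b] equals 1; if there is no such [b], make the point dominant. *)
Lemma to_alcove x : rational_pt x ->
  exists2 g, affine_weyl D g & alcove D (g x).
Proof.
move=> [M M0 hM].
pose N y : R := M%:R ^+ 2 * ip y y.
have Nint y : (forall a, a \in roots D -> M%:R * pairing a y \is a Num.int) ->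
    N y \is a Num.int.
  move=> h; rewrite /N mulr_sumr big_seq; apply: rpred_sum => a ha.
  by rewrite expr2 mulrACA; apply: rpredM; exact: h.
have M0R : 0 < M%:R :> R by rewrite ltr0n.
have N0 y : 0 <= N y by rewrite /N mulr_ge0 ?ip_ge0 // exprn_ge0 // ltW.
have [k hk] : exists k : nat, N x < k%:R.
  by exists (Num.bound (N x)); exact: archi_boundP.
elim: k x hM hk => [|k IH] x hM hk; first by have := N0 x; lra.
have [h|h] := pselect (forall a, a \in roots D -> pairing a x <= 1).
  have [w [hw hc]] := dominant_exists x; exists (act w).
    apply/affine_weylP; exists w, 0; split=> //; first exact: coroot_lattice0.
    by apply: funext => y; rewrite addr0.
  move=> a ha; rewrite hc //= pairing_act; apply: h; apply: weyl_root => //.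
  exact: pos_root ha.
have [b hb hlt] : exists2 b, b \in roots D & 1 < pairing b x.
  apply: contrapT => hn; apply: h => a ha; rewrite leNgt; apply/negP => h.
  by apply: hn; exists a.
pose y := arefl D b (-1) x.
have ye : y = x - (pairing b x - 1) *: rc b by rewrite /y /arefl.
have hy a : a \in roots D -> M%:R * pairing a y \is a Num.int.
  move=> ha; rewrite ye pairingB pairingZ pairing_rc mulrBr mulrA mulrBr mulr1.
  apply: rpredB; first exact: hM.
  apply: rpredM; last exact: intr_int.
  by apply: rpredB; [exact: hM | exact: natr_int].
have Nlt : N y < N x.
  rewrite /N ltr_pM2l ?exprn_gt0 // ye.
  rewrite ipBr ipZr ![ip (_ - _) _]ipC !ipBr !ipZr [ip (rc b) x]ipC.
  have h1 := ip_rc x hb; have h2 := ip_rc_gt0 omegaE hb.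
  have h3 : 0 < (pairing b x - 1) * ip (rc b) (rc b) by rewrite mulr_gt0 // subr_gt0.
  set p := pairing b x in h1 h3 *; set c := ip x (rc b) in h1 *.
  have -> : c = p * ip (rc b) (rc b) / 2 by rewrite -h1; field.
  by set d := ip (rc b) (rc b) in h3 *; nra.
have [g hg hag] : exists2 g, affine_weyl D g & alcove D (g y).
  apply: IH => //; have := int_ltD1 (Nint _ hy) (Nint _ hM) Nlt.
  by move: hk; rewrite -natr1; lra.
exists (g \o arefl D b (-1)) => //; apply: affine_comp => //.
exact: (affine_weyl_refl (-1) hb (@affine_weyl_id _ _ _)).
Qed.

End Affine.

(** * Vertices, edges and their foldings *)

Section Faces.
Context (R : realType) (n : nat) (D : rootDatum n) (omega : 'I_n -> 'cV[R]_n).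
Hypothesis omegaE :
  forall i j, pairing (simple D j) (omega i) = (i == j)%:R.
Local Notation A := 'cV[R]_n.
Local Notation rc := (@coroot_vec R n D).
Local Notation sr := (@root_reflection R n D).
Local Notation vrho := (rho_check omega).
Local Notation pos := (pos_roots D).
Implicit Types (a b : 'rV[int]_n) (x y v V e f U z : A) (w : 'M[int]_n)
  (F E T : set A) (g : A -> A).

Lemma specialP V : special D V <->
  forall a, a \in roots D -> pairing a V \is a Num.int.
Proof.
split=> h a ha.
  have [m hm] := h a ha; rewrite -(addrK m%:~R (pairing a V)).
  by rewrite (hm : _ + _ = 0) sub0r rpredN intr_int.
by have /intrP[m hm] := h a ha; exists (- m); rewrite /hyp /= hm mulrNz subrr.
Qed.

Lemma special0 : special D (0 : A).
Proof. by apply/specialP => a _; rewrite pairing0 rpred0. Qed.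

Lemma specialD U V : special D U -> special D V -> special D (U + V).
Proof.
move=> /specialP hU /specialP hV; apply/specialP => a ha.
by rewrite pairingD rpredD ?hU ?hV.
Qed.

Lemma special_coroot_lattice v : coroot_lattice D v -> special D v.
Proof. by move=> hv; apply/specialP => a _; exact: (coroot_lattice_int _ hv). Qed.

Lemma face_at_refl x : face_at D x x.
Proof. by move=> a m _; split. Qed.

Lemma face_at_aff w v x : weyl D w -> special D v ->
  face_at D (act w x + v) = [set act w y + v | y in face_at D x].
Proof.
move=> hw /specialP hv; apply/seteqP; split=> z /=; last first.
  move=> [y hy <-] a m ha; have /intrP[k hk] := hv a ha.
  have := hy (a *m w) (k + m) (weyl_root hw ha).
  by rewrite /hyp_pos /hyp_neg /= !pairingD !pairing_act hk intrD !addrA.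
move=> hz; have [w' [hw' h1 h2]] := weyl_inv hw.
exists (act w' (z - v)); last by rewrite -actM h2 act1 subrK.
move=> a m ha; have ha' := weyl_root hw' ha.
have /intrP[k hk] := hv _ ha'.
have e1 : pairing (a *m w') (act w x + v) + (m - k)%:~R = pairing a x + m%:~R.
  by rewrite pairingD pairing_act -mulmxA h1 mulmx1 hk intrB; ring.
have e2 : pairing (a *m w') z + (m - k)%:~R = pairing a (act w' (z - v)) + m%:~R.
  by rewrite pairing_act pairingB hk intrB; ring.
by have := hz (a *m w') (m - k) ha'; rewrite /hyp_pos /hyp_neg /= e1 e2.
Qed.

Definition segment V e : set A := [set V + t *: e | t in [set t : R | 0 <= t <= 1]].

(** The segment is the closed face of each of its inner points; as [e] is not 0 it
is then an edge.  Unlike [is_edge] this remembers source and direction. *)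
Definition edge_at V e := e != 0 /\
  forall t, 0 < t < 1 -> face_at D (V + t *: e) = segment V e.
Definition vertex_at V := face_at D V = [set V].

Lemma segment_src V e : segment V e V.
Proof. by exists 0; rewrite /= ?lexx ?ler01 // scale0r addr0. Qed.

Lemma segment_tgt V e : segment V e (V + e).
Proof. by exists 1; rewrite /= ?lexx ?ler01 // scale1r. Qed.

Lemma segment_aff w v V e :
  [set act w y + v | y in segment V e] = segment (act w V + v) (act w e).
Proof.
apply/seteqP; split=> z /=.
  by move=> [_ [t ht <-] <-]; exists t => //; rewrite actD actZ addrAC.
by move=> [t ht <-]; exists (V + t *: e); [exists t | rewrite actD actZ addrAC].
Qed.

Lemma act_neq0 w e : weyl D w -> e != 0 -> act w e != 0.
Proof.
move=> hw; apply: contra => /eqP h; have [w' [_ h1 _]] := weyl_inv hw.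
by rewrite -(act1 e) -h1 actM h act0.
Qed.

Lemma edge_at_aff w v V e : weyl D w -> special D v -> edge_at V e ->
  edge_at (act w V + v) (act w e).
Proof.
move=> hw hv [e0 he]; split; first exact: act_neq0.
by move=> t /he h; rewrite -segment_aff -h -face_at_aff // actD actZ addrAC.
Qed.

Lemma vertex_at_aff w v V : weyl D w -> special D v -> vertex_at V ->
  vertex_at (act w V + v).
Proof.
by move=> hw hv h; rewrite /vertex_at face_at_aff // h image_set1.
Qed.

Lemma is_vertexP V : is_vertex D V <-> vertex_at V.
Proof.
split=> [[[x hx] _]|h].
  have := face_at_refl x; rewrite -hx /= => e.
  by rewrite /vertex_at {1}hx; congr (face_at D _).
split; first by exists V.
exists (0 : 'M_(0, n)); split.
- by rewrite /row_free mxrank0.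
- by case.
- by move=> x y /= -> ->; rewrite subrr trmx0 sub0mx.
Qed.

Lemma half_itv : (0 < 2^-1 :> R) && (2^-1 < 1 :> R).
Proof. by rewrite invr_gt0 ltr0n /= invf_lt1 ?ltr1n. Qed.

Lemma is_edge_segment V e : edge_at V e -> is_edge D (segment V e).
Proof.
move=> [e0 he]; split; first by exists (V + 2^-1 *: e); rewrite he // half_itv.
exists e^T; split.
- by rewrite /row_free rank_rV trmx_eq0 e0.
- move=> i; exists (V + e), V; split; [exact: segment_tgt | exact: segment_src|].
  by rewrite ord1 row_id addrC addKr.
- move=> _ _ [s _ <-] [t _ <-]; rewrite opprD addrACA subrr add0r -scalerBl.
  by rewrite linearZ scalemx_sub.
Qed.

Lemma edge_not_vertex E x : is_edge D E -> open_face D E x -> ~ is_vertex D x.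
Proof.
move=> [_ [B [fB hB _]]] hx /is_vertexP hv.
have [y [z []]] := hB ord0; rewrite hx hv /= => -> -> /eqP.
rewrite subrr trmx0 row_id => /eqP B0.
by move: fB; rewrite /row_free B0 mxrank0.
Qed.

Lemma segment_neq1 V e x : e != 0 -> segment V e <> [set x].
Proof.
move=> e0 h; have h0 := segment_src V e; have h1 := segment_tgt V e.
rewrite h /= in h0 h1; move/eqP: e0; apply.
by rewrite -(addKr V e) h1 -h0 addNr.
Qed.

Lemma open_segP V e x : edge_at V e -> vertex_at V -> vertex_at (V + e) ->
  open_face D (segment V e) x <-> exists2 t, 0 < t < 1 & x = V + t *: e.
Proof.
move=> he hV hVe; split; last first.
  by move=> [t ht ->]; rewrite /open_face /= he.2.
move=> h; have := face_at_refl x; rewrite -(h : segment V e = _) => -[t /andP[t0 t1] ex].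
exists t => //; apply/andP; split; rewrite lt_neqAle ?t0 ?t1 andbT.
- apply/eqP => e0; move: h; rewrite /open_face /= -ex -e0 scale0r addr0 hV.
  by apply: segment_neq1; case: he.
- apply/eqP => e1; move: h; rewrite /open_face /= -ex e1 scale1r hVe.
  by apply: segment_neq1; case: he.
Qed.

Lemma open_half V e : edge_at V e -> open_face D (segment V e) (V + 2^-1 *: e).
Proof. by move=> he; rewrite /open_face /= he.2 // half_itv. Qed.

Lemma vertex_in_segment V e x : edge_at V e -> vertex_at x -> segment V e x ->
  x = V \/ x = V + e.
Proof.
move=> [e0 he] hx [t /andP[t0 t1] ex].
move: t0; rewrite le_eqVlt => /orP[/eqP t0|t0].
  by left; rewrite -ex -t0 scale0r addr0.
move: t1; rewrite le_eqVlt => /orP[/eqP t1|t1].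
  by right; rewrite -ex t1 scale1r.
have := he t; rewrite t0 t1 ex hx => /(_ isT) /esym h.
by have := segment_neq1 e0 h.
Qed.

(** A wall that separates the ends would have the midpoint on one side, and the
whole face of the midpoint would lie on that side. *)
Lemma no_cross a V e (m : int) : a \in roots D -> edge_at V e ->
  pairing a V < m%:~R -> pairing a (V + e) <= m%:~R.
Proof.
move=> ha he hV; rewrite leNgt; apply/negP => hVe.
have h : face_at D (V + 2^-1 *: e) = segment V e by rewrite he.2 // half_itv.
have h0 := segment_src V e; have h1 := segment_tgt V e; rewrite -h in h0 h1.
have [h0p h0n] := h0 a (- m) ha; have [h1p h1n] := h1 a (- m) ha.
move: h0p h1n; rewrite /hyp_pos /hyp_neg /= mulrNz.
have [hle _ /(_ isT)|hle /(_ (ltW hle))] := lerP (pairing a (V + 2^-1 *: e) - m%:~R) 0; lra.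
Qed.

Lemma no_cross_neg a V e (m : int) : a \in roots D -> edge_at V e ->
  m%:~R < pairing a V -> m%:~R <= pairing a (V + e).
Proof.
move=> ha he h; have := @no_cross (- a) V e (- m) (opp_root ha) he.
by rewrite !pairingNl mulrNz ltrN2 lerN2; apply.
Qed.

Lemma pos_crossingsE V e :
  pos_crossings D V (segment V e) =
  count (fun a => (pairing a V \is a Num.int) && (0 < pairing a e)) pos.
Proof.
apply: eq_in_count => a ha; apply/asboolP/andP.
  move=> [m [hm hE]]; split.
    rewrite -(addrK m%:~R (pairing a V)) (hm : _ + _ = 0) sub0r rpredN.
    exact: intr_int.
  rewrite ltNge; apply/negP => h; apply: hE => _ [t /andP[t0 _] <-].
  rewrite /hyp_neg /= pairingD addrAC (hm : _ + _ = 0) add0r pairingZ.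
  exact: mulr_ge0_le0.
move=> [/intrP[m hm] he]; exists (- m); split.
  by rewrite /hyp /= hm mulrNz subrr.
move=> /(_ _ (segment_tgt V e)); rewrite /hyp_neg /= pairingD hm mulrNz addrAC subrr.
by rewrite add0r; lra.
Qed.

Lemma chamberD x y : chamber D x -> chamber D y -> chamber D (x + y).
Proof. by move=> hx hy a ha; rewrite pairingD addr_ge0 ?hx ?hy. Qed.
Lemma chamberZ t x : 0 <= t -> chamber D x -> chamber D (t *: x).
Proof. by move=> ht hx a ha; rewrite pairingZ mulr_ge0 ?hx. Qed.

Lemma sector_segment V e w : segment V e `<=` sector D V w <->
  exists2 x, chamber D x & e = act w x.
Proof.
split=> [h|[x hx ->] _ [t /andP[t0 _] <-]].
  have [x hx /addrI e1] := h _ (segment_tgt V e); exists x => //.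
by exists (t *: x); [exact: chamberZ | rewrite actZ].
Qed.

Lemma opp_sector_segment V e w : segment V e `<=` opp_sector D V w <->
  exists2 x, chamber D x & e = - act w x.
Proof.
split=> [h|[x hx ->] _ [t /andP[t0 _] <-]].
  have [x hx /addrI e1] := h _ (segment_tgt V e); exists x => //.
by exists (t *: x); [exact: chamberZ | rewrite actZ scalerN].
Qed.

Lemma sector_segment_tgt V e w : segment V e `<=` sector D (V + e) w <->
  exists2 x, chamber D x & e = - act w x.
Proof.
split=> [h|[x hx ->] _ [t /andP[_ t1] <-]].
  have [x hx e1] := h _ (segment_src V e); exists x => //.
  by apply: (addrI V); rewrite -{2}e1 addrK.
exists ((1 - t) *: x); first by apply: chamberZ; rewrite ?subr_ge0.
by rewrite actZ scalerBl scale1r scalerN addrA subrK.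
Qed.

(** Make [- rho_check] dominant: the element that does so sends every positive
root to a negative one. *)
Lemma opposition : exists w0 w0', [/\ weyl D w0, weyl D w0',
  w0 *m w0' = 1%:M, w0' *m w0 = 1%:M
  & forall x, chamber D x -> chamber D (- act w0 x) /\ chamber D (- act w0' x)].
Proof.
have [w [hw hc]] := dominant_exists omegaE (- vrho).
have hneg a : a \in pos -> - (a *m w) \in pos.
  move=> ha; have hr := pos_root ha; have ha' := weyl_root hw hr.
  rewrite (posP omegaE) ?opp_root // lt_neqAle eq_sym.
  apply/andP; split; last by have := hc _ ha; rewrite pairing_act pairingN pairingNl.
  have := pairing_rho_check_neq0 omegaE (@weyl1 _ D) ha'; rewrite act1 pairingNl oppr_eq0 //.
have [w' [hw' h1 h2]] := weyl_inv hw.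
have hneg' a : a \in pos -> - (a *m w') \in pos.
  move=> ha; have hr := pos_root ha; have ha' := weyl_root hw' hr.
  rewrite (pos_opp omegaE) //; apply/negP => /hneg.
  by rewrite -mulmxA h1 mulmx1 (pos_opp omegaE) // ha.
exists w, w'; split=> // x hx; split=> a ha.
  by have := hx _ (hneg _ ha); rewrite pairingN pairing_act pairingNl.
by have := hx _ (hneg' _ ha); rewrite pairingN pairing_act pairingNl.
Qed.

(** Sectors [V + w C] and [V - w C] become, after multiplying by the longest element,
the single condition that both directions lie in one closed chamber. *)
Lemma minimal_segment U e f : minimal D (segment U e) (U + e) (segment (U + e) f) <->
  exists2 w, weyl D w & exists x y,
    [/\ chamber D x, chamber D y, e = act w x & f = act w y].
Proof.
have [w0 [w0' [hw0 hw0' h1 h2 hc]]] := opposition; split.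
  move=> [w hw [/sector_segment_tgt[x hx ex] /opp_sector_segment[y hy ey]]].
  exists (w *m w0); first exact: weylM.
  exists (- act w0' x), (- act w0' y); split; [exact: (hc _ hx).2|exact: (hc _ hy).2| |].
    by rewrite ex actN -actM -mulmxA h1 mulmx1.
  by rewrite ey actN -actM -mulmxA h1 mulmx1.
move=> [w hw [x [y [hx hy ex ey]]]]; exists (w *m w0); first exact: weylM.
split.
  apply/sector_segment_tgt; exists (- act w0' x); first exact: (hc _ hx).2.
  by rewrite actN opprK -actM -mulmxA h1 mulmx1.
apply/opp_sector_segment; exists (- act w0' y); first exact: (hc _ hy).2.
by rewrite actN opprK -actM -mulmxA h1 mulmx1.
Qed.

Definition integral_on V : pred 'rV[int]_n := fun a => pairing a V \is a Num.int.

Lemma areflK b m x : b \in roots D -> arefl D b m (arefl D b m x) = x.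
Proof.
move=> hb; rewrite !areflE actD -actM refl_invol // act1 actN actZ act_refl.
by rewrite sr_rc_diag // scalerN opprK addrK.
Qed.

Lemma arefl_fix b m V : hyp b m V -> arefl D b m V = V.
Proof. by rewrite /arefl => /= ->; rewrite scale0r subr0. Qed.

Lemma arefl_segment b m V f : hyp b m V ->
  arefl D b m @` segment V f = segment V (sr b f).
Proof.
move=> h; have -> : arefl D b m = fun x : A => act (refl D b) x + - (m%:~R *: rc b).
  by apply: funext => x; rewrite areflE.
by rewrite segment_aff act_refl -act_refl -areflE arefl_fix // act_refl.
Qed.

Lemma edge_at_sr b m V f : b \in roots D -> hyp b m V -> edge_at V f ->
  edge_at V (sr b f).
Proof.
move=> hb h he; rewrite -{1}(arefl_fix h) areflE -act_refl.
apply: edge_at_aff => //; first exact: weyl_refl.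
by apply/special_coroot_lattice/(coroot_latticeN omegaE)/(coroot_lattice_rcZ omegaE).
Qed.

(** The chamber [V - C] on the negative side forces the root to be positive, and the
midpoint of the folded edge on the other side makes [b] negative on the old one. *)
Lemma pos_folding_segment V F f' : edge_at V f' -> vertex_at V ->
  pos_folding D V F (segment V f') ->
  exists b f, [/\ b \in pos, integral_on V b, pairing b f < 0, f' = sr b f &
                  F = segment V f].
Proof.
move=> he hV [b [m [hb hbm hF hs]]].
have eF : F = segment V (sr b f').
  rewrite -(arefl_segment _ hbm) hF; apply/seteqP; split=> x /=.
    by move=> hx; exists (arefl D b m x); [exists x | rewrite areflK].
  by move=> [_ [y hy <-] <-]; rewrite areflK.
have V0 : pairing b V + m%:~R = 0 by [].
have bV : integral_on V b.
  by rewrite /integral_on -(addrK m%:~R (pairing b V)) V0 sub0r rpredN intr_int.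
have hopen : open_face D (segment V f') (V + 2^-1 *: f') by exact: open_half.
have pb : pairing b vrho != 0.
  by have := pairing_rho_check_neq0 omegaE (@weyl1 _ D) hb; rewrite act1.
(* a regular point of the opposite chamber decides the sign of b *)
have hch : [set V - x | x in chamber D] (V - vrho).
  by exists vrho => //; exact: (chamber_vrho omegaE).
have pV t (g : A) : pairing b (V + t *: g) + m%:~R = t * pairing b g.
  by rewrite pairingD pairingZ addrAC V0 add0r.
have pVr : pairing b (V - vrho) + m%:~R = - pairing b vrho.
  by rewrite pairingB addrAC V0 add0r.
case: hs => -[h1 h2].
  have := h1 _ (or_intror hch); rewrite /hyp_neg /= pVr oppr_le0 => b0.
  have := h2 _ hopen; rewrite /hyp_neg /= pV => /negP; rewrite -ltNge.
  rewrite pmulr_rgt0 ?invr_gt0 ?ltr0n // => hf.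
  exists b, (sr b f'); split=> //; last by rewrite srK.
  - by rewrite (posP omegaE) // lt_neqAle eq_sym pb.
  - by rewrite pairing_sr_diag // oppr_lt0.
have := h1 _ (or_intror hch); rewrite /hyp_pos /= pVr oppr_ge0 => b0.
have := h2 _ hopen; rewrite /hyp_pos /= pV => /negP; rewrite -ltNge.
rewrite pmulr_rlt0 ?invr_gt0 ?ltr0n // => hf.
exists (- b), (sr b f'); split=> //.
- by rewrite (posP omegaE) ?opp_root // pairingNl oppr_gt0 lt_neqAle pb.
- by rewrite /integral_on pairingNl rpredN.
- by rewrite pairingNl pairing_sr_diag // opprK.
- by rewrite (srNl omegaE) // srK.
Qed.

Lemma pos_folding_intro V f b : edge_at V f -> vertex_at V -> b \in pos ->
  integral_on V b -> pairing b f < 0 -> pos_folding D V (segment V f) (segment V (sr b f)).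
Proof.
move=> he hV hb /intrP[m hm] hlt; have hr := pos_root hb.
have hbm : hyp b (- m) V by rewrite /hyp /= hm mulrNz subrr.
have V0 : pairing b V + (- m)%:~R = 0 by [].
exists b, (- m); split=> //; first by rewrite arefl_segment.
left; split.
  move=> x [[t /andP[t0 _] <-]|[y hy <-]]; rewrite /hyp_neg /=.
    by rewrite pairingD addrAC V0 add0r pairingZ mulr_ge0_le0 // ltW.
  by rewrite pairingB addrAC V0 add0r oppr_le0; exact: hy.
move=> x hx; have := face_at_refl x; rewrite -(hx : segment _ _ = _) => -[t /andP[t0 t1] ex].
rewrite /hyp_neg /= -ex pairingD addrAC V0 add0r pairingZ; apply/negP.
rewrite -ltNge pairing_sr_diag // mulr_gt0 ?oppr_gt0 // lt_neqAle t0 andbT.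
apply/eqP => e0; move: hx; rewrite /open_face /= -ex -e0 scale0r addr0 hV.
by apply: segment_neq1; case: (edge_at_sr hr hbm he).
Qed.

Lemma pos_foldings_segment V F0 F f : edge_at V f -> vertex_at V -> F = segment V f ->
  pos_foldings D V F0 F ->
  exists2 f0, folds D (integral_on V) f0 f & F0 = segment V f0.
Proof.
move=> he hV eF hF; elim: hF f he eF => [|F1 F2 _ IH hF] f he eF.
  by exists f => //; exact: folds0.
rewrite eF in hF; have [b [g [hb hbV hg ef eF1]]] := pos_folding_segment he hV hF.
have /intrP[m hm] := hbV.
have hbm : hyp b (- m) V by rewrite /hyp /= hm mulrNz subrr.
have hr := pos_root hb.
have [|f0 h0 e0] := IH g _ eF1; first by rewrite -(srK g hr) -ef; exact: (edge_at_sr hr hbm).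
by exists f0 => //; rewrite ef; apply: foldsS.
Qed.

Lemma folds_edge_at V f f0 : edge_at V f0 -> folds D (integral_on V) f0 f -> edge_at V f.
Proof.
move=> he; elim=> // g b _ IH hb /intrP[m hm] _.
by apply: (@edge_at_sr _ (- m)) => //; [exact: pos_root hb | rewrite /hyp /= hm mulrNz subrr].
Qed.

Lemma pos_foldings_intro V f0 f : edge_at V f0 -> vertex_at V ->
  folds D (integral_on V) f0 f -> pos_foldings D V (segment V f0) (segment V f).
Proof.
move=> he hV; elim=> [|g b hg IH hb hbV hlt]; first exact: pos_foldings0.
by apply: pos_foldingsS IH _; apply: pos_folding_intro => //; exact: folds_edge_at hg.
Qed.

Lemma same_type_conj F F' : same_type D F F' ->
  exists2 g, affine_weyl D g & F = g @` F'.
Proof.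
move=> [T [_ _ [g hg eg]] [_ _ [h hh eh]]].
have [g' [hg' c1 c2]] := affine_inv omegaE hg.
exists (g' \o h); first exact: affine_comp.
rewrite -[in RHS]image_comp -eh eg; apply/seteqP; split=> x /=.
  by move=> hx; exists (g x); [exists x | rewrite c1].
by move=> [_ [y hy <-] <-]; rewrite c1.
Qed.

Lemma has_type_conj F F' T g : affine_weyl D g -> F = g @` F' ->
  has_type D F' T -> has_type D F T.
Proof.
move=> hg eF [h1 h2 [h hh eT]]; split=> //.
have [g' [hg' c1 c2]] := affine_inv omegaE hg.
exists (h \o g'); first exact: affine_comp.
rewrite eT eF -[RHS]image_comp; congr (image _ h).
apply/seteqP; split=> x /=.
  by move=> hx; exists (g x); [exists x | rewrite c1].
by move=> [_ [y hy <-] <-]; rewrite c1.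
Qed.

(** Move an inner point of the face into the fundamental alcove; the alcove is
an intersection of half-spaces, so the whole face follows. *)
Lemma type_exists z : rational_pt D z -> exists T, has_type D (face_at D z) T.
Proof.
move=> hz; have [g hg hgz] := to_alcove omegaE hz.
exists (face_at D (g z)); split; first by exists (g z).
- move=> y hy a ha; have hr := pos_root ha; have /andP[h1 h2] := hgz a ha.
  have [p _] := hy a 0 hr; have [_ q] := hy a (-1) hr.
  move: p q; rewrite /hyp_pos /hyp_neg /= addr0 addr0 mulrNz !subr_le0.
  by move=> /(_ h1) -> /(_ h2).
- exists g => //; have /(affine_weylP omegaE)[w [v [hw hv eg]]] := hg.
  by rewrite eg face_at_aff //; exact: special_coroot_lattice.
Qed.

End Faces.

(** * LS-galleries in terms of displacements *)

Section Combinatorial.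
Context (R : realType) (n : nat) (D : rootDatum n) (omega : 'I_n -> 'cV[R]_n).
Hypothesis omegaE :
  forall i j, pairing (simple D j) (omega i) = (i == j)%:R.
Local Notation A := 'cV[R]_n.
Local Notation vrho := (rho_check omega).
Local Notation pos := (pos_roots D).
Local Notation edge_at := (edge_at D).
Local Notation vertex_at := (vertex_at D).
Local Notation folds := (folds D).
Implicit Types (a b : 'rV[int]_n) (x y v V f U z : A) (w : 'M[int]_n)
  (E F : set A) (g : A -> A) (e : nat -> A) (N k : nat).

Definition psum e k : A := \sum_(l < k) e l.

Lemma psum0 e : psum e 0 = 0.
Proof. by rewrite /psum big_ord0. Qed.

Lemma psumS e k : psum e k.+1 = psum e k + e k.
Proof. by rewrite /psum big_ord_recr. Qed.

Definition disp_gallery e N : gallery R n :=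
  (0, mkseq (fun k => (segment (psum e k) (e k), psum e k.+1)) N).

Lemma nedges_disp_gallery e N : nedges (disp_gallery e N) = N.
Proof. by rewrite /nedges size_mkseq. Qed.

Lemma vtx_disp_gallery e N k : (k <= N)%N -> vtx (disp_gallery e N) k = psum e k.
Proof.
rewrite /vtx /vertices /disp_gallery /= /unzip2 /mkseq -map_comp.
case: k => [|k] hk /=; first by rewrite psum0.
by rewrite (nth_map 0%N) ?size_iota // nth_iota.
Qed.

Lemma edg_disp_gallery e N k : (k < N)%N -> edg (disp_gallery e N) k = segment (psum e k) (e k).
Proof.
move=> hk; rewrite /edg /edges /disp_gallery /= /unzip1 /mkseq -map_comp.
by rewrite (nth_map 0%N) ?size_iota // nth_iota.
Qed.

Lemma target_vtx (d : gallery R n) : target d = vtx d (nedges d).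
Proof.
by rewrite /target /vtx /vertices /nedges (last_nth 0) size_map.
Qed.

Lemma target_disp_gallery e N : target (disp_gallery e N) = psum e N.
Proof. by rewrite target_vtx nedges_disp_gallery vtx_disp_gallery. Qed.

(** What the proof uses of the straight gallery: directions are dominant, every root
that vanishes on an edge is integral there, the direction changes only at special
vertices, and vertices are rational so that their types exist. *)
Record base_gallery e0 N : Prop := BaseGallery {
  base_size : (0 < N)%N;
  base_vert : forall k, (k <= N)%N -> vertex_at (psum e0 k);
  base_edge : forall k, (k < N)%N -> edge_at (psum e0 k) (e0 k);
  base_dom : forall k, (k < N)%N -> chamber D (e0 k);
  base_int : forall k a, (k < N)%N -> a \in roots D -> pairing a (e0 k) = 0 ->
    pairing a (psum e0 k) \is a Num.int;
  base_turn : forall k, (k.+1 < N)%N -> special D (psum e0 k.+1) \/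
    exists2 c : R, 0 < c & e0 k.+1 = c *: e0 k;
  base_rat : forall k, (k <= N)%N -> rational_pt D (psum e0 k);
  base_special : special D (psum e0 N) }.

Variables (e0 : nat -> A) (N : nat).
Hypothesis hb : base_gallery e0 N.

(** Edge by edge conjugate to the straight gallery under the affine Weyl group; the
conjugating elements of consecutive edges need not be related. *)
Definition conj_base e := forall k, (k < N)%N -> exists w v,
  [/\ weyl D w, coroot_lattice D v, psum e k = act w (psum e0 k) + v &
      e k = act w (e0 k)].

(** The edge after the vertex is folded from [act w (e0 k.+1)], which together with
the edge before it forms a minimal pair. *)
Definition turns_folded e := forall k, (k.+1 < N)%N -> exists2 w, weyl D w &
  e k = act w (e0 k) /\ folds (integral_on (psum e k.+1)) (act w (e0 k.+1)) (e k.+1).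

(** The decreasing sequence of sectors, with the Bruhat order replaced by foldings
of [rho_check]. *)
Definition defining_chain e := exists tau : nat -> 'M[int]_n,
  (forall k, (k < N)%N -> weyl D (tau k) /\ e k = act (tau k) (e0 k)) /\
  (forall k, (k.+1 < N)%N ->
     folds predT (act (tau k) vrho) (act (tau k.+1) vrho)).

Definition crossings_at V f : nat :=
  count (fun a => (pairing a V \is a Num.int) && (0 < pairing a f)) pos.

Definition crossings e : nat := \sum_(k < N) crossings_at (psum e k) (e k).

Definition dimension_eq e :=
  (crossings e)%:R = (rho R D *m (psum e0 N + psum e N)) ord0 ord0.

Record LS_disp e : Prop := LSDisp {
  LS_disp_typed : conj_base e;
  LS_disp_loc : turns_folded e;
  LS_disp_chain : defining_chain e;
  LS_disp_dim : dimension_eq e }.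

Lemma sharp_pos_disp_gallery e : sharp_pos D (disp_gallery e N) = crossings e.
Proof.
rewrite /sharp_pos nedges_disp_gallery; apply: eq_bigr => k _.
by rewrite vtx_disp_gallery ?edg_disp_gallery // ?pos_crossingsE // ltnW.
Qed.

Lemma conj_base_next e k : conj_base e -> (k < N)%N -> exists w v,
  [/\ weyl D w, coroot_lattice D v, psum e k = act w (psum e0 k) + v,
      e k = act w (e0 k) & psum e k.+1 = act w (psum e0 k.+1) + v].
Proof.
move=> ht hk; have [w [v [h1 h2 h3 h4]]] := ht k hk; exists w, v; split=> //.
by rewrite !psumS h3 h4 actD addrAC.
Qed.

Lemma conj_base_at e k : conj_base e -> (k <= N)%N -> exists w v,
  [/\ weyl D w, coroot_lattice D v & psum e k = act w (psum e0 k) + v].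
Proof.
move=> ht; rewrite leq_eqVlt => /orP[/eqP ->|hk]; last first.
  by have [w [v [*]]] := conj_base_next ht hk; exists w, v.
have N0 := base_size hb; have [|w [v [h1 h2 _ _ h]]] := @conj_base_next e N.-1 ht.
  by rewrite prednK.
by exists w, v; split=> //; rewrite prednK // in h.
Qed.

Lemma conj_base_vertex e k : conj_base e -> (k <= N)%N -> vertex_at (psum e k).
Proof.
move=> ht hk; have [w [v [h1 h2 ->]]] := conj_base_at ht hk.
by apply: (vertex_at_aff h1 (special_coroot_lattice h2)); exact: base_vert hb _ hk.
Qed.

Lemma conj_base_edge e k : conj_base e -> (k < N)%N -> edge_at (psum e k) (e k).
Proof.
move=> ht hk; have [w [v [h1 h2 -> -> _]]] := conj_base_next ht hk.
by apply: (edge_at_aff h1 (special_coroot_lattice h2)); exact: base_edge hb _ hk.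
Qed.

Lemma special_aff w v V : weyl D w -> coroot_lattice D v -> special D V ->
  special D (act w V + v).
Proof.
move=> hw hv /specialP hV; apply: specialD; last exact: special_coroot_lattice.
by apply/specialP => a ha; rewrite pairing_act; apply: hV; exact: weyl_root.
Qed.

Lemma conj_base_special e : conj_base e -> special D (psum e N).
Proof.
move=> ht; have [w [v [h1 h2 ->]]] := conj_base_at ht (leqnn N).
by apply: special_aff => //; exact: base_special hb.
Qed.

Lemma conj_base_int e k a : conj_base e -> (k < N)%N -> a \in roots D ->
  pairing a (e k) = 0 ->
  pairing a (psum e k) \is a Num.int /\ pairing a (psum e k.+1) \is a Num.int.
Proof.
move=> ht hk ha h.
suff h1 : pairing a (psum e k) \is a Num.int.
  by rewrite psumS pairingD h addr0.
have [w [v [hw hv -> ee]]] := ht k hk.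
rewrite pairingD rpredD //; last exact: (coroot_lattice_int _ hv).
rewrite pairing_act; apply: (base_int hb) => //; first exact: weyl_root.
by rewrite -pairing_act -ee.
Qed.

Lemma dominant_orbit_eq x y w w' : chamber D x -> chamber D y -> weyl D w ->
  weyl D w' -> act w x = act w' y -> x = y.
Proof.
move=> hx hy hw hw' e; have [u [hu h1 h2]] := weyl_inv hw.
have ex : x = act (u *m w') y by rewrite actM -e -actM h1 act1.
rewrite ex; apply: (dominant_unique omegaE) => //; first exact: weylM.
by rewrite -ex.
Qed.

Lemma rational_mid V f : rational_pt D V -> rational_pt D (V + f) ->
  rational_pt D (V + 2^-1 *: f).
Proof.
move=> [M1 M10 h1] [M2 M20 h2]; exists (2 * (M1 * M2))%N.
  by rewrite !muln_gt0 M10 M20.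
move=> a ha; have -> : (2 * (M1 * M2))%:R * pairing a (V + 2^-1 *: f) =
  M2%:R * (M1%:R * pairing a V) + M1%:R * (M2%:R * pairing a (V + f)) :> R.
  by rewrite !pairingD pairingZ !natrM; field.
by rewrite rpredD // rpredM ?natr_int // ?h1 ?h2.
Qed.

Lemma base_vert_type k : (k <= N)%N ->
  exists T, has_type D [set psum e0 k] T.
Proof.
move=> hk; rewrite -(base_vert hb hk); apply: (type_exists omegaE).
exact: (base_rat hb).
Qed.

Lemma base_edge_type k : (k < N)%N ->
  exists T, has_type D (segment (psum e0 k) (e0 k)) T.
Proof.
move=> hk; have he := base_edge hb hk.
rewrite -(he.2 2^-1) ?half_itv //; apply: (type_exists omegaE).
apply: rational_mid; first exact: (base_rat hb (ltnW hk)).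
by rewrite -psumS; exact: (base_rat hb).
Qed.

(** Each condition on sets is the one on displacements, by [minimal_segment],
[pos_foldings_intro], [sector_segment] and [folds_bruhat]. *)
Lemma LS_disp_gallery (ws : seq A) e :
    gconcat [seq gallery_of_path D (line_path x) | x <- ws] = disp_gallery e0 N ->
    \sum_(x <- ws) x = psum e0 N -> LS_disp e -> LS_gallery D ws (disp_gallery e N).
Proof.
move=> eg ew [ht hl [tau [htau hch]] hd].
have N0 := base_size hb; rewrite /LS_gallery /=; split.
- split; rewrite ?nedges_disp_gallery //.
  + by move=> k hk; rewrite vtx_disp_gallery //; apply/is_vertexP; exact: conj_base_vertex.
  + by move=> k hk; rewrite edg_disp_gallery //; apply/is_edge_segment/conj_base_edge.
  + move=> k hk; rewrite edg_disp_gallery // !vtx_disp_gallery // ?(ltnW hk) // psumS.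
    by split; [exact: segment_src | exact: segment_tgt].
  + by split; [exact: special0 | rewrite target_disp_gallery; exact: conj_base_special].
- by [].
- rewrite eg; split; rewrite ?nedges_disp_gallery //.
  + move=> k hk; rewrite !vtx_disp_gallery //; have [T hT] := base_vert_type hk.
    exists T => //; have [w [v [hw hv ->]]] := conj_base_at ht hk.
    apply: (has_type_conj omegaE (g := fun x => act w x + v) _ _ hT).
      by apply/(affine_weylP omegaE); exists w, v.
    by rewrite image_set1.
  + move=> k hk; rewrite !edg_disp_gallery //; have [T hT] := base_edge_type hk.
    exists T => //; have [w [v [hw hv -> -> _]]] := conj_base_next ht hk.
    apply: (has_type_conj omegaE (g := fun x => act w x + v) _ _ hT).
      by apply/(affine_weylP omegaE); exists w, v.
    by rewrite segment_aff.
- split.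
    rewrite nedges_disp_gallery => k hk; rewrite !edg_disp_gallery ?vtx_disp_gallery // ?(ltnW hk) //.
    have [w hw [ek hf]] := hl k hk.
    have hv : vertex_at (psum e k.+1) by apply: conj_base_vertex => //; exact: ltnW.
    have hed := conj_base_edge ht hk.
    have hed0 : edge_at (psum e k.+1) (act w (e0 k.+1)).
      elim: hf hed => // u b _ IH hbp /intrP[m hm] hlt hu; apply: IH.
      have hr := pos_root hbp.
      rewrite -(srK u hr); apply: (edge_at_sr omegaE (m := - m)) hu => //.
      by rewrite /hyp /= hm mulrNz subrr.
    exists (segment (psum e k.+1) (act w (e0 k.+1))).
      rewrite psumS; apply/(minimal_segment omegaE); exists w => //.
      exists (e0 k), (e0 k.+1); split=> //; apply: (base_dom hb) => //.
      exact: ltnW.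
    exact: (pos_foldings_intro omegaE).
  exists tau; split; rewrite nedges_disp_gallery => k hk.
    have [h1 h2] := htau k hk; split=> //.
    rewrite edg_disp_gallery // vtx_disp_gallery ?(ltnW hk) //; apply/sector_segment.
    by exists (e0 k) => //; exact: (base_dom hb).
  have [h1 _] := htau k (ltnW hk); have [h2 _] := htau _ hk.
  by apply: (folds_bruhat omegaE) => //; exact: hch.
- by rewrite sharp_pos_disp_gallery target_disp_gallery ew.
Qed.

(** Both ends can be moved together into the fundamental alcove, where no two
points are conjugate. *)
Lemma edge_ends V f g : edge_at V f -> (exists T, has_type D (segment V f) T) ->
  affine_weyl D g -> g V <> V + f.
Proof.
move=> [f0 _] [T [_ hT [h hh eT]]] hg e.
have [h' [hh' c1 c2]] := affine_inv omegaE hh.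
have aV : alcove D (h V) by apply: hT; rewrite eT; exists V => //; exact: segment_src.
have aVf : alcove D (h (V + f)).
  by apply: hT; rewrite eT; exists (V + f) => //; exact: segment_tgt.
have hcomp : affine_weyl D (h \o (g \o h')).
  by apply: (affine_comp omegaE) => //; apply: (affine_comp omegaE).
have : h (V + f) = h V.
  by apply: (alcove_fund omegaE aV aVf hcomp); rewrite /= c1 e.
move=> /(can_inj c1)/eqP; rewrite -subr_eq0 addrC addKr => /eqP f1.
by move/eqP: f0.
Qed.

(** An affine Weyl group element carries the straight edge to [E]; the given
vertices of [E] are its ends, in this order because the ends differ in type. *)
Lemma edge_typed V V' E (V0 f0 : A) : edge_at V0 f0 -> vertex_at V0 -> vertex_at (V0 + f0) ->
    (exists T, has_type D (segment V0 f0) T) ->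
    same_type D [set V] [set V0] -> same_type D [set V'] [set V0 + f0] ->
    same_type D E (segment V0 f0) -> E V -> E V' ->
  exists w v, [/\ weyl D w, coroot_lattice D v, V = act w V0 + v,
    V' = V + act w f0 & E = segment V (act w f0)].
Proof.
move=> he hV hVf hT /(same_type_conj omegaE)[g1 hg1 eg1].
move=> /(same_type_conj omegaE)[g2 hg2 eg2] /(same_type_conj omegaE)[g hg eg] EV EV'.
have V1 : V = g1 V0.
  by have : [set V] V by []; rewrite eg1 => -[_ -> <-].
have V2 : V' = g2 (V0 + f0).
  by have : [set V'] V' by []; rewrite eg2 => -[_ -> <-].
have /(affine_weylP omegaE)[w [v [hw hv egw]]] := hg.
have E1 : E = segment (g V0) (act w f0) by rewrite eg egw segment_aff.
have hE : edge_at (g V0) (act w f0).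
  by rewrite egw; apply: (edge_at_aff hw (special_coroot_lattice hv)).
have vaff (h : A -> A) W : affine_weyl D h -> vertex_at W -> vertex_at (h W).
  move=> /(affine_weylP omegaE)[u [t [hu htt ->]]].
  exact: (vertex_at_aff hu (special_coroot_lattice htt)).
have ge : g V0 + act w f0 = g (V0 + f0) by rewrite egw actD addrAC.
have [g' [hg' c1 c2]] := affine_inv omegaE hg.
exists w, v; rewrite E1 in EV EV'.
have hV1 : V = g V0.
  have [|//|] := vertex_in_segment hE _ EV; first by rewrite V1; exact: vaff.
  rewrite ge V1 => /(congr1 g'); rewrite c1 => e.
  have hc := affine_comp omegaE hg' hg1.
  by have := edge_ends he hT hc.
have hV2 : V' = g (V0 + f0).
  have [||//] := vertex_in_segment hE _ EV'; rewrite ?ge //; first by rewrite V2; exact: vaff.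
  rewrite V2 => e.
  have [g2' [hg2' d1 d2]] := affine_inv omegaE hg2.
  have hc := affine_comp omegaE hg2' hg.
  by case: (edge_ends he hT hc); rewrite /= -e d1.
split=> //; first by rewrite hV1 egw.
  by rewrite hV2 -ge hV1.
by rewrite hV1 E1.
Qed.

Lemma LS_gallery_disp (ws : seq A) d :
    gconcat [seq gallery_of_path D (line_path x) | x <- ws] = disp_gallery e0 N ->
    \sum_(x <- ws) x = psum e0 N -> LS_gallery D ws d ->
  exists2 e, LS_disp e & d = disp_gallery e N.
Proof.
move=> eg ew; rewrite /LS_gallery /= eg => -[[hN hV hE hVE _] hsrc hty [hloc [tau [hsec hbr]]] hdim].
have [eN htyV htyE] := hty; rewrite nedges_disp_gallery in eN; rewrite eN in hN hV hE hVE htyV htyE hloc hsec hbr.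
pose e k : A := vtx d k.+1 - vtx d k.
have d0 : vtx d 0 = 0 by rewrite -hsrc.
have eV k : psum e k = vtx d k.
  elim: k => [|k IH]; first by rewrite psum0 d0.
  by rewrite psumS IH /e addrC subrK.
have hedge k : (k < N)%N -> exists w v, [/\ weyl D w, coroot_lattice D v,
    psum e k = act w (psum e0 k) + v, e k = act w (e0 k) &
    edg d k = segment (psum e k) (e k)].
  move=> hk; have [h1 h2] := hVE k hk.
  have h3 := htyV k (ltnW hk); have h4 := htyV k.+1 hk; have h5 := htyE k hk.
  rewrite !vtx_disp_gallery ?edg_disp_gallery // ?(ltnW hk) // psumS in h3 h4 h5.
  (* the displacement e is defined by the vertices; the affine element found here
     shows that it is conjugate to the straight one *)
  have [||||w [v [hw hv ea eb ec]]] := edge_typed _ _ _ _ h3 h4 h5 h1 h2.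
  - exact: (base_edge hb).
  - exact: (base_vert hb (ltnW hk)).
  - by rewrite -psumS; exact: (base_vert hb).
  - exact: base_edge_type.
  have ek : e k = act w (e0 k) by rewrite /e eb addrC addKr.
  by exists w, v; rewrite eV ek.
have ed : d = disp_gallery e N.
  rewrite [LHS]surjective_pairing /disp_gallery; congr pair; first exact: hsrc.
  have sz : size d.2 = N by exact: eN.
  apply: (@eq_from_nth _ (set0, 0)); first by rewrite size_mkseq.
  move=> k; rewrite sz => hkN; rewrite nth_mkseq //.
  have [w [v [_ _ _ _ <-]]] := hedge k hkN; rewrite eV.
  rewrite /vtx /vertices /edg /edges /= /unzip1 /unzip2.
  by rewrite (nth_map (set0, 0)) ?sz // (nth_map (set0, 0)) ?sz //; case: nth.
exists e => //; have typ : conj_base e.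
  by move=> k hk; have [w [v [h1 h2 h3 h4 _]]] := hedge k hk; exists w, v.
split=> //.
- move=> k hk; have [F0 hmin hpf] := hloc k hk.
  have [w1 [v1 [hw1 hv1 _ e1 s1]]] := hedge k (ltnW hk).
  have [w2 [v2 [hw2 hv2 _ e2 s2]]] := hedge k.+1 hk.
  rewrite s2 -eV in hpf.
  have [||f hf ef] := pos_foldings_segment omegaE _ _ (erefl _) hpf.
  + exact: conj_base_edge.
  + by apply: conj_base_vertex => //; exact: ltnW.
  have /(minimal_segment omegaE)[w hw [x [y [hx hy ex ey]]]] :
      minimal D (segment (psum e k) (e k)) (psum e k + e k) (segment (psum e k + e k) f).
    by rewrite -s1 -psumS -ef eV.
  exists w => //.
  have xe : x = e0 k.
    apply: (dominant_orbit_eq hx _ hw hw1); last by rewrite -ex.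
    exact: (base_dom hb (ltnW hk)).
  have [u hu eu] := folds_weyl hf; have [u' [hu' c1 c2]] := weyl_inv hu.
  have ye : y = e0 k.+1.
    apply: (dominant_orbit_eq hy _ hw (weylM hu' hw2)); first exact: (base_dom hb).
    by rewrite actM -e2 eu -actM c1 act1 ey.
  by split; [rewrite -xe | rewrite -ye -ey].
- exists tau; split=> [k hk|k hk].
    have [h1 h2] := hsec k hk; have [w1 [v1 [hw1 hv1 _ e1 s1]]] := hedge k hk.
    move: h2; rewrite s1 -eV => /sector_segment[x hx ex]; split=> //.
    rewrite ex; congr (act _ _); apply: (dominant_orbit_eq hx _ h1 hw1); first exact: (base_dom hb).
    by rewrite -ex.
  have [h1 _] := hsec k (ltnW hk); have [h2 _] := hsec _ hk.
  by apply: (bruhat_folds omegaE) => //; exact: hbr.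
- move: hdim; rewrite ed sharp_pos_disp_gallery target_disp_gallery ew.
  by [].
Qed.

End Combinatorial.

(** * The dimension formula and integrality *)

Section Dimension.
Context (R : realType) (n : nat) (D : rootDatum n) (omega : 'I_n -> 'cV[R]_n).
Hypothesis omegaE :
  forall i j, pairing (simple D j) (omega i) = (i == j)%:R.
Local Notation A := 'cV[R]_n.
Local Notation sr := (@root_reflection R n D).
Local Notation rr := (@reflected_root n D).
Local Notation alpha := (simple D).
Local Notation pos := (pos_roots D).
Local Notation folds := (folds D).
Local Notation edge_at := (edge_at D).
Implicit Types (a b : 'rV[int]_n) (x y v V f U z : A) (w : 'M[int]_n)
  (e : nat -> A) (k : nat).

(** Distance to the next integer above.  It vanishes on integers, and the gaps of
[r] and [- r] add up to 1 otherwise. *)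
Definition gap (r : R) : R := (Num.ceil r)%:~R - r.

Lemma gap_ge0 r : 0 <= gap r.
Proof. by rewrite /gap subr_ge0 ceil_ge. Qed.

Lemma gap_int r : r \is a Num.int -> gap r = 0.
Proof. by move=> h; rewrite /gap ceilK // subrr. Qed.

Lemma gap_gt0 r : r \isn't a Num.int -> 0 < gap r.
Proof.
move=> h; rewrite lt_neqAle gap_ge0 andbT eq_sym subr_eq0.
by apply: contra h => /eqP <-; exact: intr_int.
Qed.

Lemma gapD r s : s \is a Num.int -> gap (r + s) = gap r.
Proof. by move=> h; rewrite /gap ceilDrz // intrD [(Num.ceil s)%:~R]ceilK // opprD addrACA subrr addr0. Qed.

(** On an edge the value rises from [x] to [y] without passing an integer; the edge
counts as a positive crossing iff [x] is an integer. *)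
Lemma gap_step (x y : R) : x < y ->
    (forall m : int, x < m%:~R -> y <= m%:~R) ->
  (x \is a Num.int)%:R - (y - x) = gap y - gap x.
Proof.
move=> xy h; rewrite /gap.
have [hx|hx] := boolP (x \is a Num.int).
  have cx := ceilK hx.
  have -> : Num.ceil y = Num.ceil x + 1.
    apply: ceil_def; rewrite addrK cx xy /=; apply: h.
    by rewrite intrD cx; lra.
  by rewrite intrD cx /=; ring.
have cx : x < (Num.ceil x)%:~R.
  rewrite lt_neqAle ceil_ge andbT; apply: contra hx => /eqP ->.
  exact: intr_int.
have -> : Num.ceil y = Num.ceil x.
  apply: ceil_def; rewrite h // andbT.
  by apply: lt_trans xy; exact: ceilB1_lt.
by rewrite /=; ring.
Qed.

Definition gap_weight V x : R := pos_weight D (fun a => gap (pairing a V)) x.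

Lemma gap_weight_special V x : special D V -> gap_weight V x = 0.
Proof.
move=> /specialP h; rewrite /gap_weight /pos_weight big_seq; apply: big1 => a ha.
by rewrite gap_int ?h // !mul0r.
Qed.

Lemma gap_weight_scale V c x : 0 < c -> gap_weight V (c *: x) = gap_weight V x.
Proof.
by move=> hc; apply: eq_bigr => a _; rewrite pairingZ pmulr_rgt0.
Qed.

Lemma gap_weight_inv b V a : b \in roots D -> integral_on V b ->
  gap (pairing (rr b a) V) = gap (pairing a V).
Proof.
move=> hr hb; rewrite -pairing_sr pairing_srE; apply: gapD.
by rewrite rpredN rpredM ?intr_int.
Qed.

Lemma gap_weight_fold V b x : b \in pos -> integral_on V b -> pairing b x < 0 ->
  gap_weight V x <= gap_weight V (sr b x).
Proof.
move=> hb hbV hx; have hr := pos_root hb; apply: (pos_weight_fold_le omegaE) => //.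
  by move=> a _; exact: gap_ge0.
by move=> a _; exact: gap_weight_inv.
Qed.

Lemma gap_weight_folds V x y : folds (integral_on V) x y -> gap_weight V x <= gap_weight V y.
Proof.
elim=> // u b _ IH hb hbV hu; apply: le_trans IH _; exact: gap_weight_fold.
Qed.

(** The last folding that makes [alpha i] nonnegative on the direction is in a root
[b] such that [s_b] makes [alpha i] negative, because [alpha i] is simple.  So the
contribution of [alpha i] to the gain is positive, as [alpha i] is not integral at [V]. *)
Lemma gap_weight_folds_neg V x y i : folds (integral_on V) x y -> gap_weight V y <= gap_weight V x ->
    ~~ integral_on V (alpha i) -> pairing (alpha i) x < 0 ->
  pairing (alpha i) y < 0.
Proof.
move=> hf hle hi hx; elim: hf hle => // u b hxu IH hb hbV hu hle.
have hr := pos_root hb; have ai := simple_root D i; have hp := simple_pos omegaE i.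
have huy := gap_weight_fold hb hbV hu.
have hau : pairing (alpha i) u < 0 by apply: IH; exact: le_trans hle.
rewrite ltNge; apply/negP => hnn.
have hne : b != alpha i by apply: contraNneq hi => <-.
have hpint : 0 < (cartan D (alpha i) b)%:~R :> R.
  have : (cartan D (alpha i) b)%:~R * pairing b u < 0.
    by move: hnn; rewrite pairing_srE; lra.
  by rewrite nmulr_llt0.
have hrr : - rr b (alpha i) \in pos.
  rewrite (pos_opp omegaE) ?rr_root //; apply/negP => hrp.
  move/eqP: hne; apply; apply: (pos_support1 omegaE) => // j ji.
  have h1 := pos_omega omegaE j hrp; have h2 := pos_omega omegaE j hb.
  rewrite -pairing_sr pairing_srE omegaE (negPf ji) sub0r oppr_ge0 in h1.
  by apply/eqP; rewrite eq_le h2 andbT -(pmulr_rle0 _ hpint).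
have : gap_weight V u < gap_weight V (sr b u).
  apply: (pos_weight_fold_lt omegaE (a := alpha i)) => //.
  - by move=> a _; exact: gap_ge0.
  - by move=> a _; exact: gap_weight_inv.
  - rewrite pairingNl; apply: gap_gt0; rewrite rpredN; exact: hi.
  - by rewrite -pairing_sr.
have := gap_weight_folds hxu; lra.
Qed.

Lemma sum_abs_weyl x w : weyl D w ->
  \sum_(a <- pos) `|pairing a (act w x)| = \sum_(a <- pos) `|pairing a x|.
Proof.
move=> hw.
have h y : 2 * \sum_(a <- pos) `|pairing a y| = \sum_(a <- roots D) `|pairing a y|.
  rewrite (sum_roots_pos omegaE) mulr_sumr; apply: eq_bigr => a _.
  by rewrite pairingNl normrN; ring.
have : 2 * \sum_(a <- pos) `|pairing a (act w x)| =
    2 * \sum_(a <- pos) `|pairing a x|.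
  rewrite !h -(sum_roots_weyl (fun a => `|pairing a x|) hw).
  by apply: eq_bigr => a _; rewrite pairing_act.
by move/(mulfI _); apply; rewrite pnatr_eq0.
Qed.

Lemma rhoE y : (rho R D *m y) ord0 ord0 = 2^-1 * \sum_(a <- pos) pairing a y.
Proof.
rewrite /rho -scalemxAl mxE mulmx_suml summxE; congr (_ * _).
Qed.

(** Root by root this is [gap_step], applied to the positive roots that increase
along the edge. *)
Lemma edge_defect V f : edge_at V f ->
  \sum_(a <- pos) Num.max 0 (pairing a f) - (crossings_at D V f)%:R =
  gap_weight V f - gap_weight (V + f) f.
Proof.
move=> he; have -> : (crossings_at D V f)%:R = \sum_(a <- pos)
    ((pairing a V \is a Num.int) && (0 < pairing a f)%R)%:R :> R.
  rewrite /crossings_at -sum1_count natr_sum big_mkcond; apply: eq_bigr => a _.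
  by case: (_ && _).
rewrite /gap_weight /pos_weight -!sumrB sum_pos [LHS]big_mkcond big_seq [RHS]big_seq.
apply: eq_bigr => a ha; case: (boolP (a \in pos)) => hp; last first.
  by rewrite !mulr0 !mul0r subrr.
rewrite !mulr1 maxEle; have [h0|h0] := leP 0 (pairing a f); last first.
  by rewrite ltNge (ltW h0) /= andbF !mulr0 subrr.
move: h0; rewrite le_eqVlt => /orP[/eqP <-|h0].
  by rewrite ltxx andbF !mulr0.
rewrite h0 andbT !mulr1.
have := @gap_step (pairing a V) (pairing a (V + f)).
rewrite {1}pairingD ltrDl h0 => /(_ isT (fun m => no_cross ha he)).
by rewrite {1}pairingD; lra.
Qed.

Variables (e0 : nat -> A) (N : nat).
Hypothesis hb : base_gallery D e0 N.

(** As [e0 k] is dominant, its pairing with twice [rho] is the sum of the absolute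
values of the positive roots on it, which is constant on Weyl orbits. *)
Lemma rho_sum e : conj_base D e0 N e ->
  (rho R D *m (psum e0 N + psum e N)) ord0 ord0 =
  \sum_(k < N) \sum_(a <- pos) Num.max 0 (pairing a (e k)).
Proof.
move=> ht; rewrite rhoE.
have -> : \sum_(a <- pos) pairing a (psum e0 N + psum e N) =
   \sum_(k < N) \sum_(a <- pos) (pairing a (e0 k) + pairing a (e k)).
  rewrite exchange_big /=; apply: eq_bigr => a _.
  by rewrite pairingD !pairing_sum -big_split.
rewrite mulr_sumr; apply: eq_bigr => k _; rewrite big_split /=.
have -> : \sum_(a <- pos) pairing a (e0 k) = \sum_(a <- pos) `|pairing a (e k)|.
  have [w [v [hw _ _ ->]]] := ht k (ltn_ord k); rewrite sum_abs_weyl //.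
  rewrite big_seq [RHS]big_seq; apply: eq_bigr => a ha; rewrite ger0_norm //.
  exact: (base_dom hb (ltn_ord k)).
rewrite -big_split mulr_sumr; apply: eq_bigr => a _ /=.
by rewrite maxEle; case: leP => h; [rewrite ger0_norm | rewrite ltr0_norm]; lra.
Qed.

Definition turn e k : R :=
  gap_weight (psum e k.+1) (e k.+1) - gap_weight (psum e k.+1) (e k).

(** Sum [edge_defect] over the edges and regroup by vertices; both ends of the
gallery are special and contribute nothing. *)
Lemma rho_defect e : conj_base D e0 N e ->
  (rho R D *m (psum e0 N + psum e N)) ord0 ord0 - (crossings D N e)%:R =
  \sum_(k < N.-1) turn e k.
Proof.
move=> ht; rewrite (rho_sum ht) /crossings natr_sum -sumrB.
have -> : \sum_(k < N) (\sum_(a <- pos) Num.max 0 (pairing a (e k)) -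
    (crossings_at D (psum e k) (e k))%:R) =
    \sum_(k < N) (gap_weight (psum e k) (e k) - gap_weight (psum e k.+1) (e k)).
  apply: eq_bigr => k _; rewrite psumS edge_defect //.
  exact: (conj_base_edge hb).
have hs := conj_base_special hb ht; have N0 := base_size hb.
rewrite -(prednK N0) in hs *; set m := N.-1 in hs *.
have tele : forall m, \sum_(k < m.+1) (gap_weight (psum e k) (e k) - gap_weight (psum e k.+1) (e k)) =
   gap_weight (psum e 0) (e 0%N) - gap_weight (psum e m.+1) (e m) + \sum_(k < m) turn e k.
  elim=> [|p IH]; first by rewrite big_ord_recr /= !big_ord0 add0r addr0.
  by rewrite big_ord_recr IH [in RHS]big_ord_recr /turn /=; ring.
by rewrite tele psum0 !gap_weight_special ?subrr ?add0r //; exact: special0.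
Qed.

(** At a special vertex all gaps vanish; at the others the straight gallery keeps
its direction, so both vectors are proportional. *)
Lemma turn_start e k w : conj_base D e0 N e -> (k.+1 < N)%N -> weyl D w ->
  e k = act w (e0 k) ->
  gap_weight (psum e k.+1) (e k) = gap_weight (psum e k.+1) (act w (e0 k.+1)).
Proof.
move=> ht hk hw ek; have [hs|[c hc ec]] := base_turn hb hk; last first.
  by rewrite ec actZ gap_weight_scale // ek.
have [w' [v [h1 h2 h3]]] := conj_base_at hb ht (ltnW hk).
by rewrite !gap_weight_special // h3; exact: special_aff.
Qed.

Lemma turn_ge0 e k : conj_base D e0 N e -> turns_folded D e0 N e -> (k.+1 < N)%N ->
  0 <= turn e k.
Proof.
move=> ht hl hk; have [w hw [ek hf]] := hl k hk.
by rewrite subr_ge0 (turn_start ht hk hw ek); exact: gap_weight_folds.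
Qed.

(** In an LS-gallery the total in [rho_defect] is 0 and its terms are nonnegative, so
no turn changes [gap_weight] and [gap_weight_folds_neg] applies. *)
Lemma turn_neg e k i : LS_disp D omega e0 N e -> (k.+1 < N)%N ->
    pairing (alpha i) (psum e k.+1) \isn't a Num.int ->
  pairing (alpha i) (e k) < 0 -> pairing (alpha i) (e k.+1) < 0.
Proof.
move=> [ht hl _ hd] hk hni hneg; have := rho_defect ht.
rewrite -hd subrr => /esym/eqP; rewrite psumr_eq0; last first.
  by move=> j _; apply: turn_ge0 => //; have := ltn_ord j; lia.
have hk' : (k < N.-1)%N by lia.
move=> /allP/(_ (Ordinal hk') (mem_index_enum _)) /=.
rewrite subr_eq0 => /eqP e1.
have [w hw [ek hf]] := hl k hk.
apply: (gap_weight_folds_neg hf) => //.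
  by rewrite e1 (turn_start ht hk hw ek).
have [hs|[c hc ec]] := base_turn hb hk; last first.
  by rewrite ec actZ -ek pairingZ pmulr_rlt0.
have [w' [v [h1 h2 h3]]] := conj_base_at hb ht (ltnW hk).
have /specialP := special_aff h1 h2 hs; rewrite -h3 => /(_ _ (simple_root D i)).
by rewrite (negPf hni).
Qed.

Lemma LS_disp_base : LS_disp D omega e0 N e0.
Proof.
have ht : conj_base D e0 N e0.
  move=> k hk; exists 1%:M, 0; rewrite !act1 addr0.
  by split=> //; [exact: weyl1 | exact: coroot_lattice0].
split=> //.
- move=> k hk; exists 1%:M; first exact: weyl1.
  by rewrite !act1; split=> //; exact: folds0.
- exists (fun=> 1%:M); split=> k hk; last exact: folds0.
  by rewrite act1; split=> //; exact: weyl1.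
- apply/esym/eqP; rewrite /dimension_eq -subr_eq0 (rho_defect ht); apply/eqP/big1 => k _.
  have hk : (k.+1 < N)%N by have := ltn_ord k; lia.
  rewrite /turn (@turn_start e0 k 1%:M) ?act1 ?subrr //; exact: weyl1.
Qed.

End Dimension.

(** * Root operators on displacements *)

Section Block.
Context (R : realType) (n : nat) (D : rootDatum n) (omega : 'I_n -> 'cV[R]_n).
Hypothesis omegaE :
  forall i j, pairing (simple D j) (omega i) = (i == j)%:R.
Local Notation A := 'cV[R]_n.
Local Notation rc := (@coroot_vec R n D).
Local Notation sr := (@root_reflection R n D).
Local Notation rr := (@reflected_root n D).
Local Notation alpha := (simple D).
Local Notation vrho := (rho_check omega).
Local Notation pos := (pos_roots D).
Local Notation folds := (folds D).
Implicit Types (a b : 'rV[int]_n) (x y v V f U z : A) (w : 'M[int]_n)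
  (e : nat -> A) (k l : nat).

Variables (e0 : nat -> A) (N : nat).
Hypothesis hb : base_gallery D e0 N.
Variable i : 'I_n.
Local Notation LS_disp := (LS_disp D omega e0 N).
Local Notation conj_base := (conj_base D e0 N).
Local Notation s := (sr (alpha i)).
Let ai := simple_root D i.
Let ap := simple_pos omegaE i.

Definition wall_height e k : R := pairing (alpha i) (psum e k).
Local Notation height := wall_height.

Lemma heightS e k : height e k.+1 = height e k + pairing (alpha i) (e k).
Proof. by rewrite /height psumS pairingD. Qed.

Lemma height0 e : height e 0 = 0.
Proof. by rewrite /height psum0 pairing0. Qed.

(** The effect of both root operators on displacements: an affine reflection between
the vertices [P] and [Q], and a translation after [Q]. *)
Definition reflect_block P Q e k : A := if (P <= k < Q)%N then s (e k) else e k.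

Lemma blockK P Q e : reflect_block P Q (reflect_block P Q e) = e.
Proof. by apply: funext => k; rewrite /reflect_block; case: (P <= k < Q)%N; rewrite ?srK. Qed.

Lemma int_strict (m x : R) : m \is a Num.int -> m < x < m + 1 ->
  x \isn't a Num.int.
Proof.
move=> hm /andP[h1 h2]; apply/negP => hx; have := int_ltD1 hm hx h1; lra.
Qed.

(** [act w x] lies in the closed chamber of [act w rho_check]. *)
Lemma sign_pos w x a : weyl D w -> chamber D x -> a \in roots D ->
  0 < pairing a (act w x) -> 0 < pairing a (act w vrho).
Proof.
move=> hw hx ha h; have hr := weyl_root hw ha.
rewrite pairing_act -(posP omegaE) // -[_ \in _]negbK -(pos_opp omegaE) //.
apply/negP => /hx; rewrite pairingNl -pairing_act; lra.
Qed.

Lemma sign_nonneg w x a : weyl D w -> chamber D x -> a \in roots D ->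
  0 < pairing a (act w vrho) -> 0 <= pairing a (act w x).
Proof.
move=> hw hx ha; rewrite (pairing_weyl_vrho omegaE) // pairing_act; exact: hx.
Qed.

Lemma sign_neg w x a : weyl D w -> chamber D x -> a \in roots D ->
  pairing a (act w x) < 0 -> pairing a (act w vrho) < 0.
Proof.
move=> hw hx ha h; have := @sign_pos w x (- a) hw hx (opp_root ha).
by rewrite !pairingNl !oppr_gt0; apply.
Qed.

Lemma sign_nonpos w x a : weyl D w -> chamber D x -> a \in roots D ->
  pairing a (act w vrho) < 0 -> pairing a (act w x) <= 0.
Proof.
move=> hw hx ha h; have := @sign_nonneg w x (- a) hw hx (opp_root ha).
by rewrite !pairingNl oppr_gt0 oppr_ge0; apply.
Qed.

Lemma integral_on_rr V b : integral_on V (alpha i) -> integral_on V b -> integral_on V (rr (alpha i) b).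
Proof.
move=> h1 h2; rewrite /integral_on -pairing_sr pairing_srE rpredB // rpredM //.
exact: intr_int.
Qed.

Section Reflect.
Variables (e : nat -> A) (P Q : nat).
Hypotheses (PQ : (P < Q)%N) (QN : (Q <= N)%N).
Hypothesis hP : height e P \is a Num.int.
Hypothesis hQ : height e Q \is a Num.int.
Local Notation e' := (reflect_block P Q e).

Lemma block_low k : (k < P)%N -> e' k = e k.
Proof. by move=> h; rewrite /reflect_block leqNgt h. Qed.

Lemma block_mid k : (P <= k < Q)%N -> e' k = s (e k).
Proof. by rewrite /reflect_block => ->. Qed.

Lemma block_high k : (Q <= k)%N -> e' k = e k.
Proof. by move=> h; rewrite /reflect_block ltnNge h andbF. Qed.

Lemma psum_low k : (k <= P)%N -> psum e' k = psum e k.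
Proof.
elim: k => [|k IH] hk; first by rewrite !psum0.
by rewrite !psumS IH ?block_low // ltnW.
Qed.

Lemma psum_mid k : (P <= k <= Q)%N ->
  psum e' k = psum e k - (height e k - height e P) *: rc (alpha i).
Proof.
elim: k => [|k IH] /andP[h1 h2].
  have P0 : P = 0%N by apply/eqP; rewrite -leqn0.
  by rewrite psum_low // P0 subrr scale0r subr0.
have [hk|hk] := leqP P k; last first.
  have kP : k.+1 = P by apply/eqP; rewrite eqn_leq hk h1.
  by rewrite kP psum_low // subrr scale0r subr0.
rewrite !psumS IH ?hk ?(ltnW h2) // block_mid ?hk // heightS /root_reflection.
by rewrite addrACA -opprD -scalerDl; congr (_ - _ *: _); ring.
Qed.

Lemma psum_high k : (Q <= k)%N ->
  psum e' k = psum e k - (height e Q - height e P) *: rc (alpha i).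
Proof.
elim: k => [|k IH] hk; first by move: PQ; rewrite ltnNge (leq_trans hk).
have [hk'|hk'] := leqP Q k; first by rewrite !psumS IH // block_high // addrAC.
have -> : k.+1 = Q by apply/eqP; rewrite eqn_leq hk hk'.
by rewrite psum_mid // leqnn ltnW.
Qed.

Lemma psum_mid_sr k : (P <= k <= Q)%N ->
  psum e' k = s (psum e k) + height e P *: rc (alpha i).
Proof. by move=> hk; rewrite psum_mid // /root_reflection scalerBl opprB [X in _ + X]addrC addrA. Qed.

Lemma pairing_shift m b x : m \is a Num.int ->
  (pairing b (x - m *: rc (alpha i)) \is a Num.int) =
  (pairing b x \is a Num.int).
Proof.
move=> hm; rewrite pairingB pairingZ pairing_rc rpredBr //.
by rewrite rpredM ?intr_int.
Qed.

Lemma integral_on_high k b : (Q <= k)%N -> integral_on (psum e' k) b = integral_on (psum e k) b.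
Proof. by move=> hk; rewrite /integral_on psum_high // pairing_shift // rpredB. Qed.

Lemma integral_on_mid k b : (P <= k <= Q)%N ->
  integral_on (psum e' k) b = integral_on (psum e k) (rr (alpha i) b).
Proof.
move=> hk; rewrite /integral_on psum_mid_sr // pairingD pairingZ pairing_rc -pairing_sr.
by rewrite rpredDr // rpredM ?intr_int.
Qed.

Lemma conj_base_block : conj_base e -> conj_base e'.
Proof.
move=> ht k hk; have [w [v [hw hv ev ee]]] := ht k hk.
have [h1|h1] := ltnP k P.
  by exists w, v; rewrite psum_low ?block_low // ltnW.
have [h2|h2] := ltnP k Q.
  exists (refl D (alpha i) *m w), (s v + height e P *: rc (alpha i)); split.
  - exact: weylS.
  - have /intrP[m ->] := hP; apply: coroot_latticeD; last exact: (coroot_lattice_rcZ omegaE).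
    exact: (coroot_lattice_sr omegaE).
  - rewrite psum_mid_sr ?h1 ?(ltnW h2) // ev srD actM act_refl.
    exact/esym/addrA.
  - by rewrite block_mid ?h1 // ee actM act_refl.
exists w, (v - (height e Q - height e P) *: rc (alpha i)); split=> //.
- have /intrP[m ->] : height e Q - height e P \is a Num.int by exact: rpredB.
  by apply: coroot_latticeD => //; apply/(coroot_latticeN omegaE)/(coroot_lattice_rcZ omegaE).
- by rewrite psum_high // ev addrA.
- by rewrite block_high.
Qed.

Hypothesis nonint : forall k, (P < k < Q)%N -> ~~ integral_on (psum e k) (alpha i).

(** Inside the block the simple root is not integral at the vertices, so the whole
situation can be reflected; only the two ends of the block need an argument. *)
Lemma turns_folded_block : turns_folded D e0 N e ->
    (forall k, k.+1 = P -> exists2 w, weyl D w & e k = act w (e0 k) /\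
       folds (integral_on (psum e P)) (act w (e0 P)) (s (e P))) ->
    (forall k, k.+1 = Q -> (Q < N)%N -> exists2 w, weyl D w &
       s (e k) = act w (e0 k) /\
       folds (integral_on (psum e Q)) (act w (e0 Q)) (e Q)) ->
  turns_folded D e0 N e'.
Proof.
move=> hl hlP hlQ k hk; have [w hw [ek hf]] := hl k hk.
have [h|h|h] := ltngtP k.+1 P.
- exists w => //; rewrite !block_low // ?(ltnW h) //.
  by rewrite psum_low // ltnW.
- have [h'|h'|h'] := ltngtP k.+1 Q.
  + exists (refl D (alpha i) *m w); first exact: weylS.
    rewrite !block_mid; [|lia|lia]; rewrite !actM !act_refl -ek; split=> //.
    apply: (folds_conj omegaE) hf; first by apply: nonint; lia.
    by move=> b hbr hbi; rewrite integral_on_mid ?rrK //; lia.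
  + exists w => //; rewrite !block_high; [|lia|lia]; split=> //.
    by apply: folds_sub hf => b _; rewrite integral_on_high //; lia.
  + have [w1 hw1 [e1 hf1]] := hlQ k h' (eq_ind _ (fun q => (q < N)%N) hk _ h').
    exists w1 => //; rewrite block_mid; [|lia]; rewrite h' block_high; [|lia].
    split=> //; apply: folds_sub hf1 => b _; rewrite integral_on_high //.
- have [w1 hw1 [e1 hf1]] := hlP k h.
  exists w1 => //; rewrite block_low; [|lia]; rewrite h block_mid; [|lia].
  by rewrite psum_low.
Qed.

(** The reflection permutes the positive roots other than [alpha i], so only
[alpha i] itself can change the count. *)
Lemma crossings_at_block k : (P <= k < Q)%N ->
  let up := (integral_on (psum e k) (alpha i)) && (0 < pairing (alpha i) (e k)) in
  let down := (integral_on (psum e k) (alpha i)) && (pairing (alpha i) (e k) < 0) in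
  (crossings_at D (psum e' k) (e' k) + up = crossings_at D (psum e k) (e k) + down)%N.
Proof.
move=> hk /=.
have := count_pos_simple omegaE (fun a => (pairing a (psum e k) \is a Num.int) &&
  (0 < pairing a (e k))) i.
rewrite pairingNl rpredN pairingNl oppr_gt0 => <-; congr (_ + _)%N.
apply: eq_count => a /=; rewrite block_mid //; congr (_ && _).
  by apply: integral_on_mid; lia.
by rewrite pairing_sr.
Qed.

Lemma crossings_at_out k : (k < P)%N || (Q <= k)%N ->
  crossings_at D (psum e' k) (e' k) = crossings_at D (psum e k) (e k).
Proof.
move=> /orP[h|h]; first by rewrite psum_low ?block_low // ltnW.
by apply: eq_count => a; rewrite block_high // -!/(integral_on _ a) integral_on_high.
Qed.

Lemma crossings_block :
  let up := 0 < pairing (alpha i) (e P) in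
  let down := pairing (alpha i) (e P) < 0 in
  (crossings D N e' + up = crossings D N e + down)%N.
Proof.
move=> /=; have hPN : (P < N)%N by lia.
rewrite /crossings (bigD1 (Ordinal hPN)) //= [in RHS](bigD1 (Ordinal hPN)) //=.
have -> : (\sum_(k < N | k != Ordinal hPN) crossings_at D (psum e' k) (e' k) =
  \sum_(k < N | k != Ordinal hPN) crossings_at D (psum e k) (e k))%N.
  apply: eq_bigr => k; rewrite -val_eqE /= => hk.
  have [h|h] := boolP ((k < P)%N || (Q <= k)%N); first exact: crossings_at_out.
  have h2 : (P <= k < Q)%N by lia.
  have h3 : ~~ integral_on (psum e k) (alpha i) by apply: nonint; lia.
  by have /= := crossings_at_block h2; rewrite (negPf h3) !addn0.
have hPP : (P <= P < Q)%N by lia.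
have iP : integral_on (psum e P) (alpha i) by exact: hP.
have /= := crossings_at_block hPP; rewrite iP /= => h.
by rewrite addnAC h addnAC.
Qed.

Lemma rho_rc : (rho R D *m rc (alpha i)) ord0 ord0 = 1.
Proof.
rewrite rhoE (perm_big _ (perm_to_rem ap)) big_cons /=.
have -> : \sum_(a <- rem (alpha i) pos) pairing a (rc (alpha i)) = 0.
  set S := \sum_(_ <- _) _; have : S = - S.
    rewrite {1}/S -(perm_big _ (perm_pos_simple omegaE i)) big_map /S -sumrN.
    apply: eq_bigr => a _; rewrite -pairing_sr sr_rc_diag // pairingN //.
  by move=> h; lra.
by rewrite addr0 pairing_rc cartan_diag // mulVf // pnatr_eq0.
Qed.

Lemma dimension_block : dimension_eq D e0 N e ->
    height e Q - height e P =
      (0 < pairing (alpha i) (e P))%R%:R - (pairing (alpha i) (e P) < 0)%R%:R ->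
  dimension_eq D e0 N e'.
Proof.
rewrite /dimension_eq => hd hh; rewrite psum_high // hh.
have rho_shift y c : (rho R D *m (y - c *: rc (alpha i))) ord0 ord0 =
    (rho R D *m y) ord0 ord0 - c.
  rewrite -[c in RHS]mulr1 -rho_rc !rhoE mulrCA -mulrBr; congr (_ * _).
  rewrite mulr_sumr -sumrB; apply: eq_bigr => a _.
  by rewrite pairingB pairingZ.
rewrite addrA rho_shift.
have := crossings_block => /= /(congr1 (fun k => k%:R : R)); rewrite !natrD.
by move=> h; rewrite -hd; move: h; lra.
Qed.

End Reflect.

Lemma stretch_before (p : pred nat) P : exists S, [/\ (S <= P)%N,
  forall l, (S <= l < P)%N -> p l & S = 0%N \/ ~~ p S.-1].
Proof.
elim: P => [|P [S [h1 h2 h3]]]; first by exists 0%N; split=> //; left.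
have [hp|hp] := boolP (p P); last first.
  by exists P.+1; split=> // [l hl|]; [exfalso; lia | right].
exists S; split=> // [|l hl]; first exact: leqW.
by have [->//|ne] := eqVneq l P; apply: h2; lia.
Qed.

Lemma stretch_after (p : pred nat) Q M : (Q <= M)%N -> exists S,
  [/\ (Q <= S <= M)%N, forall l, (Q <= l < S)%N -> p l & S = M \/ ~~ p S].
Proof.
elim: M => [|M IH] hQ.
  by exists 0%N; split=> [|l|]; [rewrite hQ | rewrite andbF | left].
have [eQ|ne] := eqVneq Q M.+1.
  by exists Q; rewrite leqnn hQ; split=> // [l hl|]; [exfalso; lia | left].
have [|S [/andP[h1 h2] h3 h4]] := IH; first by lia.
have [hp|hp] := boolP (p S); last first.
  by exists S; rewrite h1 leqW //; split=> //; right.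
case: h4 => [eS|]; last by rewrite hp.
exists M.+1; split=> // [|l hl|]; [by rewrite hQ leqnn | | by left].
by have [->|nl] := eqVneq l S; last by apply: h3; lia.
Qed.

(** Ascending towards a minimum, the height cannot move. *)
Lemma flat_before e S P : (forall k, (k <= P)%N -> height e P <= height e k) ->
    (forall l, (S <= l < P)%N -> 0 <= pairing (alpha i) (e l)) ->
  forall l, (S <= l < P)%N -> pairing (alpha i) (e l) = 0.
Proof.
move=> hmin hge.
have hle d l : (l + d = P)%N -> (S <= l)%N -> height e l <= height e P.
  elim: d l => [|d IH] l hl hS; first by rewrite -hl addn0.
  have := IH l.+1; rewrite heightS addSnnS => /(_ hl (leqW hS)).
  by have := hge l; rewrite hS -hl addnS ltnS leq_addr => /(_ isT); lra.
move=> l /andP[hS hP].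
have := hle (P - l.+1)%N l.+1 (subnKC hP) (leqW hS); rewrite heightS.
have := hmin l (ltnW hP); have := hge l; rewrite hS hP => /(_ isT); lra.
Qed.

(** Descending from a minimum, the height cannot move. *)
Lemma flat_after e Q S : (forall k, (k <= S)%N -> height e Q <= height e k) ->
    (forall l, (Q <= l < S)%N -> pairing (alpha i) (e l) <= 0) ->
  forall l, (Q <= l < S)%N -> pairing (alpha i) (e l) = 0.
Proof.
move=> hmin hle.
have hge l : (Q <= l <= S)%N -> height e l <= height e Q.
  elim: l => [|l IH] /andP[h1 h2]; first by move: h1; rewrite leqn0 => /eqP ->.
  move: h1; rewrite leq_eqVlt => /orP[/eqP -> //|h1].
  rewrite heightS; have := hle l; have := IH; rewrite -ltnS h1 h2 ltnW //.
  by move=> /(_ isT) ? /(_ isT); lra.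
move=> l hl; have /andP[h1 h2] := hl.
have := hge l; have := hmin l.+1 h2; have := hle l hl.
by rewrite heightS h1 ltnW // => ? ? /(_ isT); lra.
Qed.

(** The block of edges reflected by the lowering operator: the two parameters in
[root_op] are the times of the vertices [P] and [Q] ([root_op_lowering]). *)
Record lowering_block e P Q : Prop := FCond {
  f_lt : (P < Q)%N;
  f_le : (Q <= N)%N;
  f_int : height e P \is a Num.int;
  f_end : height e Q = height e P + 1;
  f_min : forall k, (k <= N)%N -> height e P <= height e k;
  f_last : forall k, (P < k <= N)%N -> height e P < height e k;
  f_first : forall k, (P < k < Q)%N -> height e k < height e P + 1 }.

Lemma lowering_nonint e P Q k : lowering_block e P Q -> (P < k < Q)%N ->
  ~~ integral_on (psum e k) (alpha i).
Proof.
move=> h hk; apply: (int_strict (f_int h)); apply/andP; split.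
  apply: (f_last h); have /andP[-> hkQ] := hk.
  exact: leq_trans (ltnW hkQ) (f_le h).
exact: (f_first h).
Qed.

(** A descent inside the block would go on until the next integral height, by
[turn_neg], and the block would not end one level higher. *)
Lemma lowering_ascends e P Q k : LS_disp e -> lowering_block e P Q -> (P <= k < Q)%N ->
  0 < pairing (alpha i) (e k).
Proof.
move=> he h /andP[hk1 hk2]; have hQN := f_le h.
rewrite ltNge; apply/negP => hle.
have hPk : (P < k)%N.
  rewrite ltn_neqAle hk1 andbT; apply/eqP => e1.
  have := f_last h (k := P.+1); rewrite heightS e1 ltrDl.
  by move=> /(_ ltac:(lia)); lra.
have hneg : pairing (alpha i) (e k) < 0.
  rewrite lt_neqAle hle andbT; apply/eqP => e1.
  have hkN : (k < N)%N by lia.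
  have [h1 _] := conj_base_int hb (LS_disp_typed he) hkN ai e1.
  have h2 : ~~ integral_on (psum e k) (alpha i) by apply: (lowering_nonint h); lia.
  by rewrite /integral_on h1 in h2.
have H l : (k + l < Q)%N -> pairing (alpha i) (e (k + l)%N) < 0 /\
    height e (k + l).+1 < height e k.
  elim: l => [|l IH] hl; first by rewrite addn0 heightS; split=> //; lra.
  have [|h1 h2] := IH; first by lia.
  have h3 : pairing (alpha i) (e (k + l).+1) < 0.
    apply: (turn_neg omegaE hb he) => //; first by lia.
    by apply: (lowering_nonint h); lia.
  by rewrite addnS heightS; split=> //; lra.
have [|_] := H (Q.-1 - k)%N; first by lia.
have -> : (k + (Q.-1 - k)).+1 = Q by lia.
rewrite (f_end h); have := f_first h (k := k); rewrite hPk hk2 => /(_ isT); lra.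
Qed.

Lemma turns_folded_lower e P Q : LS_disp e -> lowering_block e P Q ->
  turns_folded D e0 N (reflect_block P Q e).
Proof.
move=> he h; have hPQ := f_lt h; have hQN := f_le h; have hP := f_int h.
have hup := lowering_ascends he h.
have hQ : height e Q \is a Num.int by rewrite (f_end h) rpredD ?rpred1.
have hl := LS_disp_loc he.
have dom k : (k < N)%N -> chamber D (e0 k) by exact: (base_dom hb).
apply: turns_folded_block => //; first by move=> k; exact: lowering_nonint.
- move=> k ek; have hkN : (k.+1 < N)%N by rewrite ek; exact: leq_trans hQN.
  have [w hw [e1 hf]] := hl k hkN.
  have hle : pairing (alpha i) (e k) <= 0.
    by have := f_min h (ltnW (ltnW hkN)); rewrite -ek heightS; lra.
  rewrite -ek in hP *.
  have st b : b \in roots D -> integral_on (psum e k.+1) b ->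
    integral_on (psum e k.+1) (rr (alpha i) b) by move=> _; exact: integral_on_rr.
  have [hx|hx] := leP (pairing (alpha i) (act w (e0 k.+1))) 0.
    by exists w => //; split=> //; exact: (folds_sr_right omegaE).
  (* the edge before the minimum lies on the wall, so that the minimal
     configuration may be reflected in it *)
  exists (refl D (alpha i) *m w); first exact: weylS.
  have hz : pairing (alpha i) (e k) = 0.
    apply/eqP; rewrite eq_le hle e1 /=; apply: sign_nonneg => //.
      exact/dom/ltnW.
    by apply: sign_pos hx => //; exact: dom.
  rewrite !actM !act_refl -e1 sr_id //; split=> //.
  apply: (folds_sr_right omegaE) => //; last first.
    by rewrite pairing_sr_diag // oppr_le0 ltW.
  by apply: folds_trans hf; apply: folds_ge1 => //; exact: ltW.
- move=> k ek hQ'; have hkN : (k.+1 < N)%N by rewrite ek.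
  have [w hw [e1 hf]] := hl k hkN; rewrite ek in hf.
  exists (refl D (alpha i) *m w); first exact: weylS.
  rewrite !actM !act_refl -e1; split=> //; apply: folds_trans hf.
  apply: folds_ge1 => //; apply: sign_nonneg => //; first exact: dom.
  have hk : (P <= k < Q)%N by rewrite -ltnS ek hPQ leqnn.
  have := hup k hk; rewrite e1; apply: sign_pos => //.
  exact/dom/ltnW.
Qed.

(** Let [S] be the start of the stretch before [P] on which [alpha i] is positive on
[act (tau l) rho_check].  There [alpha i] is nonnegative on the edges, hence 0
before the minimum, so these edges are unchanged when [tau l] is reflected too.
Reflecting [tau] from [S] to [Q] keeps the chain decreasing by the lifting
property. *)
Lemma defining_chain_lower e P Q : LS_disp e -> lowering_block e P Q ->
  defining_chain D omega e0 N (reflect_block P Q e).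
Proof.
move=> he h; have hPQ := f_lt h; have hQN := f_le h.
have hPN : (P <= N)%N by exact: leq_trans (ltnW hPQ) hQN.
have hup := lowering_ascends he h; have [tau [htau hch]] := LS_disp_chain he.
have [S [hSP hS1 hS2]] :=
  stretch_before (fun l => 0 < pairing (alpha i) (act (tau l) vrho)) P.
have hz : forall l, (S <= l < P)%N -> pairing (alpha i) (e l) = 0.
  apply: flat_before => [k hk|l hl]; first exact/(f_min h)/(leq_trans hk).
  have hlN : (l < N)%N by have /andP[_ hlP] := hl; exact: leq_trans hPN.
  have [hw ->] := htau l hlN.
  by apply: sign_nonneg => //; [exact: (base_dom hb) | exact: hS1].
have hpos k : (S <= k < Q)%N -> 0 < pairing (alpha i) (act (tau k) vrho).
  move=> /andP[hk1 hk2]; have [hkP|hkP] := ltnP k P; first by rewrite hS1 ?hk1.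
  have hk' : (k < N)%N by exact: leq_trans hQN.
  have [hw ek] := htau k hk'.
  have := hup k; rewrite hkP hk2 ek => /(_ isT).
  by apply: sign_pos => //; exact: (base_dom hb).
exists (fun k => if (S <= k < Q)%N then refl D (alpha i) *m tau k else tau k).
split=> k hk.
  have [hw ek] := htau k hk; rewrite /reflect_block.
  case: ifP => hkS; last first.
    split=> //; rewrite -ek; case: ifP => // /andP[hk1 hk2].
    by rewrite hk2 (leq_trans hSP hk1) in hkS.
  split; first exact: weylS.
  rewrite actM act_refl -ek; case: ifP => // hk2.
  have /andP[hk3 hk4] := hkS; rewrite sr_id // hz // hk3 /=.
  by move: hk2; rewrite hk4 andbT ltnNge => ->.
have hc := hch k hk.
case: ifP => h1; case: ifP => h2.
- rewrite !actM !act_refl; apply: (folds_sr_up omegaE) => //.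
  exact/ltW/hpos.
- rewrite actM act_refl; apply: folds_trans hc.
  by apply: folds_ge1 => //; apply/ltW/hpos.
- rewrite actM act_refl; apply: (folds_sr_right omegaE) => //.
  have eS : k.+1 = S by move: h1 h2; clear; lia.
  by case: hS2 => [h0|]; [rewrite h0 in eS | rewrite -eS -leNgt].
- exact: hc.
Qed.

Lemma LS_disp_lower e P Q : LS_disp e -> lowering_block e P Q -> LS_disp (reflect_block P Q e).
Proof.
move=> he h; have hPQ := f_lt h; have hQN := f_le h; have hP := f_int h.
have hQ : height e Q \is a Num.int by rewrite (f_end h) rpredD ?rpred1.
have hni : forall k, (P < k < Q)%N -> ~~ integral_on (psum e k) (alpha i).
  by move=> k; exact: lowering_nonint.
split.
- exact: conj_base_block (LS_disp_typed he).
- exact: turns_folded_lower.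
- exact: defining_chain_lower.
- apply: dimension_block (LS_disp_dim he) _ => //.
  have hP0 : 0 < pairing (alpha i) (e P) by apply: (lowering_ascends he h); rewrite leqnn.
  by rewrite (f_end h) hP0 ltNge (ltW hP0) /=; lra.
Qed.

(** [Q] is the first vertex at which the height is minimal and [P] the last one
before it that is higher by 1.  [e_low], a consequence of the integrality of local
minima, is what lets lowering undo the operator. *)
Record raising_block e P Q : Prop := ECond {
  e_lt : (P < Q)%N;
  e_le : (Q <= N)%N;
  e_int : height e P \is a Num.int;
  e_end : height e P = height e Q + 1;
  e_min : forall k, (k <= N)%N -> height e Q <= height e k;
  e_first : forall k, (k < Q)%N -> height e Q < height e k;
  e_last : forall k, (P < k < Q)%N -> height e k < height e P;
  e_low : forall k, (k <= P)%N -> height e P <= height e k }.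

Lemma raising_int_end e P Q : raising_block e P Q -> height e Q \is a Num.int.
Proof.
move=> h; have -> : height e Q = height e P - 1 by rewrite (e_end h); ring.
by rewrite rpredB ?rpred1 ?(e_int h).
Qed.

Lemma raising_nonint e P Q k : raising_block e P Q -> (P < k < Q)%N ->
  ~~ integral_on (psum e k) (alpha i).
Proof.
move=> h hk; apply: (int_strict (raising_int_end h)); rewrite -(e_end h).
by apply/andP; split; [apply: (e_first h); case/andP: hk | exact: (e_last h)].
Qed.

(** Once negative, the simple root stays negative until the next wall. *)
Lemma raising_descends e P Q k : LS_disp e -> raising_block e P Q -> (P <= k < Q)%N ->
  pairing (alpha i) (e k) < 0.
Proof.
move=> he h /andP[hk1 hk2]; have hQN := e_le h.
have -> : k = (P + (k - P))%N by lia.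
have : (P + (k - P) < Q)%N by lia.
elim: (k - P)%N => [|l IH] hl.
  rewrite addn0; have [e1|ne] := eqVneq P.+1 Q.
    by have := e_end h; rewrite -e1 heightS; lra.
  have := e_last h (k := P.+1); rewrite heightS => /(_ ltac:(have := e_lt h; lia)); lra.
rewrite addnS; apply: (turn_neg omegaE hb he); [lia| |by apply: IH; lia].
by apply: (raising_nonint h); lia.
Qed.

Lemma turns_folded_raise e P Q : LS_disp e -> raising_block e P Q ->
  turns_folded D e0 N (reflect_block P Q e).
Proof.
move=> he h; have hPQ := e_lt h; have hQN := e_le h; have hP := e_int h.
have hQ := raising_int_end h; have hl := LS_disp_loc he.
apply: turns_folded_block => //; first by move=> k; exact: raising_nonint.
- move=> k ek; have hkN : (k.+1 < N)%N by rewrite ek; exact: leq_trans hQN.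
  have [w hw [e1 hf]] := hl k hkN; rewrite ek in hf.
  exists w => //; split=> //; apply: folds_trans hf _.
  by apply: folds1 => //; apply: (raising_descends he h); rewrite leqnn.
- move=> k ek hQ'; have hkN : (k.+1 < N)%N by rewrite ek.
  have [w hw [e1 hf]] := hl k hkN; rewrite ek in hf.
  have st b : b \in roots D -> integral_on (psum e Q) b ->
    integral_on (psum e Q) (rr (alpha i) b) by move=> _; exact: integral_on_rr.
  exists (refl D (alpha i) *m w); first exact: weylS.
  rewrite !actM !act_refl -e1; split=> //; apply: (folds_sr_left omegaE) => //.
  by have := e_min h (k := Q.+1) hQ'; rewrite heightS; lra.
Qed.

(** The mirror image of [defining_chain_lower]: the reflected stretch of [tau] extends
beyond [Q] as long as [alpha i] is negative on [act (tau l) rho_check]. *)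
Lemma defining_chain_raise e P Q : LS_disp e -> raising_block e P Q ->
  defining_chain D omega e0 N (reflect_block P Q e).
Proof.
move=> he h; have hPQ := e_lt h; have hQN := e_le h.
have hdn := raising_descends he h; have [tau [htau hch]] := LS_disp_chain he.
have [S [/andP[hQS hSN] hS1 hS2]] :=
  stretch_after (fun l => pairing (alpha i) (act (tau l) vrho) < 0) hQN.
have hz : forall l, (Q <= l < S)%N -> pairing (alpha i) (e l) = 0.
  apply: flat_after => [k hk|l hl]; first exact/(e_min h)/(leq_trans hk).
  have hlN : (l < N)%N by have /andP[_ hlS] := hl; exact: leq_trans hSN.
  have [hw ->] := htau l hlN.
  by apply: sign_nonpos => //; [exact: (base_dom hb) | exact: hS1].
have hneg k : (P <= k < S)%N -> pairing (alpha i) (act (tau k) vrho) < 0.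
  move=> /andP[hk1 hk2]; have [hkQ|hkQ] := leqP Q k; first by rewrite hS1 ?hkQ.
  have hk' : (k < N)%N by exact: leq_trans hQN.
  have [hw ek] := htau k hk'.
  have := hdn k; rewrite hk1 hkQ ek => /(_ isT).
  by apply: sign_neg => //; exact: (base_dom hb).
exists (fun k => if (P <= k < S)%N then refl D (alpha i) *m tau k else tau k).
split=> k hk.
  have [hw ek] := htau k hk; rewrite /reflect_block.
  case: ifP => hkS; last first.
    split=> //; rewrite -ek; case: ifP => // /andP[hk1 hk2].
    by rewrite hk1 (leq_trans hk2 hQS) in hkS.
  split; first exact: weylS.
  rewrite actM act_refl -ek; case: ifP => // hk2.
  have /andP[hk3 hk4] := hkS; rewrite sr_id // hz // hk4 andbT.
  by move: hk2; rewrite hk3 /= [(Q <= k)%N]leqNgt => ->.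
have hc := hch k hk.
case: ifP => h1; case: ifP => h2.
- rewrite !actM !act_refl; apply: (folds_sr_down omegaE) => //.
  exact/ltW/hneg.
- rewrite actM act_refl; apply: (folds_sr_left omegaE) => //.
  have eS : k.+1 = S by move: h1 h2; clear; lia.
  by case: hS2 => [h0|]; [rewrite -eS in h0; rewrite h0 ltnn in hk | rewrite -eS -leNgt].
- rewrite actM act_refl; apply: folds_trans hc _.
  by apply: folds_le1 => //; apply/ltW/hneg.
- exact: hc.
Qed.

Lemma LS_disp_raise e P Q : LS_disp e -> raising_block e P Q -> LS_disp (reflect_block P Q e).
Proof.
move=> he h; have hPQ := e_lt h; have hQN := e_le h; have hP := e_int h.
have hQ := raising_int_end h.
have hni : forall k, (P < k < Q)%N -> ~~ integral_on (psum e k) (alpha i).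
  by move=> k; exact: raising_nonint.
split.
- exact: conj_base_block (LS_disp_typed he).
- exact: turns_folded_raise.
- exact: defining_chain_raise.
- apply: dimension_block (LS_disp_dim he) _ => //.
  have hP0 : pairing (alpha i) (e P) < 0 by apply: (raising_descends he h); rewrite leqnn.
  by rewrite (e_end h) hP0 ltNge (ltW hP0) /=; lra.
Qed.

Lemma raising_lowering e P Q : raising_block e P Q -> lowering_block (reflect_block P Q e) P Q.
Proof.
move=> h; have hPQ := e_lt h; have hQN := e_le h; have hend := e_end h.
have hP := e_int h; have hQ := raising_int_end h.
have H1 k : (k <= P)%N -> height (reflect_block P Q e) k = height e k.
  by move=> hk; rewrite /height psum_low.
have H2 k : (P <= k <= Q)%N ->
    height (reflect_block P Q e) k = height e P + height e P - height e k.
  move=> hk; rewrite /height psum_mid // pairingB pairingZ pairing_rc cartan_diag //.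
  by rewrite -!/(height _ _); ring.
have H3 k : (Q <= k)%N -> height (reflect_block P Q e) k = height e k + 2.
  move=> hk; rewrite /height psum_high // pairingB pairingZ pairing_rc cartan_diag //.
  by rewrite -!/(height _ _) hend; ring.
have low k : (P < k <= N)%N -> height e P < height (reflect_block P Q e) k.
  move=> hk; have [hkQ|hkQ] := ltnP k Q.
    by rewrite H2; [have := e_last h (k := k) ltac:(lia); lra | lia].
  by rewrite H3 //; have := e_min h (k := k) ltac:(lia); lra.
split=> //.
- by rewrite H1 // (e_int h).
- by rewrite (H1 P) // (H3 Q) // hend; ring.
- move=> k hk; rewrite (H1 P) //; have [hkP|hkP] := leqP k P.
    by rewrite H1 //; exact: (e_low h).
  by apply/ltW/low; lia.
- by move=> k hk; rewrite (H1 P) //; exact: low.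
- move=> k hk; rewrite (H1 P) // H2; last by lia.
  by have := e_first h (k := k) ltac:(lia); lra.
Qed.

End Block.

(** * Galleries to which no raising operator applies *)

Section Highest.
Context (R : realType) (n : nat) (D : rootDatum n) (omega : 'I_n -> 'cV[R]_n).
Hypothesis omegaE :
  forall i j, pairing (simple D j) (omega i) = (i == j)%:R.
Local Notation A := 'cV[R]_n.
Local Notation alpha := (simple D).
Local Notation vrho := (rho_check omega).
Local Notation pos := (pos_roots D).
Local Notation folds := (folds D).
Implicit Types (a b : 'rV[int]_n) (x y v V f U z : A) (w : 'M[int]_n)
  (e : nat -> A) (k l : nat) (i : 'I_n).

Variables (e0 : nat -> A) (N : nat).
Hypothesis hb : base_gallery D e0 N.
Local Notation LS_disp := (LS_disp D omega e0 N).
Local Notation height i e k := (wall_height D i e k).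

Lemma height_int_end e i : LS_disp e -> height i e N \is a Num.int.
Proof.
move=> he; have /specialP := conj_base_special hb (LS_disp_typed he).
by apply; exact: simple_root.
Qed.

(** Away from the walls of [alpha i] the simple root could not stop decreasing, by
[turn_neg]; it does not vanish on an edge off its walls either. *)
Lemma local_min_int e i k : LS_disp e -> (k.+1 <= N)%N ->
    pairing (alpha i) (e k) <= 0 ->
    ((k.+1 < N)%N -> 0 <= pairing (alpha i) (e k.+1)) ->
  height i e k.+1 \is a Num.int.
Proof.
move=> he hk h1 h2; have ai := simple_root D i.
move: (hk); rewrite leq_eqVlt => /orP[/eqP ->|hk']; first exact: height_int_end.
move: h1; rewrite le_eqVlt => /orP[/eqP h1|h1].
  by have [] := conj_base_int hb (LS_disp_typed he) hk ai h1.
apply/negPn/negP => hn; have := turn_neg omegaE hb he hk' hn h1.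
by have := h2 hk'; lra.
Qed.

Lemma first_argmin (f : nat -> R) M : exists2 q, (q <= M)%N &
  (forall k, (k <= M)%N -> f q <= f k) /\ (forall k, (k < q)%N -> f q < f k).
Proof.
elim: M => [|M [q hq [h1 h2]]].
  by exists 0%N => //; split=> // k; rewrite leqn0 => /eqP ->.
have [h|h] := ltP (f M.+1) (f q).
  exists M.+1 => //; split=> k.
    rewrite leq_eqVlt => /orP[/eqP -> //|hk]; have := h1 k hk; lra.
  by move=> hk; have := h1 k hk; lra.
exists q; first by lia.
by split=> // k; rewrite leq_eqVlt => /orP[/eqP -> //|]; exact: h1.
Qed.

Lemma last_before (p : pred nat) Q : (0 < Q)%N -> p 0%N -> exists2 P, (P < Q)%N &
  p P /\ forall k, (P < k < Q)%N -> ~~ p k.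
Proof.
elim: Q => // -[|Q] IH _ p0.
  by exists 0%N => //; split=> // k hk; exfalso; lia.
have [h|h] := boolP (p Q.+1).
  by exists Q.+1 => //; split=> // k hk; exfalso; lia.
have [P hP [h1 h2]] := IH isT p0; exists P; first by lia.
split=> // k hk; have [->//|ne] := eqVneq k Q.+1; apply: h2; lia.
Qed.

(** The minimum of the height is a negative integer by [local_min_int].  Going back
from it the height reaches the next integer at a vertex, as edges do not cross
walls. *)
Lemma raising_exists e i k : LS_disp e -> (k <= N)%N -> height i e k < 0 ->
  exists P Q, raising_block D N i e P Q.
Proof.
move=> he hk hlt; have ai := simple_root D i.
have [Q hQ [hmin hfirst]] := first_argmin (fun k => height i e k) N.
have hQ0 : height i e Q < 0 by have := hmin k hk; lra.
have Q0 : (0 < Q)%N.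
  by rewrite lt0n; apply/eqP => q0; move: hQ0; rewrite q0 height0 ltxx.
have eQ : Q = Q.-1.+1 by rewrite prednK.
have hQint : height i e Q \is a Num.int.
  rewrite eQ; apply: local_min_int => //; first by rewrite -eQ.
    by have := hfirst Q.-1; rewrite {2 3}eQ heightS leqnn => /(_ isT); lra.
  move=> hQN; have := hmin Q.+1; rewrite -eQ in hQN *; rewrite heightS => /(_ hQN); lra.
have hQ1 : height i e Q + 1 <= 0 by apply: int_ltD1 => //; exact: rpred0.
have [|P hPQ [hP hPlast]] := @last_before (fun k => height i e Q + 1 <= height i e k) Q Q0.
  by rewrite height0.
have hlast l : (P < l < Q)%N -> height i e l < height i e Q + 1.
  by move=> /hPlast; rewrite -ltNge.
have hPS : height i e P.+1 < height i e Q + 1.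
  have [->|ne] := eqVneq P.+1 Q; first by rewrite ltrDl.
  by apply: hlast; lia.
have hPN : (P < N)%N by lia.
have hend : height i e P = height i e Q + 1.
  apply/eqP; rewrite eq_le hP andbT leNgt; apply/negP => hgt.
  have /intrP[m em] := hQint.
  have := @no_cross_neg _ _ D (alpha i) (psum e P) (e P) (m + 1) ai
    (conj_base_edge hb (LS_disp_typed he) hPN).
  rewrite intrD -em => /(_ hgt); rewrite -psumS; move: hPS; rewrite /wall_height; lra.
exists P, Q; split=> //.
- by rewrite hend rpredD ?rpred1.
- by move=> l /hlast; rewrite hend.
move=> l hl; have [q hq [hqmin hqfirst]] := first_argmin (fun k => height i e k) P.
suff hqP : height i e P <= height i e q by have := hqmin l hl; lra.
rewrite leNgt; apply/negP => hqlt.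
have q0 : (0 < q)%N.
  by rewrite lt0n; apply/eqP => q0; move: hqlt; rewrite q0 height0 hend; lra.
have qP : q != P by apply/eqP => e1; move: hqlt; rewrite e1 ltxx.
have hqP : (q < P)%N by rewrite ltn_neqAle qP hq.
have eq : q = q.-1.+1 by rewrite prednK.
have hqint : height i e q \is a Num.int.
  rewrite eq; apply: local_min_int => //.
  - by rewrite -eq; exact: ltnW (ltn_trans hqP hPN).
  - by have := hqfirst q.-1; rewrite {2 3}eq heightS leqnn => /(_ isT); lra.
  - by move=> _; have := hqmin q.+1 hqP; rewrite -eq heightS; lra.
have := int_ltD1 hQint hqint (hfirst q (ltn_trans hqP hPQ)).
by move: hqlt; rewrite hend; lra.
Qed.

(** A folding of [act w rho_check] in [b] has [b] nonpositive on [act w x]; as this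
is the dominant vector [x], the pairing is 0 and [s_b] fixes [x]. *)
Lemma folds_fix w x y : weyl D w -> chamber D x -> act w x = x ->
    folds predT (act w vrho) y ->
  exists w', [/\ weyl D w', y = act w' vrho & act w' x = x].
Proof.
move=> hw hx hwx; elim=> [|u b _ [w' [hw' -> e1]] hbp _ hlt]; first by exists w.
have hr := pos_root hbp.
exists (refl D b *m w'); rewrite !actM !act_refl; split=> //; first exact: weylS.
rewrite e1 sr_id //; apply/eqP; rewrite eq_le (hx _ hbp) andbT.
by rewrite -e1; apply: (sign_nonpos omegaE).
Qed.

Lemma chamber_psum0 k : (k <= N)%N -> chamber D (psum e0 k).
Proof.
elim: k => [|k IH] hk; first by rewrite psum0 => a _; rewrite pairing0.
by rewrite psumS; apply: chamberD; [exact/IH/ltnW | exact: (base_dom hb)].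
Qed.

Lemma defining_chain_folds (tau : nat -> 'M[int]_n) l k :
    (forall j, (j.+1 < N)%N ->
       folds predT (act (tau j) vrho) (act (tau j.+1) vrho)) ->
  (l <= k < N)%N -> folds predT (act (tau l) vrho) (act (tau k) vrho).
Proof.
move=> h; elim: k => [|k IH] /andP[h1 h2].
  have -> : l = 0%N by lia.
  exact: folds0.
have [->|ne] := eqVneq l k.+1; first exact: folds0.
by apply: folds_trans (h _ h2); apply: IH; lia.
Qed.

(** All displacements before [k] are straight and fixed by [tau k], by [folds_fix].
So [tau k] maps the straight vertex number [k.+1] to that of the gallery, and both
are dominant. *)
Lemma dominant_base e : LS_disp e ->
    (forall i k, (k <= N)%N -> 0 <= height i e k) ->
  forall k, (k < N)%N -> e k = e0 k.
Proof.
move=> he hpos k; have [_ _ [tau [htau hch]] _] := he.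
elim/ltn_ind: k => k IH hk.
have eV : psum e k = psum e0 k.
  apply: eq_bigr => l _; apply: IH; first exact: ltn_ord.
  exact: ltn_trans hk.
have [hw ek] := htau k hk.
have fixl l : (l < k)%N -> act (tau k) (e0 l) = e0 l.
  move=> hl; have hlN : (l < N)%N by exact: ltn_trans hk.
  have [hwl el] := htau l hlN; have e1 := IH l hl hlN.
  have hfl : folds predT (act (tau l) vrho) (act (tau k) vrho).
    by apply: defining_chain_folds hch _; rewrite hk ltnW.
  have [|w' [hw' ew' fw']] := folds_fix hwl (base_dom hb hlN) _ hfl; first by rewrite -el.
  by rewrite (weyl_vrho_inj2 omegaE hw hw' ew').
have fixV : act (tau k) (psum e0 k) = psum e0 k.
  by rewrite act_sum; apply: eq_bigr => l _; exact: fixl.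
have eS : psum e k.+1 = act (tau k) (psum e0 k.+1).
  by rewrite !psumS actD fixV -ek eV.
have := dominant_unique omegaE (chamber_psum0 hk) hw.
rewrite -eS => /(_ _); rewrite !psumS eV => h; apply: (addrI (psum e0 k)); apply: h.
apply/(chamberP omegaE) => i; have := hpos i k.+1 hk.
by rewrite /wall_height psumS eV.
Qed.

Lemma LS_disp_cases e : LS_disp e ->
  (forall k, (k < N)%N -> e k = e0 k) \/ exists i P Q, raising_block D N i e P Q.
Proof.
move=> he; have [h|h] := pselect (forall i k, (k <= N)%N -> 0 <= height i e k).
  by left; exact: dominant_base.
right; apply: contrapT => hn; apply: h => i k hk.
rewrite leNgt; apply/negP => hlt; apply: hn.
by have [P [Q h]] := raising_exists he hk hlt; exists i, P, Q.
Qed.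

Lemma crossings_le e : (crossings D N e <= N * size pos)%N.
Proof.
rewrite /crossings -[N in (_ <= N * _)%N]card_ord -sum_nat_const.
by apply: leq_sum => k _; exact: count_size.
Qed.

End Highest.

(** * Paths and the galleries they trace *)

Section Paths.
Context (R : realType) (n : nat) (D : rootDatum n) (omega : 'I_n -> 'cV[R]_n).
Hypothesis omegaE :
  forall i j, pairing (simple D j) (omega i) = (i == j)%:R.
Local Notation A := 'cV[R]_n.
Local Notation rc := (@coroot_vec R n D).
Local Notation sr := (@root_reflection R n D).
Local Notation alpha := (simple D).
Implicit Types (a b : 'rV[int]_n) (x y v V f U z : A) (w : 'M[int]_n)
  (e : nat -> A) (k l : nat) (p q : R -> A) (t : nat -> R).

Section Times.
Variables (t : nat -> R) (N : nat).
Hypothesis t0 : t 0%N = 0.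
Hypothesis tN : t N = 1.
Hypothesis tlt : forall k, (k < N)%N -> t k < t k.+1.

Lemma times_mono k l : (k <= l <= N)%N -> t k <= t l.
Proof.
elim: l => [|l IH] /andP[h1 h2]; first by move: h1; rewrite leqn0 => /eqP ->.
move: h1; rewrite leq_eqVlt => /orP[/eqP -> //|h1].
have hkl : (k <= l <= N)%N by lia.
by have := IH hkl; have := tlt h2; lra.
Qed.

Lemma times_lt k l : (k < l <= N)%N -> t k < t l.
Proof.
move=> /andP[h1 h2]; apply: lt_le_trans (times_mono _).
  by apply: tlt; exact: leq_trans h2.
by rewrite h1.
Qed.

Lemma times_ltE k l : (k <= N)%N -> (l <= N)%N -> (t k < t l) = (k < l)%N.
Proof.
move=> hk hl; case: (ltnP k l) => h; first by rewrite times_lt // h.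
by apply/negbTE; rewrite -leNgt times_mono // h.
Qed.

Lemma times_leE k l : (k <= N)%N -> (l <= N)%N -> (t k <= t l) = (k <= l)%N.
Proof. by move=> hk hl; rewrite leNgt times_ltE // -leqNgt. Qed.

Lemma times01 k : (k <= N)%N -> 0 <= t k <= 1.
Proof. by move=> hk; rewrite -t0 -tN !times_leE. Qed.

Lemma times_locate u : 0 <= u <= 1 ->
  (exists2 k, (k <= N)%N & u = t k) \/
  (exists2 k, (k < N)%N & t k < u < t k.+1).
Proof.
rewrite -t0 -tN => /andP[u0 u1].
elim: (N) (leqnn N) u1 => [|M IH] hM u1.
  by left; exists 0%N => //; apply/eqP; rewrite eq_le u0 u1.
have [h|h] := leP u (t M).
  by have [|[k hk e]|[k hk e]] := IH _ h; [lia | left | right]; exists k => //; lia.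
move: u1; rewrite le_eqVlt => /orP[/eqP ->|h'].
  by left; exists M.+1.
by right; exists M; rewrite ?h ?h'.
Qed.

End Times.

(** Inner points of edges are not vertices, so the times of the vertices are
determined one after the other, and an edge is the face of any inner point. *)
Lemma traces_unique p (g h : gallery R n) : traces D p g -> traces D p h -> g = h.
Proof.
move=> [t [t0 tN tlt tV tE]] [s [s0 sN slt sV sE]].
have eqt : forall k, (k <= nedges g)%N -> (k <= nedges h)%N /\ t k = s k.
  elim=> [|k IH] hk; first by rewrite t0 s0.
  have [hkh ek] := IH (ltnW hk).
  have htS := tlt k hk.
  have hkh' : (k < nedges h)%N.
    rewrite ltn_neqAle hkh andbT; apply/eqP => e1.
    have := times01 t0 tN tlt hk; rewrite -sN -e1 -ek; lra.
  split=> //; have hsS := slt k hkh'.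
  have [h1|h1|//] := ltgtP (t k.+1) (s k.+1).
    have [he ho] := sE k hkh'; have [hv ev] := tV k.+1 hk.
    have := ho (t k.+1); rewrite -ek htS h1 ev => /(_ isT) hop.
    by have := edge_not_vertex he hop.
  have [he ho] := tE k hk; have [hv ev] := sV k.+1 hkh'.
  have := ho (s k.+1); rewrite ek hsS h1 ev => /(_ isT) hop.
  by have := edge_not_vertex he hop.
have eN : nedges g = nedges h.
  have [h1 e1] := eqt _ (leqnn _); apply/eqP; rewrite eqn_leq h1 leqNgt.
  by apply/negP => h2; have := times_lt slt (k := nedges g) (l := nedges h);
    rewrite h2 leqnn -e1 tN sN ltxx => /(_ isT).
have eV k : (k <= nedges g)%N -> vtx g k = vtx h k.
  move=> hk; have [hkh ek] := eqt k hk.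
  by have [_ <-] := tV k hk; have [_ <-] := sV k hkh; rewrite ek.
have eE k : (k < nedges g)%N -> edg g k = edg h k.
  move=> hk; have hkh : (k < nedges h)%N by rewrite -eN.
  have [_ ek] := eqt k (ltnW hk); have [_ ekS] := eqt k.+1 hk.
  have htS := tlt k hk; have hm : t k < (t k + t k.+1) / 2 < t k.+1.
    by apply/andP; split; lra.
  have [_ h1] := tE k hk; have [_ h2] := sE k hkh.
  have hm2 : s k < (t k + t k.+1) / 2 < s k.+1 by rewrite -ek -ekS.
  by have := h1 _ hm; have := h2 _ hm2; rewrite /open_face /= => -> ->.
rewrite [g]surjective_pairing [h]surjective_pairing; congr pair.
  exact: (eV 0%N).
apply: (@eq_from_nth _ (set0, 0)); first exact: eN.
move=> k hk; have hk' : (k < size h.2)%N by rewrite -[size _]eN.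
have := eE k hk; have := eV k.+1 hk.
rewrite /vtx /edg /vertices /edges /= /unzip1 /unzip2.
rewrite !(nth_map (set0, 0)) //.
by case: nth => ? ?; case: nth => ? ? /= -> ->.
Qed.

Lemma gallery_of_pathE p g : traces D p g -> gallery_of_path D p = g.
Proof.
by move=> h; apply: xget_unique => // h' h''; exact: (traces_unique h'' h).
Qed.

(** [traces] with the open faces spelled out: on the [k]-th time interval the path is
an arbitrary function into the open [k]-th edge. *)
Definition runs_along t p e (N : nat) :=
  [/\ t 0%N = 0, t N = 1, forall k, (k < N)%N -> t k < t k.+1,
      forall k, (k <= N)%N -> p (t k) = psum e k
    & forall k u, (k < N)%N -> t k < u < t k.+1 ->
        exists2 r, 0 < r < 1 & p u = psum e k + r *: e k].

Variables (e0 : nat -> A) (N : nat).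
Hypothesis hb : base_gallery D e0 N.
Local Notation LS_disp := (LS_disp D omega e0 N).
Local Notation conj_base := (conj_base D e0 N).

Lemma runs_traces e t p : conj_base e -> runs_along t p e N -> traces D p (disp_gallery e N).
Proof.
move=> ht [t0 tN tlt tV tE]; exists t; rewrite nedges_disp_gallery; split=> // k hk.
  by rewrite vtx_disp_gallery // tV //; split=> //; apply/is_vertexP/(conj_base_vertex hb).
have he := conj_base_edge hb ht hk.
rewrite edg_disp_gallery //; split; first exact: is_edge_segment.
move=> u /(tE k u hk)[r hr ->]; rewrite /open_face /= he.2 //.
Qed.

Lemma traces_runs e p : conj_base e -> traces D p (disp_gallery e N) -> exists t, runs_along t p e N.
Proof.
move=> ht [t]; rewrite nedges_disp_gallery => -[t0 tN tlt tV tE].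
exists t; split=> // [k hk|k u hk hu].
  by have [_ ->] := tV k hk; rewrite vtx_disp_gallery.
have [_ h] := tE k hk; have := h u hu; rewrite edg_disp_gallery //.
have hv := conj_base_vertex hb ht (ltnW hk); have hvS := conj_base_vertex hb ht hk.
rewrite psumS in hvS.
by move/(open_segP _ (conj_base_edge hb ht hk) hv hvS).
Qed.

Variable i : 'I_n.
Local Notation height e k := (wall_height D i e k).

(** A height that is extremal, or integral, at an inner point of an edge is constant
along that edge; so the two parameters in the definition of the root operator are
times of vertices. *)
Lemma root_op_lowering e t p q : LS_disp e -> runs_along t p e N -> root_op D (alpha i) p q ->
  exists P Q, lowering_block D N i e P Q /\
  q = fun u => if u <= t P then p u
               else if u <= t Q then p (t P) + act (refl D (alpha i)) (p u - p (t P))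
               else p u - rc (alpha i).
Proof.
move=> he [t0 tN tlt tV tE].
move=> [u0 [u1 [[hu0 hmin hlast] hdef [hu1 hh1 hfirst] ->]]].
have ai := simple_root D i; have ht := LS_disp_typed he.
have hH k : (k <= N)%N -> pairing (alpha i) (p (t k)) = height e k.
  by move=> hk; rewrite tV.
have hHr k u : (k < N)%N -> t k < u < t k.+1 -> exists2 r, 0 < r < 1 &
    pairing (alpha i) (p u) = height e k + r * pairing (alpha i) (e k).
  move=> hk hu; have [r hr ->] := tE k u hk hu.
  by exists r => //; rewrite pairingD pairingZ.
have t01 k : (k <= N)%N -> 0 <= t k <= 1 := fun hk => times01 t0 tN tlt hk.
have tltE k l : (k <= N)%N -> (l <= N)%N -> (t k < t l) = (k < l)%N.
  exact: (times_ltE tlt).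
(* the last minimum is attained at a vertex *)
have [P hPN eP] : exists2 P, (P <= N)%N & u0 = t P.
  have [//|[k hk hku]] := times_locate t0 tN hu0.
  have [r hr er] := hHr k u0 hk hku.
  have h1 := hmin _ (t01 k (ltnW hk)); have h2 := hmin _ (t01 k.+1 hk).
  rewrite er hH ?(ltnW hk) // in h1; rewrite er hH // heightS in h2.
  have c0 : pairing (alpha i) (e k) = 0 by move: hr => /andP[r0 r1]; nra.
  have := hlast (t k.+1); have /andP[_ ->] := t01 k.+1 hk.
  have /andP[_ ->] := hku; move=> /(_ isT) /eqP; case.
  by rewrite er hH // heightS c0 mulr0.
subst u0; rewrite !hH // in hdef hh1 hmin hlast hfirst.
have fmin k : (k <= N)%N -> height e P <= height e k.
  by move=> hk; rewrite -(hH k hk); apply: hmin; exact: t01.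
have flast k : (P < k <= N)%N -> height e P < height e k.
  move=> /andP[h1 h2]; rewrite lt_neqAle fmin // andbT eq_sym.
  rewrite -(hH k h2); apply: hlast; rewrite tltE // h1.
  by have /andP[_ ->] := t01 k h2.
have fint : height e P \is a Num.int.
  have [P0|P0] := posnP P; first by rewrite P0 height0 rpred0.
  have eP : height e P = height e P.-1 + pairing (alpha i) (e P.-1).
    by rewrite -heightS prednK.
  rewrite -(prednK P0); apply: (local_min_int omegaE hb he); rewrite ?prednK //.
    by have := fmin P.-1 ltac:(lia); lra.
  by move=> h; have := fmin P.+1 h; rewrite heightS; lra.
have hu1' : 0 <= u1 <= 1 by have hP01 := t01 P hPN; apply/andP; split; lra.
(* so is the first later point at which the height has grown by 1 *)
have [Q hQN eQ] : exists2 Q, (Q <= N)%N & u1 = t Q.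
  have [//|[k hk hku]] := times_locate t0 tN hu1'.
  have [r hr er] := hHr k u1 hk hku.
  have hPk : (P <= k)%N.
    by rewrite -ltnS -tltE //; have /andP[] := hu1; have /andP[] := hku; lra.
  rewrite er in hh1; have [c0|c0] := eqVneq (pairing (alpha i) (e k)) 0.
    rewrite c0 mulr0 addr0 in hh1.
    have hPk' : (P < k)%N.
      rewrite ltn_neqAle hPk andbT; apply/eqP => e1; rewrite e1 in hh1; lra.
    have := hfirst (t k); rewrite tltE ?hPk' ?(ltnW hk) //.
    have /andP[-> _] := hku; move=> /(_ isT) /eqP; case.
    by rewrite hH ?(ltnW hk).
  have /intrP[m em] := fint.
  have ed := conj_base_edge hb ht hk.
  have h1 := @no_cross _ _ D (alpha i) _ _ (m + 1) ai ed.
  have h2 := @no_cross_neg _ _ D (alpha i) _ _ (m + 1) ai ed.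
  rewrite intrD -em -hh1 -psumS -!/(height e _) heightS in h1 h2.
  move: hr => /andP[r0 r1].
  have [c1|c1|c1] := ltgtP (pairing (alpha i) (e k)) 0.
    by have := h2 ltac:(nra); nra.
    by have := h1 ltac:(nra); nra.
  by rewrite c1 eqxx in c0.
subst u1; rewrite hH // in hh1.
have hPQ : (P < Q)%N by rewrite -tltE //; have /andP[] := hu1.
have ffirst k : (P < k < Q)%N -> height e k < height e P + 1.
  move=> /andP[hPk hkQ].
  have hind d : (P + d < Q)%N -> height e (P + d)%N < height e P + 1.
    elim: d => [|d IH] hd; first by rewrite addn0 ltrDl.
    rewrite addnS in hd *.
    have hdN : (P + d < N)%N by apply: leq_trans hQN; exact: ltnW.
    have hlt := IH (ltnW hd); have /intrP[m em] := fint.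
    have := @no_cross _ _ D (alpha i) _ _ (m + 1) ai (conj_base_edge hb ht hdN).
    rewrite intrD -em -psumS -!/(height e _) => /(_ hlt).
    rewrite le_eqVlt => /orP[/eqP e1|//].
    have hin : t P < t (P + d).+1 < t Q by rewrite !tltE ?hd ?ltnS ?leq_addr.
    by have := hfirst _ hin; rewrite hH // e1 eqxx.
  by have := hind (k - P)%N; rewrite subnKC ?(ltnW hPk) //; apply.
by exists P, Q; split.
Qed.

Lemma lowering_runs e t p P Q : LS_disp e -> runs_along t p e N -> lowering_block D N i e P Q ->
  runs_along t (fun u => if u <= t P then p u
               else if u <= t Q then p (t P) + act (refl D (alpha i)) (p u - p (t P))
               else p u - rc (alpha i)) (reflect_block D i P Q e) N.
Proof.
move=> he [t0 tN tlt tV tE] h; have hPQ := f_lt h; have hQN := f_le h.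
have hP := f_int h; have hPN : (P <= N)%N by lia.
have hQ : height e Q \is a Num.int by rewrite (f_end h) rpredD ?rpred1.
have mid x : p (t P) + act (refl D (alpha i)) (x - p (t P)) =
    sr (alpha i) x + height e P *: rc (alpha i).
  rewrite act_refl srB tV // addrCA; congr (_ + _).
  by rewrite /root_reflection opprB addrCA subrr addr0.
have high k : (Q <= k)%N -> psum (reflect_block D i P Q e) k = psum e k - rc (alpha i).
  by move=> hk; rewrite psum_high // (f_end h) addrAC subrr add0r scale1r.
have tleE k l : (k <= N)%N -> (l <= N)%N -> (t k <= t l) = (k <= l)%N.
  exact: (times_leE tlt).
split=> // [k hk|k u hk hku].
  rewrite !tleE // (tV k) //; have [h1|h1] := leqP k P; first by rewrite psum_low.
  have [h2|h2] := leqP k Q; last by rewrite high // ltnW.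
  by rewrite mid psum_mid_sr // (ltnW h1).
have [r hr er] := tE k u hk hku; exists r => //; rewrite er.
have /andP[hku1 hku2] := hku.
have [h1|h1] := ltnP k P.
  have -> : u <= t P by have := tleE k.+1 P hk hPN; rewrite h1; lra.
  by rewrite psum_low ?block_low // ltnW.
have -> : (u <= t P) = false.
  by have := tleE P k hPN (ltnW hk); rewrite h1; lra.
have [h2|h2] := ltnP k Q.
  have -> : u <= t Q by have := tleE k.+1 Q hk hQN; rewrite h2; lra.
  rewrite mid psum_mid_sr ?h1 ?(ltnW h2) // block_mid ?h1 // srD srZ.
  exact: addrAC.
have -> : (u <= t Q) = false.
  by have := tleE Q k hQN (ltnW hk); rewrite h2; lra.
by rewrite high // block_high // addrAC.
Qed.

Lemma lowering_root_op e t p P Q : LS_disp e -> runs_along t p e N -> lowering_block D N i e P Q ->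
  root_op D (alpha i) p
    (fun u => if u <= t P then p u
              else if u <= t Q then p (t P) + act (refl D (alpha i)) (p u - p (t P))
              else p u - rc (alpha i)).
Proof.
move=> he [t0 tN tlt tV tE] h; have hPQ := f_lt h; have hQN := f_le h.
have ai := simple_root D i; have ht := LS_disp_typed he.
have hPN : (P <= N)%N by lia.
have hH k : (k <= N)%N -> pairing (alpha i) (p (t k)) = height e k.
  by move=> hk; rewrite tV.
have hHr k u : (k < N)%N -> t k < u < t k.+1 -> exists2 r, 0 < r < 1 &
    pairing (alpha i) (p u) = height e k + r * (height e k.+1 - height e k).
  move=> hk hu; have [r hr ->] := tE k u hk hu.
  exists r => //; rewrite pairingD pairingZ heightS; congr (_ + _ * _).
  by rewrite addrC addKr.
have t01 k : (k <= N)%N -> 0 <= t k <= 1 := fun hk => times01 t0 tN tlt hk.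
have tltE k l : (k <= N)%N -> (l <= N)%N -> (t k < t l) = (k < l)%N.
  exact: (times_ltE tlt).
exists (t P), (t Q); split.
- split; first exact: t01.
  + move=> u /(times_locate t0 tN)[[k hk ->]|[k hk hku]].
      by rewrite !hH //; exact: (f_min h).
    have [r hr ->] := hHr k u hk hku; rewrite hH //.
    have h1 := f_min h (ltnW hk); have h2 := f_min h hk.
    by move: hr => /andP[r0 r1]; nra.
  + move=> u /andP[hu1 hu2].
    have hu01 : 0 <= u <= 1 by have hP01 := t01 P hPN; apply/andP; split; lra.
    apply: contraTneq (isT) => heq; move: heq.
    have [[k hk eu]|[k hk hku]] := times_locate t0 tN hu01.
      rewrite eu !hH // in hu1 *; rewrite tltE // in hu1.
      by have := f_last h (k := k) ltac:(lia); lra.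
    have [r hr ->] := hHr k u hk hku; rewrite hH //.
    have hPk : (P <= k)%N by rewrite -ltnS -tltE //; have /andP[] := hku; lra.
    have hPk1 : (P < k.+1 <= N)%N by rewrite ltnS hPk hk.
    have h1 := f_min h (ltnW hk); have h2 := f_last h hPk1.
    by move: hr => /andP[r0 r1]; nra.
- have -> : pairing (alpha i) (p 1) = height e N by rewrite -tN hH.
  rewrite hH // lerBrDl; apply: int_ltD1; first exact: (f_int h).
    exact: (height_int_end hb _ he).
  by apply: (f_last h); rewrite leqnn andbT; exact: leq_trans hQN.
- split.
  + by rewrite tltE // hPQ; have /andP[] := t01 Q hQN.
  + by rewrite !hH // (f_end h).
  + move=> u /andP[hu1 hu2].
    have hu01 : 0 <= u <= 1.
      by have hP01 := t01 P hPN; have hQ01 := t01 Q hQN; apply/andP; split; lra.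
    apply: contraTneq (isT) => heq; move: heq.
    have [[k hk eu]|[k hk hku]] := times_locate t0 tN hu01.
      rewrite eu !hH // in hu1 hu2 *; rewrite !tltE // in hu1 hu2.
      by have := f_first h (k := k) ltac:(lia); lra.
    have [r hr ->] := hHr k u hk hku; rewrite hH //.
    have hPk : (P <= k)%N by rewrite -ltnS -tltE //; have /andP[] := hku; lra.
    have hkQ : (k < Q)%N by rewrite -tltE // ?(ltnW hk) //; have /andP[] := hku; lra.
    have h1 : height e k < height e P + 1.
      have [->|ne] := eqVneq k P; first by rewrite ltrDl.
      by apply: (f_first h); rewrite ltn_neqAle eq_sym ne hPk hkQ.
    have h2 : height e k.+1 <= height e P + 1.
      have [->|ne] := eqVneq k.+1 Q; first by rewrite (f_end h).
      by apply/ltW/(f_first h); rewrite ltnS hPk ltn_neqAle ne hkQ.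
    by move: hr => /andP[r0 r1]; nra.
- by [].
Qed.

End Paths.

(** * The straight gallery *)

Section Straight.
Context (R : realType) (n : nat) (D : rootDatum n) (omega : 'I_n -> 'cV[R]_n).
Hypothesis omegaE :
  forall i j, pairing (simple D j) (omega i) = (i == j)%:R.
Local Notation A := 'cV[R]_n.
Local Notation alpha := (simple D).
Implicit Types (a b : 'rV[int]_n) (x y v V f U z : A) (w : 'M[int]_n)
  (e : nat -> A) (k l : nat) (p q : R -> A) (t : nat -> R) (i : 'I_n).

Lemma disp_gallery_ext e e' N : (forall k, (k < N)%N -> e k = e' k) -> disp_gallery e N = disp_gallery e' N.
Proof.
move=> h; have hs k : (k <= N)%N -> psum e k = psum e' k.
  move=> hk; apply: eq_bigr => l _; apply: h; exact: leq_trans (ltn_ord l) hk.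
rewrite /disp_gallery; congr pair; apply: (@eq_from_nth _ (set0, 0)); rewrite ?size_mkseq //.
by move=> k hk; rewrite !nth_mkseq // h // !hs // ltnW.
Qed.

Section Cat.
Variables (e1 e2 : nat -> A) (N1 N2 : nat).

(** Displacements, unlike vertices, are concatenated without translation. *)
Definition disp_cat k : A := if (k < N1)%N then e1 k else e2 (k - N1)%N.

Lemma psum_cat_low k : (k <= N1)%N -> psum disp_cat k = psum e1 k.
Proof.
elim: k => [|k IH] hk; first by rewrite !psum0.
by rewrite !psumS IH ?(ltnW hk) // /disp_cat hk.
Qed.

Lemma psum_cat_high k : psum disp_cat (N1 + k) = psum e1 N1 + psum e2 k.
Proof.
elim: k => [|k IH]; first by rewrite addn0 psum_cat_low // psum0 addr0.
by rewrite addnS !psumS IH /disp_cat ltnNge leq_addr /= addKn addrA.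
Qed.

Lemma disp_gallery_cat : gcat (disp_gallery e1 N1) (disp_gallery e2 N2) = disp_gallery disp_cat (N1 + N2).
Proof.
rewrite /gcat target_disp_gallery /source /= subr0 /disp_gallery; congr pair.
apply: (@eq_from_nth _ (set0, 0)).
  by rewrite /mkseq size_cat !size_map !size_iota.
move=> k; rewrite size_cat size_mkseq !size_map !size_iota => hk.
rewrite nth_cat size_mkseq [in RHS]nth_mkseq //; case: ltnP => h1.
  by rewrite nth_mkseq // /disp_cat h1 !psum_cat_low // ltnW.
have hk2 : (k - N1 < N2)%N by rewrite ltn_subLR.
rewrite (nth_map (set0, 0)) ?size_mkseq // nth_mkseq //=.
have E1 : psum disp_cat k = psum e1 N1 + psum e2 (k - N1).
  by rewrite -psum_cat_high subnKC.
have E2 : psum disp_cat k.+1 = psum e1 N1 + psum e2 (k - N1).+1.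
  by rewrite -psum_cat_high addnS subnKC.
rewrite E1 E2 /disp_cat ltnNge h1 /=; congr pair; last exact: addrC.
apply/seteqP; split=> x /=.
  by move=> [_ [r hr <-] <-]; exists r => //; rewrite -addrA addrC.
move=> [r hr <-]; exists (psum e2 (k - N1) + r *: e2 (k - N1)%N); first by exists r.
by rewrite addrC addrA.
Qed.

Lemma vertex_at_shift V U : special D U -> vertex_at D V -> vertex_at D (U + V).
Proof.
by move=> hU hV; have := vertex_at_aff (@weyl1 _ D) hU hV; rewrite act1 addrC.
Qed.

Lemma edge_at_shift V U f : special D U -> edge_at D V f -> edge_at D (U + V) f.
Proof.
by move=> hU hV; have := edge_at_aff (@weyl1 _ D) hU hV; rewrite !act1 addrC.
Qed.

Lemma base_cat : base_gallery D e1 N1 -> base_gallery D e2 N2 -> base_gallery D disp_cat (N1 + N2).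
Proof.
move=> h1 h2; have hU := base_special h1.
have N10 := base_size h1; have N20 := base_size h2.
have hi k : (N1 <= k)%N -> psum disp_cat k = psum e1 N1 + psum e2 (k - N1).
  by move=> hk; rewrite -psum_cat_high subnKC.
split.
- by rewrite addn_gt0 N10.
- move=> k hk; have [hk1|hk1] := leqP k N1.
    by rewrite psum_cat_low //; exact: (base_vert h1).
  by rewrite hi ?(ltnW hk1) //; apply: vertex_at_shift => //; apply: (base_vert h2); lia.
- move=> k hk; rewrite /disp_cat; case: ltnP => hk1.
    by rewrite psum_cat_low ?(ltnW hk1) //; exact: (base_edge h1).
  by rewrite hi //; apply: edge_at_shift => //; apply: (base_edge h2); lia.
- move=> k hk; rewrite /disp_cat; case: ltnP => hk1; first exact: (base_dom h1).
  by apply: (base_dom h2); lia.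
- move=> k a hk ha; rewrite /disp_cat; case: ltnP => hk1.
    by rewrite psum_cat_low ?(ltnW hk1) //; exact: (base_int h1).
  rewrite hi // pairingD => h; apply: rpredD; first by move/specialP: hU; apply.
  by apply: (base_int h2) => //; lia.
- move=> k hk; rewrite /disp_cat; have [hk1|hk1|hk1] := ltngtP k.+1 N1.
  + by rewrite psum_cat_low ?(ltnW hk1) //; exact: (base_turn h1).
  + rewrite hi ?(ltnW hk1) // subSn //.
    have [|hs|hc] := @base_turn _ _ _ _ _ h2 (k - N1)%N; first by lia.
      by left; apply: specialD.
    by right.
  + by left; rewrite hk1 psum_cat_low.
- move=> k hk; have [hk1|hk1] := leqP k N1.
    by rewrite psum_cat_low //; exact: (base_rat h1).
  have [|M M0 hM] := @base_rat _ _ _ _ _ h2 (k - N1)%N; first by lia.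
  exists M => // a ha; rewrite hi ?(ltnW hk1) // pairingD mulrDr rpredD //.
    by rewrite rpredM ?natr_int //; move/specialP: hU; apply.
  exact: hM.
- by rewrite psum_cat_high; apply: specialD => //; exact: (base_special h2).
Qed.

(** The first path runs at double speed until 1/2, the second one afterwards. *)
Lemma runs_cat t1 t2 p q : (0 < N1)%N -> (0 < N2)%N ->
    runs_along t1 p e1 N1 -> runs_along t2 q e2 N2 ->
  runs_along (fun k => if (k <= N1)%N then t1 k / 2 else (1 + t2 (k - N1)%N) / 2)
       (path_cat p q) disp_cat (N1 + N2).
Proof.
move=> N10 N20 [t10 t1N t1lt t1V t1E] [t20 t2N t2lt t2V t2E].
have b1 k : (k <= N1)%N -> 0 <= t1 k <= 1 := fun hk => times01 t10 t1N t1lt hk.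
have b2 k : (k <= N2)%N -> 0 <= t2 k <= 1 := fun hk => times01 t20 t2N t2lt hk.
have hi k : (N1 <= k)%N -> psum disp_cat k = psum e1 N1 + psum e2 (k - N1).
  by move=> hk; rewrite -psum_cat_high subnKC.
have p1 : p 1 = psum e1 N1 by rewrite -t1N t1V.
have joint : (1 + t2 0%N) / 2 = t1 N1 / 2 :> R by rewrite t20 t1N addr0.
have thigh k : (N1 <= k)%N -> (if (k <= N1)%N then t1 k / 2 else (1 + t2 (k - N1)%N) / 2) =
    (1 + t2 (k - N1)%N) / 2.
  move=> hk; case: leqP => // hk'.
  have -> : k = N1 by apply/eqP; rewrite eqn_leq hk hk'.
  by rewrite subnn joint.
split.
- by rewrite leq0n t10 mul0r.
- by rewrite thigh ?leq_addr // addKn t2N; field.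
- move=> k hk; have [hk1|hk1] := ltnP k N1.
    by rewrite (ltnW hk1) ltr_pM2r ?invr_gt0 ?ltr0n //; exact: t1lt.
  rewrite !thigh ?(leqW hk1) // ltr_pM2r ?invr_gt0 ?ltr0n // ltrD2l subSn //.
  by apply: t2lt; lia.
- move=> k hk; rewrite /path_cat; have [hk1|hk1] := leqP k N1.
    have /andP[_ h] := b1 k hk1.
    have -> : t1 k / 2 <= 2^-1 by lra.
    have -> : 2 * (t1 k / 2) = t1 k by field.
    by rewrite t1V // psum_cat_low.
  have hk2 : (k - N1 <= N2)%N by lia.
  have ht0 : 0 < t2 (k - N1)%N by rewrite -t20; apply: (times_lt t2lt); lia.
  have -> : ((1 + t2 (k - N1)%N) / 2 <= 2^-1) = false by apply/negbTE; rewrite -ltNge; lra.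
  have -> : 2 * ((1 + t2 (k - N1)%N) / 2) - 1 = t2 (k - N1)%N by field.
  by rewrite p1 t2V // hi // ltnW.
move=> k u hk; have [hk1|hk1] := ltnP k N1.
  rewrite (ltnW hk1) => /andP[h1 h2].
  have /andP[_ b] := b1 k.+1 hk1.
  have [|r hr er] := t1E k (2 * u) hk1; first by apply/andP; split; lra.
  exists r => //; rewrite /path_cat psum_cat_low ?(ltnW hk1) // /disp_cat hk1 -er.
  by have -> : u <= 2^-1 by lra.
rewrite !thigh ?(leqW hk1) // subSn // => /andP[h1 h2].
have hk2 : (k - N1 < N2)%N by lia.
have /andP[b _] := b2 (k - N1)%N (ltnW hk2).
have [|r hr er] := t2E (k - N1)%N (2 * u - 1) hk2; first by apply/andP; split; lra.
exists r => //; rewrite /path_cat hi // /disp_cat ltnNge hk1 /= -addrA -er p1.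
have -> // : (u <= 2^-1) = false by apply/negbTE; rewrite -ltNge; lra.
Qed.

End Cat.

Section Single.
Variable i : 'I_n.
Local Notation om := (omega i).

(** All crossings on the ray through [om] then have parameters in [1/M] times the
integers. *)
Lemma common_multiple (l : seq 'rV[int]_n) : {subset l <= roots D} ->
  exists2 M : nat, (0 < M)%N & forall a, a \in l -> pairing a om != 0 ->
    M%:R / pairing a om \is a Num.int.
Proof.
elim: l => [|a l IH] hl; first by exists 1%N.
have [|M M0 hM] := IH; first by move=> b hb; apply: hl; rewrite inE hb orbT.
have [a0|a0] := eqVneq (pairing a om) 0.
  exists M => // b; rewrite inE => /orP[/eqP ->|/hM //]; by rewrite a0 eqxx.
have ha : a \in roots D by apply: hl; rewrite inE eqxx.
have /intrP[z ez] := root_int_omega omegaE i ha.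
have z0 : z != 0 by move: a0; rewrite ez intr_eq0.
exists (M * `|z|)%N; first by rewrite muln_gt0 M0 absz_gt0.
move=> b; rewrite inE => /orP[/eqP ->|hb] hbn.
  rewrite natrM -mulrA rpredM ?natr_int // ez natr_absz intr_norm.
  have zR : z%:~R != 0 :> R by rewrite intr_eq0.
  have [h|h] := ger0P (z%:~R : R); rewrite ?mulNr divff ?rpredN ?rpred1 //.
by rewrite natrM mulrAC rpredM ?natr_int // hM.
Qed.

(** The wall [<a, x> = m] meets the ray transversally in [r *: om].  Walls containing
the whole ray are excluded. *)
Definition crosses_at (r : R) := exists2 a, a \in roots D &
  pairing a om != 0 /\ r * pairing a om \is a Num.int.

(** The simple roots other than [alpha i] vanish on the ray, and the corresponding
walls cut out the line. *)
Lemma line_on y r : face_at D (r *: om) y -> y = pairing (alpha i) y *: om.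
Proof.
move=> hy; apply: (simple_ext omegaE) => j; rewrite pairingZ omegaE.
have [<-|ji] := eqVneq i j; first by rewrite mulr1.
have [h1 h2] := hy (alpha j) 0 (simple_root D j).
move: h1 h2; rewrite /hyp_pos /hyp_neg /= !addr0 pairingZ omegaE (negPf ji) !mulr0.
by move=> /(_ (lexx _)) h1 /(_ (lexx _)) h2; apply/eqP; rewrite eq_le h1 h2.
Qed.

Lemma crossing_vertex r : crosses_at r -> vertex_at D (r *: om).
Proof.
move=> [a ha [a0 /intrP[m em]]]; apply/seteqP; split=> y /=; last first.
  by move=> ->; exact: face_at_refl.
move=> hy; have ey := line_on hy; set c := pairing _ _ in ey.
rewrite ey; congr (_ *: _).
have [h1 h2] := hy a (- m) ha; move: h1 h2; rewrite /hyp_pos /hyp_neg /=.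
rewrite pairingZ em mulrNz subrr ey pairingZ -em -mulrBl.
move=> /(_ (lexx _)) h1 /(_ (lexx _)) h2.
have : (c - r) * pairing a om = 0 by apply/eqP; rewrite eq_le h1 h2.
by move/eqP; rewrite mulf_eq0 (negPf a0) orbF subr_eq0 => /eqP.
Qed.

Lemma om_neq0 : om != 0.
Proof.
apply/eqP => h; have := omegaE i i; rewrite h pairing0 eqxx => /eqP.
by rewrite eq_sym oner_eq0.
Qed.

Lemma crossing_pos r : crosses_at r -> exists a m, [/\ a \in roots D,
  0 < pairing a om & r * pairing a om = m%:~R].
Proof.
move=> [a ha [a0 /intrP[m em]]]; have [h|h|h] := ltgtP 0 (pairing a om).
- by exists a, m.
- exists (- a), (- m); rewrite pairingNl oppr_gt0 mulrN em mulrNz.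
  by split=> //; exact: opp_root.
- by rewrite -h eqxx in a0.
Qed.

(** If a half-space contained an inner point of the segment but not all of it, its
wall would cross the ray strictly between [r] and [s]. *)
Lemma crossing_edge r s : r < s -> crosses_at r -> crosses_at s ->
  (forall u, r < u < s -> ~ crosses_at u) -> edge_at D (r *: om) ((s - r) *: om).
Proof.
move=> rs hr hs hno; split.
  by rewrite scaler_eq0 negb_or om_neq0 subr_eq0 gt_eqF.
move=> t /andP[t0 t1]; rewrite scalerA -scalerDl; set u := r + _.
have ru : r < u by rewrite /u ltrDl mulr_gt0 // subr_gt0.
have us : u < s by rewrite /u; nra.
apply/seteqP; split=> y /=.
  move=> hy; have ey := line_on hy; set c := pairing _ _ in ey.
  have rc : r <= c.
    have [a [m [ha a0 em]]] := crossing_pos hr.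
    have [h _] := hy a (- m) ha; move: h.
    rewrite /hyp_pos /= ey !pairingZ mulrNz !subr_ge0 -em !ler_pM2r //.
    by apply; exact: ltW.
  have cs : c <= s.
    have [a [m [ha a0 em]]] := crossing_pos hs.
    have [_ h] := hy a (- m) ha; move: h.
    rewrite /hyp_neg /= ey !pairingZ mulrNz !subr_le0 -em !ler_pM2r //.
    by apply; exact: ltW.
  exists ((c - r) / (s - r)) => /=.
    by rewrite divr_ge0 ?subr_ge0 ?(ltW rs) //= ler_pdivrMr ?subr_gt0 // mul1r lerD2r.
  rewrite scalerA -scalerDl ey; congr (_ *: _).
  by rewrite divfK ?subr_eq0 ?gt_eqF // addrC subrK.
move=> [v /andP[v0 v1] <-]; rewrite scalerA -scalerDl; set c := r + _.
have rc : r <= c by rewrite lerDl mulr_ge0 // subr_ge0 ltW.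
have cs : c <= s by rewrite /c; nra.
have key a m : a \in roots D -> 0 <= u * pairing a om + m%:~R ->
    0 <= c * pairing a om + m%:~R.
  move=> ha hu; rewrite leNgt; apply/negP => hc.
  have a0 : pairing a om != 0.
    by apply/eqP => a0; move: hu hc; rewrite a0 !mulr0; lra.
  have hb : crosses_at (- m%:~R / pairing a om).
    by exists a => //; split=> //; rewrite divfK // rpredN intr_int.
  apply: (hno _ _ hb).
  have [h|h|h] := ltgtP (pairing a om) 0; last by rewrite h eqxx in a0.
    rewrite ltr_ndivlMr // ltr_ndivrMr //.
    by apply/andP; split; nra.
  rewrite ltr_pdivlMr // ltr_pdivrMr //.
  by apply/andP; split; nra.
move=> a m ha; split; first by rewrite /hyp_pos /= !pairingZ; exact: key.
have := key (- a) (- m) (opp_root ha); rewrite /hyp_neg /= !pairingZ !pairingNl.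
by rewrite !mulrN mulrNz -!opprD !oppr_ge0.
Qed.

(** Take the crossings among the points [k / M], in increasing order. *)
Lemma base_single : exists e N t, [/\ base_gallery D e N, psum e N = om &
  runs_along t (line_path om) e N].
Proof.
have [M M0 hM] := common_multiple (fun a (h : a \in roots D) => h).
have MR : 0 < M%:R :> R by rewrite ltr0n.
pose ks := [seq k <- iota 0 M.+1 | `[< crosses_at (k%:R / M%:R) >]].
have mem_ks k : (k \in ks) = (k <= M)%N && `[< crosses_at (k%:R / M%:R) >].
  by rewrite mem_filter mem_iota add0n /= ltnS andbC.
have ks_sorted : sorted ltn ks.
  by apply: sorted_filter; [exact: ltn_trans | exact: iota_ltn_sorted].
have ai1 : pairing (alpha i) om = 1 by rewrite omegaE eqxx.
have brk r : r \is a Num.int -> crosses_at r.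
  by move=> hr; exists (alpha i); rewrite ?simple_root // ai1 mulr1 oner_neq0.
have ks0 : 0%N \in ks by rewrite mem_ks /=; apply/asboolP; rewrite mul0r; apply: brk.
have ksM : M \in ks.
  by rewrite mem_ks leqnn; apply/asboolP; rewrite divff ?gt_eqF //; apply: brk.
have kslt j l : (j < l)%N -> (l < size ks)%N -> (nth 0%N ks j < nth 0%N ks l)%N.
  move=> jl hl; apply: (sorted_ltn_nth ltn_trans 0%N ks_sorted) => //.
  by rewrite inE; exact: ltn_trans hl.
have ksle j l : (j < size ks)%N -> (l < size ks)%N ->
    (nth 0%N ks j < nth 0%N ks l)%N -> (j < l)%N.
  move=> hj hl h; rewrite ltnNge leq_eqVlt; apply/negP => /orP[/eqP e|h'].
    by move: h; rewrite e ltnn.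
  by have := kslt _ _ h' hj; rewrite ltnNge (ltnW h).
have first0 : nth 0%N ks 0 = 0%N.
  have [|h] := posnP (index 0%N ks); first by move=> e; rewrite -[in LHS]e nth_index.
  by have := kslt _ _ h; rewrite index_mem nth_index // => /(_ ks0).
have sz : (1 < size ks)%N.
  have h1 : (index M ks < size ks)%N by rewrite index_mem.
  have : (0 < index M ks)%N.
    by rewrite lt0n; apply/eqP => e; move: M0; rewrite -(nth_index 0%N ksM) e first0.
  by lia.
set N := (size ks).-1.
have NE : size ks = N.+1 by rewrite prednK //; lia.
have lastM : nth 0%N ks N = M.
  have h1 : (index M ks < size ks)%N by rewrite index_mem.
  have : (index M ks <= N)%N by rewrite -ltnS -NE.
  rewrite leq_eqVlt => /orP[/eqP <-|h]; first exact: nth_index.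
  have hN : (N < size ks)%N by rewrite NE.
  have := kslt _ _ h hN; rewrite nth_index //.
  have := mem_nth 0%N hN; rewrite mem_ks => /andP[h2 _] h3.
  by have := leq_trans h3 h2; rewrite ltnn.
pose T j : R := (nth 0%N ks j)%:R / M%:R.
pose e j : A := (T j.+1 - T j) *: om.
have T0 : T 0%N = 0 by rewrite /T first0 mul0r.
have TN : T N = 1 by rewrite /T lastM divff // gt_eqF.
have Tlt j : (j < N)%N -> T j < T j.+1.
  move=> hj; rewrite /T ltr_pM2r ?invr_gt0 // ltr_nat; apply: kslt => //.
  by rewrite NE ltnS.
have Tb j : (j <= N)%N -> crosses_at (T j).
  move=> hj; have : nth 0%N ks j \in ks by apply: mem_nth; rewrite NE ltnS.
  by rewrite mem_ks => /andP[_ /asboolP].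
have T01 j : (j <= N)%N -> 0 <= T j <= 1 := fun hj => times01 T0 TN Tlt hj.
have Tno j u : (j < N)%N -> T j < u < T j.+1 -> ~ crosses_at u.
  move=> hj /andP[u0 u1] [a ha [a0 hu]].
  have uM : u * M%:R \is a Num.int.
    have -> : u * M%:R = (u * pairing a om) * (M%:R / pairing a om) by field.
    by rewrite rpredM // hM.
  have u00 : 0 <= u by have := T01 j (ltnW hj); lra.
  have u11 : u <= 1 by have := T01 j.+1 hj; lra.
  have [k ek] : exists k : nat, u * M%:R = k%:R.
    apply/natrP; rewrite natrEint uM mulr_ge0 //; exact: ltW.
  have uk : u = k%:R / M%:R by rewrite -ek mulfK // gt_eqF.
  have hk : k \in ks.
    rewrite mem_ks -(ler_nat R) -ek ler_piMl ?(ltW MR) //=; apply/asboolP.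
    by rewrite mulfK ?gt_eqF //; exists a.
  have hki : (index k ks < size ks)%N by rewrite index_mem.
  rewrite uk /T !ltr_pM2r ?invr_gt0 // !ltr_nat -(nth_index 0%N hk) in u0 u1.
  have hj1 : (j < size ks)%N by rewrite NE ltnS ltnW.
  have hj2 : (j.+1 < size ks)%N by rewrite NE ltnS.
  by have := ksle _ _ hki hj2 u1; rewrite ltnS leqNgt (ksle _ _ hj1 hki u0).
have eV k : psum e k = T k *: om.
  elim: k => [|k IH]; first by rewrite psum0 T0 scale0r.
  by rewrite psumS IH /e -scalerDl addrC subrK.
have Tpos j : (j < N)%N -> 0 < T j.+1 - T j by move=> hj; rewrite subr_gt0; exact: Tlt.
exists e, N, T; split.
- split.
  + by rewrite /N; lia.
  + by move=> k hk; rewrite eV; apply/crossing_vertex/Tb.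
  + move=> k hk; rewrite eV; apply: crossing_edge; [exact: Tlt | exact/Tb/ltnW | exact: Tb |].
    by move=> u; exact: Tno.
  + by move=> k hk; apply: chamberZ; [exact/ltW/Tpos | exact: (chamber_omega omegaE)].
  + move=> k a hk ha; rewrite eV !pairingZ => /eqP; rewrite mulf_eq0 gt_eqF ?Tpos //=.
    by move=> /eqP ->; rewrite mulr0.
  + move=> k hk; right; exists ((T k.+2 - T k.+1) / (T k.+1 - T k)).
      by rewrite divr_gt0 ?Tpos // ltnW.
    by rewrite /e scalerA divfK // gt_eqF // Tpos // ltnW.
  + move=> k hk; exists M => // a ha; rewrite eV pairingZ mulrA /T [M%:R * _]mulrC.
    rewrite divfK ?gt_eqF //.
    by rewrite rpredM ?natr_int //; exact: (root_int_omega omegaE).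
  + rewrite eV TN scale1r; apply/specialP => a ha.
    exact: (root_int_omega omegaE).
- by rewrite eV TN scale1r.
- split=> // k u hk /andP[h1 h2].
  exists ((u - T k) / (T k.+1 - T k)).
    by rewrite divr_gt0 ?Tpos ?subr_gt0 //= ltr_pdivrMr ?Tpos // mul1r ltrD2r.
  rewrite eV /e scalerA divfK ?gt_eqF ?Tpos // -scalerDl /line_path.
  by congr (_ *: _); rewrite addrC subrK.
Qed.

End Single.

Lemma base_exists (s : seq 'I_n) : s != [::] -> exists e N t,
  [/\ base_gallery D e N,
      gconcat [seq gallery_of_path D (line_path x) | x <- map omega s] = disp_gallery e N,
      \sum_(x <- map omega s) x = psum e N &
      runs_along t (path_concat (map (@line_path R n) (map omega s))) e N].
Proof.
elim: s => // i s IH _.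
have [e1 [N1 [t1 [h1 s1 r1]]]] := base_single i.
have g1 : gallery_of_path D (line_path (omega i)) = disp_gallery e1 N1.
  apply: gallery_of_pathE; apply: (runs_traces h1) r1.
  exact: LS_disp_typed (LS_disp_base omegaE h1).
case: s IH => [|j s] IH.
  exists e1, N1, t1; split=> //; last by rewrite big_cons big_nil addr0.
  rewrite /= g1 /gcat /= /disp_gallery cats0 //.
have [//|e2 [N2 [t2 [h2 g2 s2 r2]]]] := IH.
exists (disp_cat e1 e2 N1), (N1 + N2)%N,
  (fun k => if (k <= N1)%N then t1 k / 2 else (1 + t2 (k - N1)%N) / 2); split.
- exact: base_cat.
- rewrite -disp_gallery_cat -g1 -g2 //.
- by rewrite map_cons big_cons s2 psum_cat_high s1.
- apply: runs_cat => //; [exact: base_size h1 | exact: base_size h2].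
Qed.

End Straight.

(** * The path model *)

Section Model.
Context (R : realType) (n : nat) (D : rootDatum n) (omega : 'I_n -> 'cV[R]_n).
Hypothesis omegaE :
  forall i j, pairing (simple D j) (omega i) = (i == j)%:R.
Variables (ws : seq 'cV[R]_n) (e0 : nat -> 'cV[R]_n) (N : nat) (t0 : nat -> R).
Hypothesis hb : base_gallery D e0 N.
Hypothesis runs0 : runs_along t0 (path_concat (map (@line_path R n) ws)) e0 N.
Local Notation LS_disp := (LS_disp D omega e0 N).

Lemma path_model_disp p : path_model D ws p -> exists2 e, LS_disp e & traces D p (disp_gallery e N).
Proof.
elim=> [|i p' q _ [e he htr] hop].
  exists e0; first exact: LS_disp_base.
  exact: (runs_traces hb (LS_disp_typed (LS_disp_base omegaE hb)) runs0).
have [t hr] := traces_runs hb (LS_disp_typed he) htr.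
have [P [Q [hf ->]]] := root_op_lowering omegaE hb he hr hop.
have he' := LS_disp_lower omegaE hb he hf.
exists (reflect_block D i P Q e) => //; apply: (runs_traces hb (LS_disp_typed he')).
exact: (lowering_runs he hr hf).
Qed.

(** Induction on the number of crossings still missing from the bound [crossings_le]. *)
Lemma LS_disp_path_model e : LS_disp e -> exists2 p, path_model D ws p & traces D p (disp_gallery e N).
Proof.
move: {2}(N * size (pos_roots D) - crossings D N e)%N
  (erefl (N * size (pos_roots D) - crossings D N e)%N) => m.
elim/ltn_ind: m e => m IH e em he.
have [hbase|[i [P [Q hE]]]] := LS_disp_cases omegaE hb he.
  rewrite (disp_gallery_ext hbase); exists (path_concat (map (@line_path R n) ws)).
    exact: path_model_start.
  exact: (runs_traces hb (LS_disp_typed (LS_disp_base omegaE hb)) runs0).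
have he' := LS_disp_raise omegaE hb he hE; have hF := raising_lowering omegaE hE.
(* the block starts on a wall of alpha i and now ascends from it *)
have hsharp : crossings D N (reflect_block D i P Q e) = (crossings D N e).+1.
  have hni k (hk : (P < k < Q)%N) := raising_nonint hE hk.
  have := crossings_block omegaE (e_lt hE) (e_le hE) (e_int hE) (raising_int_end hE) hni.
  have hPP : (P <= P < Q)%N by rewrite leqnn (e_lt hE).
  have hd := raising_descends omegaE hb he hE hPP.
  by rewrite /= hd ltNge (ltW hd) /= addn0 addn1.
have hle := crossings_le D N (reflect_block D i P Q e).
have m0 : (m.-1 < m)%N by rewrite prednK // -em subn_gt0 -hsharp.
have em' : (N * size (pos_roots D) - crossings D N (reflect_block D i P Q e))%N = m.-1.
  by rewrite hsharp subnS em.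
have [p hp htr] := IH _ m0 _ em' he'.
have [t hr] := traces_runs hb (LS_disp_typed he') htr.
have hop := lowering_root_op hb he' hr hF.
have hq := lowering_runs he' hr hF; rewrite blockK in hq.
eexists; first exact: (path_model_op hp hop).
exact: (runs_traces hb (LS_disp_typed he) hq).
Qed.

End Model.

Theorem corollary3 (R : realType) (n : nat) (D : rootDatum n)
    (omega : 'I_n -> 'cV[R]_n)
    (omegaE : forall i j, pairing (simple D j) (omega i) = (i == j)%:R)
    (s : seq 'I_n) (s_neq0 : s != [::]) :
  [set gallery_of_path D p | p in path_model D (map omega s)] =
  LS_gallery D (map omega s).
Proof.
have [e0 [N [t0 [hb hcat hsum hruns]]]] := base_exists omegaE s_neq0.
apply/seteqP; split=> d /=.
  move=> [p /(path_model_disp omegaE hb hruns)[e he htr] <-].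
  rewrite (gallery_of_pathE htr).
  exact: (LS_disp_gallery omegaE hb hcat hsum he).
move=> /(LS_gallery_disp omegaE hb hcat hsum)[e he ->].
have [p hp htr] := LS_disp_path_model omegaE hb hruns he.
by exists p => //; exact: gallery_of_pathE.
Qed.
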